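(* Let $\mathscr T_\nu=\mathscr T_\nu(Y_1,Y_2,\alpha_1,\alpha_2)$ be the function defined in the context, with $Y_1,Y_2>0$ and $\nu$ fixed. As $\alpha_1,\alpha_2\to\infty$, $$\mathscr T_\nu\sim\frac1{Y_1}\sum_{k=0}^\infty\sum_{\ell=0}^{2k}p_{k,\ell}(\alpha_1,\alpha_2)\,\Phi(Y_2/Y_1,-\ell,0)_\nu ,$$ where $p_{k,\ell}(\alpha_1,\alpha_2)=\frac1{\ell!}\,\partial_x^\ell P_{2k}(x)\big|_{x=0}$ and $$P_{2k}(x)=\sum_{m=0}^k\frac1{\alpha_1^m\alpha_2^{k-m}}\binom{x+1}{m}\binom{-x}{k-m}B_m^{(2+x)}B_{k-m}^{(1-x)},$$ with $B_n^{(s)}$ the N\o rlund polynomials.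
   Context: For $\alpha_1,\alpha_2>0$, $Y_1,Y_2>0$ and $-\alpha_2<\operatorname{Re}\nu<\alpha_1$, $$\mathscr T_\nu=\frac{\alpha_1-1}{\alpha_1Y_1}\Bigl(F(1,2-\alpha_1;\alpha_2;-z)-\frac{z^\nu}{(\alpha_1-1)_{-\nu}(\alpha_2)_\nu}F(1,2-\alpha_1+\nu;\alpha_2+\nu;-z)\Bigr),\quad z=\frac{\alpha_2Y_2}{\alpha_1Y_1},$$ where $(s)_w=\Gamma(s+w)/\Gamma(s)$ and $F={}_2F_1$ is the Gauss hypergeometric function. N\o rlund polynomials: $B_n^{(s)}$ is defined by $\bigl(\tfrac{t}{e^t-1}\bigr)^s=\sum_{n\ge0}B_n^{(s)}\tfrac{t^n}{n!}$; it is a polynomial in $s$, and each $P_{2k}$ is a polynomial in $x$ of degree at most $2k$. Incomplete Lerch transcendent: $\Phi(z,s,\omega)_\nu=\Phi(z,s,\omega)-z^\nu\Phi(z,s,\omega+\nu)$, where $\Phi(z,s,\omega)=\sum_{k\ge0}(k+\omega)^{-s}z^k$ for $|z|<1$, extended by analytic continuation in $z$ (for $s=-\ell$, $\ell\in\{0,1,2,\dots\}$, it is a rational function of $z$ with its only pole at $z=1$, with $0^0=1$), and $\Phi(z,0,\omega)_\nu=(1-z^\nu)/(1-z)$. The removable singularity at $z=1$ is filled by continuity. The symbol $\sim$ denotes a Poincar\'e-type asymptotic expansion ordered by $k$ (the $k$-th term being homogeneous of degree $k$ in $(1/\alpha_1,1/\alpha_2)$): for every $K\ge0$ the difference of $\mathscr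 T_\nu$ and the partial sum over $k\le K$ is $O\bigl((1/\alpha_1+1/\alpha_2)^{K+1}\bigr)$. *)

(* Defs.v *)
(* Stdlib reals with Coquelicot; [C] is Coquelicot's field of complex numbers. *)
From Stdlib Require Import Reals Factorial Lra ClassicalEpsilon.
From Coquelicot Require Import Coquelicot.
Open Scope R_scope.

(** * Elementary complex functions *)

Definition Cexp (z : C) : C :=
  (exp (Re z) * cos (Im z), exp (Re z) * sin (Im z)).

(* Principal power; only meant for a positive real base. *)
Definition Rcpow (x : R) (w : C) : C := Cexp (w * ln x)%C.

Fixpoint rising (s : C) (n : nat) : C :=
  match n with
  | O => RtoC 1
  | S m => (rising s m * (s + INR m))%C
  end.

(* Limits of a sequence and at a real point (punctured), taken componentwise. *)
Definition CLim_seq (u : nat -> C) : C :=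
  (real (Lim_seq (fun n => Re (u n))), real (Lim_seq (fun n => Im (u n)))).

Definition CLim (f : R -> C) (x : R) : C :=
  (real (Lim (fun t => Re (f t)) x), real (Lim (fun t => Im (f t)) x)).

(* Euler's limit  Gamma(s) = lim n! n^s / (s (s+1) ... (s+n)),
   valid for every s outside {0, -1, -2, ...}. *)
Definition CGamma (s : C) : C :=
  CLim_seq (fun n => (INR (fact n) * Rcpow (INR n) s / rising s (S n))%C).

Definition poch (s w : C) : C := (CGamma (s + w) / CGamma s)%C.

(** * Analytic continuation of a power series from the unit disc *)

Definition analytic_at (g : C -> C) (w0 : C) : Prop :=
  exists (a : nat -> C) (r : posreal), forall w : C,
    Cmod (w - w0) < r ->
    is_pseries (K := C_AbsRing) (V := C_NormedModule) a (w - w0)%C (g w).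

(* [g] is the analytic continuation to [D] of [sum_n a_n w^n].  It is used only
   for connected open [D] containing the unit disc, where [g] is then unique. *)
Definition continues (D : C -> Prop) (a : nat -> C) (g : C -> C) : Prop :=
  (forall w : C, Cmod w < 1 ->
     is_pseries (K := C_AbsRing) (V := C_NormedModule) a w (g w)) /\
  (forall w : C, D w -> analytic_at g w).

Definition cut_plane (w : C) : Prop := ~ (Im w = 0 /\ 1 <= Re w).

Definition punctured_plane (w : C) : Prop := w <> RtoC 1.

(** * The Gauss hypergeometric function *)

(* [F] is the principal branch of 2F1: for all parameters for which the series
   makes sense, [F a b c] is its analytic continuation to C \ [1, +oo).  This
   determines [F a b c w] for every [w] in the cut plane. *)
Definition is_Gauss_2F1 (F : C -> C -> C -> C -> C) : Prop :=
  forall a b c : C, (forall n : nat, c <> (- INR n)%C) ->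
    continues cut_plane
      (fun n => (rising a n * rising b n / (rising c n * INR (fact n)))%C)
      (F a b c).

(** * The Lerch transcendent at s = -l *)

Section LerchExists.

Let is_CS (a : nat -> C) (l : C) : Prop :=
  is_series (K := C_AbsRing) (V := C_NormedModule) a l.

Fixpoint mbin (j k : nat) : R :=
  match j with
  | O => 1
  | S i => mbin i k * (INR k + INR i + 1) / (INR i + 1)
  end.

Lemma mbin_pos j k : 0 < mbin j k.
Proof.
  induction j as [|j IH]; simpl; [lra|].
  pose proof (pos_INR k); pose proof (pos_INR j).
  apply Rdiv_lt_0_compat; [apply Rmult_lt_0_compat|]; lra.
Qed.

Lemma mbin_ratio j k :
  mbin j (S k) * (INR k + 1) = mbin j k * (INR k + INR j + 1).
Proof.
  induction j as [|j IH].
  - simpl mbin; simpl (INR 0); lra.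
  - cbn [mbin]; pose proof (pos_INR j).
    rewrite !S_INR.
    replace (mbin j (S k) * (INR k + 1 + INR j + 1) / (INR j + 1) * (INR k + 1))
      with ((mbin j (S k) * (INR k + 1)) * (INR k + 1 + INR j + 1) / (INR j + 1))
      by (field; lra).
    rewrite IH; field; lra.
Qed.

Lemma mbin_pascal j k : mbin (S j) (S k) = mbin (S j) k + mbin j (S k).
Proof.
  pose proof (mbin_ratio j k) as H; cbn [mbin]; pose proof (pos_INR j).
  rewrite S_INR.
  apply Rmult_eq_reg_r with (INR j + 1); [|lra].
  replace ((mbin j k * (INR k + INR j + 1) / (INR j + 1) + mbin j (S k))
           * (INR j + 1))
    with (mbin j k * (INR k + INR j + 1) + mbin j (S k) * (INR j + 1))
    by (field; lra).
  rewrite <- H; field; lra.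
Qed.

Lemma mbin_0 j : mbin j 0 = 1.
Proof.
  induction j as [|j IH]; cbn [mbin]; [easy|].
  rewrite IH; pose proof (pos_INR j); simpl; field; lra.
Qed.

Lemma mbin_lim0 j x : 0 <= x < 1 -> is_lim_seq (fun n => mbin j n * x ^ n) 0.
Proof.
  intros [[Hx|<-] Hx1].
  2:{ apply is_lim_seq_incr_1, is_lim_seq_ext with (fun _ => 0).
      - intros n; simpl; ring.
      - apply is_lim_seq_const. }
  apply ex_series_lim_0, ex_series_Rabs, (ex_series_DAlembert _ x); [exact Hx1| |].
  - intros n; pose proof (mbin_pos j n).
    apply Rgt_not_eq, Rmult_lt_0_compat; [easy|now apply pow_lt].
  - apply is_lim_seq_ext with (fun n => x * (1 + INR j * / (INR n + 1))).
    + intros n; pose proof (mbin_ratio j n) as H.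
      pose proof (mbin_pos j n); pose proof (pos_INR n); pose proof (pos_INR j).
      assert (Hp : 0 < x ^ n) by now apply pow_lt.
      assert (E : mbin j (S n) = mbin j n * (INR n + INR j + 1) / (INR n + 1)).
      { rewrite <- H; field; lra. }
      rewrite E.
      replace (mbin j n * (INR n + INR j + 1) / (INR n + 1) * x ^ S n
               / (mbin j n * x ^ n))
        with (x * (1 + INR j * / (INR n + 1))) by (simpl; field; lra).
      symmetry; apply Rabs_pos_eq, Rmult_le_pos; [lra|].
      assert (0 <= INR j * / (INR n + 1)); [|lra].
      apply Rmult_le_pos; [easy|].
      apply Rlt_le, Rinv_0_lt_compat; lra.
    + replace (Finite x) with (Rbar_mult x (1 + INR j * 0)) by (simpl; f_equal; ring).
      apply (is_lim_seq_scal_l _ x (1 + INR j * 0)).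
      apply (is_lim_seq_plus' _ _ 1 (INR j * 0)); [apply is_lim_seq_const|].
      apply (is_lim_seq_scal_l _ (INR j) 0).
      apply is_lim_seq_ext with (fun n => / INR (S n)).
      { intros n; now rewrite S_INR. }
      apply (is_lim_seq_incr_1 (fun n => / INR n)).
      replace (Finite 0) with (Rbar_inv p_infty) by easy.
      apply is_lim_seq_inv; [apply is_lim_seq_INR|easy].
Qed.

Lemma C_pow_n (u : C) n : pow_n (K := AbsRing.Ring C_AbsRing) u n = (u ^ n)%C.
Proof. induction n as [|n IH]; simpl; [easy|now rewrite IH]. Qed.

Let LC (l : C) : (C -> Prop) -> Prop :=
  locally (T := NormedModule.UniformSpace C_AbsRing C_NormedModule) l.

Lemma lim_scal_sub (c a : C) (u t : nat -> C) :
  filterlim u eventually (LC a) -> filterlim t eventually (LC (RtoC 0)) ->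
  filterlim (fun n => (c * (u n + - t n))%C) eventually
    (LC (c * (a + - RtoC 0))%C).
Proof.
  intros Hu Ht.
  apply (filterlim_comp _ _ _ (fun n => (u n + - t n)%C) (fun v => (c * v)%C) _
           (LC (a + - RtoC 0)%C)).
  2: apply (filterlim_scal_r (K := C_AbsRing) (V := C_NormedModule) c).
  apply (filterlim_comp_2 (F := eventually) (G := LC a) (H := LC (- RtoC 0)%C)
           u (fun n => (- t n)%C) Cplus).
  - exact Hu.
  - apply (filterlim_comp _ _ _ t Copp _ (LC (RtoC 0))); [exact Ht|].
    apply (filterlim_opp (K := C_AbsRing) (V := C_NormedModule)).
  - apply (filterlim_plus (K := C_AbsRing) (V := C_NormedModule)).
Qed.

Lemma mbin_series j (u : C) : Cmod u < 1 ->
  is_CS (fun n => (u ^ n * mbin j n)%C) (/ (1 - u) ^ S j)%C.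
Proof.
  intros Hu.
  assert (Hu1 : (1 - u)%C <> RtoC 0).
  { intros E; assert (u = RtoC 1) as ->.
    { replace u with (1 - (1 - u))%C by ring; rewrite E; ring. }
    rewrite Cmod_1 in Hu; lra. }
  assert (T : forall i, filterlim (fun n => (u ^ S n * mbin i n)%C) eventually
     (locally (T := NormedModule.UniformSpace C_AbsRing C_NormedModule) (RtoC 0))).
  { intros i.
    apply (filterlim_norm_zero (K := C_AbsRing) (V := C_NormedModule)).
    apply (is_lim_seq_ext (fun n => Cmod u * (mbin i n * Cmod u ^ n)) _ 0).
    - intros n. change (norm (V := C_NormedModule)) with Cmod.
      rewrite Cmod_mult, Cmod_pow, Cmod_R, Rabs_pos_eq.
      + simpl; ring.
      + apply Rlt_le, mbin_pos.
    - replace (Finite 0) with (Rbar_mult (Cmod u) 0) by (simpl; f_equal; ring).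
      apply is_lim_seq_scal_l, mbin_lim0; split; [apply Cmod_ge_0|easy]. }
  induction j as [|j IH].
  - assert (P : forall N, sum_n (G := NormedModule.AbelianMonoid C_AbsRing C_NormedModule)
        (fun n => (u ^ n * mbin 0 n)%C) N
        = (/ (1 - u) * (1 + - (u ^ S N * mbin 0 N)))%C).
    { induction N as [|N IHN].
      - rewrite sum_O; simpl; match goal with |- @eq _ ?a ?b => change (@eq C a b) end.
        field; easy.
      - rewrite sum_Sn, IHN.
        change (plus (G := NormedModule.AbelianMonoid C_AbsRing C_NormedModule))
          with Cplus. simpl; match goal with |- @eq _ ?a ?b => change (@eq C a b) end.
        field; easy. }
    unfold is_CS, is_series.
    eapply filterlim_ext; [intros N; symmetry; apply P|].
    replace (/ (1 - u) ^ 1)%C with (/ (1 - u) * (1 + - RtoC 0))%C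
      by (simpl; field; easy).
    apply (lim_scal_sub _ (RtoC 1) (fun _ => RtoC 1)); [|apply T].
    apply filterlim_const.
  - assert (P : forall N, sum_n (G := NormedModule.AbelianMonoid C_AbsRing C_NormedModule)
        (fun n => (u ^ n * mbin (S j) n)%C) N
        = (/ (1 - u) * (sum_n (G := NormedModule.AbelianMonoid C_AbsRing C_NormedModule)
             (fun n => (u ^ n * mbin j n)%C) N + - (u ^ S N * mbin (S j) N)))%C).
    { induction N as [|N IHN].
      - rewrite !sum_O, !mbin_0; simpl; match goal with |- @eq _ ?a ?b => change (@eq C a b) end.
        field; easy.
      - rewrite !sum_Sn, IHN.
        change (plus (G := NormedModule.AbelianMonoid C_AbsRing C_NormedModule))
          with Cplus.
        rewrite mbin_pascal, !RtoC_plus, (Cpow_S _ (S N)).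
        match goal with |- @eq _ ?a ?b => change (@eq C a b) end.
        field; easy. }
    unfold is_CS, is_series.
    eapply filterlim_ext; [intros N; symmetry; apply P|].
    replace (/ (1 - u) ^ S (S j))%C
      with (/ (1 - u) * (/ (1 - u) ^ S j + - RtoC 0))%C.
    2:{ rewrite (Cpow_S _ (S j)).
        pose proof (Cpow_nz _ (S j) Hu1) as Hv; revert Hv.
        generalize ((1 - u) ^ S j)%C; intros v Hv; field; easy. }
    apply lim_scal_sub; [exact IH|apply T].
Qed.

Lemma continues_mbin j :
  continues punctured_plane (fun k => RtoC (mbin j k))
    (fun w => (/ (1 - w) ^ S j)%C).
Proof.
  split.
  - intros w Hw. unfold is_pseries.
    eapply is_series_ext; [|apply mbin_series, Hw].
    intros n.
    exact (f_equal (fun v => (v * mbin j n)%C) (eq_sym (C_pow_n w n))).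
  - intros w0 H0.
    assert (Hw0 : (1 - w0)%C <> RtoC 0).
    { intros E; apply H0; replace w0 with (1 - (1 - w0))%C by ring.
      rewrite E; ring. }
    exists (fun n => (mbin j n * / ((1 - w0) ^ n * (1 - w0) ^ S j))%C).
    exists (mkposreal _ (proj1 (Cmod_gt_0 _) Hw0)).
    intros w Hw; simpl in Hw.
    set (u := ((w - w0) / (1 - w0))%C).
    assert (Hu : Cmod u < 1).
    { unfold u; rewrite Cmod_div by easy.
      apply Rmult_lt_reg_r with (Cmod (1 - w0)); [now apply Cmod_gt_0|].
      unfold Rdiv; rewrite Rmult_assoc, Rinv_l, Rmult_1_r, Rmult_1_l; [easy|].
      now apply Rgt_not_eq, Cmod_gt_0. }
    assert (Hu1 : (1 - u)%C <> RtoC 0).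
    { intros E; assert (u = RtoC 1) as Eu.
      { replace u with (1 - (1 - u))%C by ring; rewrite E; ring. }
      rewrite Eu, Cmod_1 in Hu; lra. }
    replace (/ (1 - w) ^ S j)%C with (/ (1 - w0) ^ S j * / (1 - u) ^ S j)%C.
    2:{ replace (1 - w)%C with ((1 - w0) * (1 - u))%C by (unfold u; field; easy).
        rewrite Cpow_mult_l; field; split; now apply Cpow_nz. }
    unfold is_pseries.
    eapply is_series_ext.
    2: apply (is_series_scal (K := C_AbsRing) (V := C_NormedModule)
                (/ (1 - w0) ^ S j)%C), (mbin_series j u Hu).
    intros n.
    set (c := (mbin j n * / ((1 - w0) ^ n * (1 - w0) ^ S j))%C).
    refine (eq_trans _ (f_equal (fun v => (v * c)%C) (eq_sym (C_pow_n (w - w0)%C n)))).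
    change ((/ (1 - w0) ^ S j * (u ^ n * mbin j n))%C = ((w - w0) ^ n * c)%C).
    unfold c.
    replace (u ^ n)%C with ((w - w0) ^ n * / (1 - w0) ^ n)%C.
    2:{ unfold u, Cdiv; rewrite Cpow_mult_l, Cpow_inv by easy; easy. }
    field; split; now apply Cpow_nz.
Qed.

Lemma continues_lin D a b f g (x y : C) :
  continues D a f -> continues D b g ->
  continues D (fun k => (x * a k + y * b k)%C) (fun w => (x * f w + y * g w)%C).
Proof.
  assert (L : forall a b (v l m : C),
    is_pseries (K := C_AbsRing) (V := C_NormedModule) a v l ->
    is_pseries (K := C_AbsRing) (V := C_NormedModule) b v m ->
    is_pseries (K := C_AbsRing) (V := C_NormedModule)
      (fun k => (x * a k + y * b k)%C) v (x * l + y * m)%C).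
  { clear; intros a b v l m Ha Hb; unfold is_pseries in *.
    eapply is_series_ext.
    2: apply (is_series_plus (K := C_AbsRing) (V := C_NormedModule)
         _ _ (x * l)%C (y * m)%C
         (is_series_scal (K := C_AbsRing) (V := C_NormedModule) x _ _ Ha)
         (is_series_scal (K := C_AbsRing) (V := C_NormedModule) y _ _ Hb)).
    intros n. set (p := pow_n (K := AbsRing.Ring C_AbsRing) v n : C).
    change ((x * (p * a n) + y * (p * b n))%C = (p * (x * a n + y * b n))%C).
    ring. }
  intros [Hf1 Hf2] [Hg1 Hg2]; split.
  - intros w Hw; now apply L; [apply Hf1|apply Hg1].
  - intros w0 H0.
    destruct (Hf2 w0 H0) as (a' & r & Ha), (Hg2 w0 H0) as (b' & s & Hb).
    exists (fun k => (x * a' k + y * b' k)%C).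
    exists (mkposreal _ (Rmin_stable_in_posreal r s)).
    intros w Hw; simpl in Hw; apply L; [apply Ha|apply Hb].
    + eapply Rlt_le_trans; [exact Hw|apply Rmin_l].
    + eapply Rlt_le_trans; [exact Hw|apply Rmin_r].
Qed.

Lemma continues_ext D a b f :
  (forall k, a k = b k) -> continues D a f -> continues D b f.
Proof.
  intros E [H1 H2]; split; [|exact H2].
  intros w Hw; unfold is_pseries; eapply is_series_ext; [|apply H1, Hw].
  intros n; now destruct (E n).
Qed.

Lemma Lerch_neg_exists (l : nat) (om : C) :
  exists f, continues punctured_plane (fun k => ((INR k + om) ^ l)%C) f.
Proof.
  assert (H : forall j, exists f,
    continues punctured_plane (fun k => ((INR k + om) ^ l * mbin j k)%C) f).
  { induction l as [|l IH]; intros j.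
    - eexists; eapply continues_ext; [|apply (continues_mbin j)].
      intros k; simpl; ring.
    - destruct (IH (S j)) as [f Hf], (IH j) as [g Hg].
      eexists; eapply continues_ext;
        [|apply (continues_lin _ _ _ _ _ (INR j + 1)%C (om - INR j - 1)%C Hf Hg)].
      intros k; cbn [mbin Cpow].
      pose proof (pos_INR j).
      assert (RtoC (INR j + 1) <> RtoC 0).
      { intros E; apply RtoC_inj in E; lra. }
      rewrite RtoC_div, RtoC_mult, !RtoC_plus by lra.
      rewrite RtoC_plus in H0. field; easy. }
  destruct (H 0%nat) as [f Hf]; exists f.
  eapply continues_ext; [|exact Hf]; intros k; simpl; ring.
Qed.

End LerchExists.

(* z |-> Phi(z, -l, om): the continuation of  sum_k (k + om)^l z^k  to C \ {1},
   with 0^0 = 1. *)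
Definition Lerch_neg (l : nat) (om : C) : C -> C :=
  epsilon (inhabits (fun _ : C => RtoC 0))
    (continues punctured_plane (fun k => ((INR k + om) ^ l)%C)).

Lemma Lerch_neg_spec (l : nat) (om : C) :
  continues punctured_plane (fun k => ((INR k + om) ^ l)%C) (Lerch_neg l om).
Proof. unfold Lerch_neg; apply epsilon_spec, Lerch_neg_exists. Qed.

(* Phi(x, -l, om)_nu for real x > 0, the removable singularity at x = 1 being
   filled by continuity. *)
Definition incLerch_neg (l : nat) (om nu : C) (x : R) : C :=
  let f := fun t : R =>
    (Lerch_neg l om t - Rcpow t nu * Lerch_neg l (om + nu) t)%C in
  if Req_EM_T x 1 then CLim f 1 else f x.

(** * Norlund polynomials and the coefficients of the expansion *)

Definition todd (t : R) : R :=
  if Req_EM_T t 0 then 1 else t / (exp t - 1).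

(* (t / (e^t - 1))^s = sum_n B_n^(s) t^n / n! *)
Definition norlund (n : nat) (s : R) : R :=
  Derive_n (fun t => Rpower (todd t) s) n 0.

Fixpoint gbinom (x : R) (m : nat) : R :=
  match m with
  | O => 1
  | S i => gbinom x i * (x - INR i) / INR (S i)
  end.

(* [Ppoly k] is the polynomial P_{2k}. *)
Definition Ppoly (a1 a2 : R) (k : nat) (x : R) : R :=
  sum_n (fun m => 1 / (a1 ^ m * a2 ^ (k - m))
           * gbinom (x + 1) m * gbinom (- x) (k - m)
           * norlund m (2 + x) * norlund (k - m) (1 - x)) k.

Definition pcoef (a1 a2 : R) (k l : nat) : R :=
  / INR (fact l) * Derive_n (Ppoly a1 a2 k) l 0.

(** * The function T_nu and the partial sums of its expansion *)

(* At the isolated parameter values where [CGamma] is evaluated at a pole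
   (a1 = 1 or a1 = 1 + nu) this is meaningful only as a limit; these values are irrelevant as a1 -> oo with nu fixed. *)

Definition Tfun (F : C -> C -> C -> C -> C) (nu : C) (Y1 Y2 a1 a2 : R) : C :=
  let z := a2 * Y2 / (a1 * Y1) in
  (((a1 - 1) / (a1 * Y1))%R *
   (F 1 (2 - a1) a2 (- z)
    - Rcpow z nu / (poch (a1 - 1) (- nu) * poch a2 nu)
      * F 1 (2 - a1 + nu) (a2 + nu) (- z)))%C.

Definition Tpartial (nu : C) (Y1 Y2 a1 a2 : R) (K : nat) : C :=
  (/ Y1 *
   sum_n (fun k =>
     sum_n (fun l => pcoef a1 a2 k l * incLerch_neg l 0 nu (Y2 / Y1)) (2 * k))
     K)%C.

(* Main.v *)
Require Import Defs.
From Stdlib Require Import Reals Lra Lia Psatz List ClassicalEpsilon.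
From Coquelicot Require Import Coquelicot.
Import ListNotations.
Open Scope R_scope.

(* Put [x = ln (Y2 / Y1)], [D = d/dx] and [u = (1 - e^(nu x)) / (1 - e^x)], a smooth
   function on the line.  Then [Phi(e^x, -l, 0)_nu = D^l u], so the partial sums of the
   expansion are [A_K = sum_(k <= K) P_{2k}(D) u], and
   [P(D) u - e^x P(D + 1) u = P(0) - P(nu) e^(nu x)] for every polynomial [P].

   The Gauss functions in [T = Y1 T_nu] solve first-order equations with one and the same
   operator [L V = V + (V' - V) / alpha_2 - e^x (V - (V' + 2 V) / alpha_1)], and [L T] is
   explicit in terms of Gamma quotients.  Those have expansions whose coefficients
   [q_m(x) = binom(x, m) B_m^(x+1)] satisfy [q_m(x+1) = q_m(x) - (x+1) q_(m-1)(x)]; this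
   recursion makes [L A_K] telescope and gives [L (T - A_K) = O(eps^(K+1) e^(N |x|))] with
   [eps = 1 / alpha_1 + 1 / alpha_2].

   A comparison function for [L] on [x <= 0] turns this into [T - A_K = O(eps^K)]; the
   lost factor [eps] is recovered by taking one more term.  The reflection [x -> -x]
   exchanges [alpha_1] and [alpha_2] and yields the same bound on [x >= 0] for the solution
   [T + c H], [H] homogeneous, that is negligible at [+oo].  The constant [c], essentially
   the defect in Euler's beta integral, is the same, suitably normalised, for
   [(alpha_1 + n, alpha_2 + n)]; comparing both bounds at [x = 0] shows that it tends to
   [0] as [n -> oo], hence [c = 0]. *)

(** The obstacle is a turning point. The derivative in [L] has a coefficient of order [eps], and at
    [x = 0] the zeroth-order coefficient is [2 / alpha_1 - 1 / alpha_2], also of order [eps] and of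
    either sign. The maximum principle therefore degenerates exactly where [Y1 = Y2], which is what
    costs the factor [eps]; no relation between [alpha_1] and [alpha_2] is assumed that could repair
    it.

    Homogeneous solutions of [L] are large at both ends of the line, so a solution is controlled
    only from an end at which it is known to be negligible. Hence two solutions, one for each
    half-line, and the need to show that they coincide. Their coincidence amounts to evaluating
    Euler's beta integral by Gamma functions, which is drawn here from the estimates themselves.

    The equations are of first order because the first parameter of the Gauss functions is 1.
    Complex [nu] is reached through polynomiality: recursions and estimates for the coefficients are
    obtained at natural numbers and then hold on the whole complex plane. *)

Ltac cring := cbv beta; match goal with |- @eq _ ?a ?b => change (@eq C a b) end; ring.
Ltac cfield := cbv beta; match goal with |- @eq _ ?a ?b => change (@eq C a b) end; field.

(** * Complex numbers and the complex exponential *)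

Lemma C_ext (x y : C) : Re x = Re y -> Im x = Im y -> x = y.
Proof. destruct x, y; simpl; congruence. Qed.

Lemma im_le_Cmod (c : C) : Rabs (Im c) <= Cmod c.
Proof.
  eapply Rle_trans; [apply Rmax_r|apply (Rmax_Cmod c)].
Qed.

Lemma Cmod_le_Re_Im (c : C) : Cmod c <= Rabs (Re c) + Rabs (Im c).
Proof.
  replace c with (RtoC (Re c) + Ci * RtoC (Im c))%C
    by (apply C_ext; simpl; ring).
  eapply Rle_trans; [apply Cmod_triangle|].
  rewrite Cmod_mult, Cmod_Ci, !Cmod_R; simpl.
  replace (Re c + (0 * Im c - 1 * 0)) with (Re c) by ring.
  replace (0 + (0 * 0 + 1 * Im c)) with (Im c) by ring.
  lra.
Qed.

Lemma Cmod_sub_le (x y : C) : Cmod (x - y) <= Cmod x + Cmod y.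
Proof. unfold Cminus; rewrite <- (Cmod_opp y); apply Cmod_triangle. Qed.

Lemma Cmod_sub_sym (x y : C) : Cmod (x - y) = Cmod (y - x).
Proof. rewrite <- Cmod_opp; apply (f_equal Cmod); ring. Qed.

Lemma Cmod_triangle_sub (x y : C) : Cmod x <= Cmod (x - y) + Cmod y.
Proof.
  replace x with ((x - y) + y)%C at 1 by ring; apply Cmod_triangle.
Qed.

Lemma Cinv_neq_0 (z : C) : z <> 0 -> (/ z)%C <> 0.
Proof.
  intros H E; apply C1_nz. replace (RtoC 1) with (z * / z)%C by (field; auto).
  rewrite E; ring.
Qed.

Lemma Cexp_plus (z w : C) : Cexp (z + w) = (Cexp z * Cexp w)%C.
Proof.
  destruct z as [a b], w as [c d]; unfold Cexp; apply C_ext; simpl;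
    rewrite exp_plus, ?cos_plus, ?sin_plus; ring.
Qed.

Lemma Cexp_RtoC (x : R) : Cexp (RtoC x) = RtoC (exp x).
Proof. apply C_ext; simpl; rewrite ?cos_0, ?sin_0; ring. Qed.

Lemma Cexp_0 : Cexp 0 = 1.
Proof. now rewrite Cexp_RtoC, exp_0. Qed.

Lemma Cmod_Cexp (z : C) : Cmod (Cexp z) = exp (Re z).
Proof.
  unfold Cexp, Cmod; simpl fst; simpl snd.
  replace ((exp (Re z) * cos (Im z)) ^ 2 + (exp (Re z) * sin (Im z)) ^ 2)
    with (exp (Re z) * exp (Re z) * (Rsqr (sin (Im z)) + Rsqr (cos (Im z))))
    by (unfold Rsqr; ring).
  rewrite sin2_cos2, Rmult_1_r.
  apply sqrt_square, Rlt_le, exp_pos.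
Qed.

Lemma Cexp_nz (z : C) : Cexp z <> 0.
Proof. apply Cmod_gt_0; rewrite Cmod_Cexp; apply exp_pos. Qed.

Lemma Cexp_opp (z : C) : Cexp (- z) = (/ Cexp z)%C.
Proof.
  assert (Cexp (- z) * Cexp z = 1)%C.
  { rewrite <- Cexp_plus, <- Cexp_0; apply (f_equal Cexp); ring. }
  pose proof (Cexp_nz z).
  replace (Cexp (- z)) with (Cexp (- z) * Cexp z * / Cexp z)%C by (field; easy).
  rewrite H; ring.
Qed.

(** * Complex-valued functions of a real variable *)

(** Derivatives are componentwise, as limits are in [CLim], so that real mean value arguments apply
    to each part. *)
Definition is_Cderive (f : R -> C) (x : R) (l : C) : Prop :=
  is_derive (fun t => Re (f t)) x (Re l) /\ is_derive (fun t => Im (f t)) x (Im l).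

Lemma is_Cderive_ext f g x l :
  (forall t, f t = g t) -> is_Cderive f x l -> is_Cderive g x l.
Proof.
  intros E [H1 H2]; split; eapply is_derive_ext; try eassumption;
    intros t; simpl; now rewrite E.
Qed.

Lemma is_Cderive_eq f x l l' : is_Cderive f x l -> l = l' -> is_Cderive f x l'.
Proof. now intros H <-. Qed.

Lemma is_Cderive_const c x : is_Cderive (fun _ => c) x 0.
Proof. split; simpl; apply (is_derive_const (K := R_AbsRing) (V := R_NormedModule)). Qed.

Lemma is_Cderive_plus f g x l m :
  is_Cderive f x l -> is_Cderive g x m -> is_Cderive (fun t => f t + g t)%C x (l + m)%C.
Proof.
  intros [H1 H2] [H3 H4]; split; simpl;
    now apply (is_derive_plus (K := R_AbsRing) (V := R_NormedModule)).
Qed.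

Lemma is_Cderive_opp f x l :
  is_Cderive f x l -> is_Cderive (fun t => - f t)%C x (- l)%C.
Proof.
  intros [H1 H2]; split; simpl;
    now apply (is_derive_opp (K := R_AbsRing) (V := R_NormedModule)).
Qed.

Lemma is_Cderive_minus f g x l m :
  is_Cderive f x l -> is_Cderive g x m -> is_Cderive (fun t => f t - g t)%C x (l - m)%C.
Proof. intros; now apply is_Cderive_plus, is_Cderive_opp. Qed.

Lemma is_derive_Rplus (f g : R -> R) (x l m : R) :
  is_derive f x l -> is_derive g x m -> is_derive (fun t => f t + g t) x (l + m).
Proof. apply (is_derive_plus (K := R_AbsRing) (V := R_NormedModule)). Qed.

Lemma is_derive_Rminus (f g : R -> R) (x l m : R) :
  is_derive f x l -> is_derive g x m -> is_derive (fun t => f t - g t) x (l - m).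
Proof. apply (is_derive_minus (K := R_AbsRing) (V := R_NormedModule)). Qed.

Lemma is_derive_Ropp (f : R -> R) (x l : R) :
  is_derive f x l -> is_derive (fun t => - f t) x (- l).
Proof. apply (is_derive_opp (K := R_AbsRing) (V := R_NormedModule)). Qed.

Lemma is_derive_Rconst (c x : R) : is_derive (fun _ => c) x 0.
Proof. apply (is_derive_const (K := R_AbsRing) (V := R_NormedModule)). Qed.

Lemma is_derive_eq (f : R -> R) (x l m : R) : is_derive f x l -> l = m -> is_derive f x m.
Proof. now intros H <-. Qed.

Lemma is_derive_Rext (f g : R -> R) (x l : R) :
  (forall t, f t = g t) -> is_derive f x l -> is_derive g x l.
Proof. apply (is_derive_ext (K := R_AbsRing) (V := R_NormedModule)). Qed.

Lemma is_derive_Rcomp (f g : R -> R) (x l m : R) :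
  is_derive f (g x) l -> is_derive g x m -> is_derive (fun t => f (g t)) x (m * l).
Proof. apply (is_derive_comp (K := R_AbsRing) (V := R_NormedModule)). Qed.

Lemma is_Cderive_mult f g x l m :
  is_Cderive f x l -> is_Cderive g x m ->
  is_Cderive (fun t => f t * g t)%C x (l * g x + f x * m)%C.
Proof.
  intros [H1 H2] [H3 H4]; split.
  - change (is_derive (fun t => Re (f t) * Re (g t) - Im (f t) * Im (g t)) x
      (Re (l * g x + f x * m)%C)).
    eapply is_derive_eq.
    + apply is_derive_Rminus; apply Derive.is_derive_mult; eassumption.
    + unfold Re, Im; simpl; ring.
  - change (is_derive (fun t => Re (f t) * Im (g t) + Im (f t) * Re (g t)) x
      (Im (l * g x + f x * m)%C)).
    eapply is_derive_eq.
    + apply is_derive_Rplus; apply Derive.is_derive_mult; eassumption.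
    + unfold Re, Im; simpl; ring.
Qed.

Lemma is_Cderive_scal c f x l :
  is_Cderive f x l -> is_Cderive (fun t => c * f t)%C x (c * l)%C.
Proof.
  intros H; eapply is_Cderive_eq; [apply is_Cderive_mult; [apply is_Cderive_const|exact H]|].
  cring.
Qed.

Lemma is_Cderive_RtoC (f : R -> R) x l :
  is_derive f x l -> is_Cderive (fun t => RtoC (f t)) x (RtoC l).
Proof.
  intros H; split; simpl; [exact H|].
  apply (is_derive_const (K := R_AbsRing) (V := R_NormedModule)).
Qed.

Lemma is_Cderive_comp f (g : R -> R) x l dg :
  is_Cderive f (g x) l -> is_derive g x dg ->
  is_Cderive (fun t => f (g t)) x (dg * l)%C.
Proof.
  intros [H1 H2] H; split.
  - eapply is_derive_eq; [apply (is_derive_Rcomp (fun t => Re (f t)) g); eassumption|].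
    unfold Re, Im; simpl; ring.
  - eapply is_derive_eq; [apply (is_derive_Rcomp (fun t => Im (f t)) g); eassumption|].
    unfold Re, Im; simpl; ring.
Qed.

Lemma is_Cderive_Cexp (w : C) x :
  is_Cderive (fun t => Cexp (w * t)) x (w * Cexp (w * x))%C.
Proof.
  destruct w as [a b]; split.
  - apply is_derive_Rext with (fun t => exp (a * t) * cos (b * t)).
    + intros t; unfold Cexp; simpl; f_equal; f_equal; ring.
    + auto_derive; [easy|].
      unfold Cexp; simpl.
      replace (a * x - b * 0) with (a * x) by ring.
      replace (a * 0 + b * x) with (b * x) by ring. ring.
  - apply is_derive_Rext with (fun t => exp (a * t) * sin (b * t)).
    + intros t; unfold Cexp; simpl; f_equal; f_equal; ring.
    + auto_derive; [easy|].
      unfold Cexp; simpl.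
      replace (a * x - b * 0) with (a * x) by ring.
      replace (a * 0 + b * x) with (b * x) by ring. ring.
Qed.

Lemma is_Cderive_unique f x l m : is_Cderive f x l -> is_Cderive f x m -> l = m.
Proof.
  intros [H1 H2] [H3 H4]; apply C_ext.
  - rewrite <- (is_derive_unique _ _ _ H1); now apply is_derive_unique.
  - rewrite <- (is_derive_unique _ _ _ H2); now apply is_derive_unique.
Qed.

Lemma is_Cderive_ext_loc f g x l (d : posreal) :
  (forall t, Rabs (t - x) < d -> f t = g t) -> is_Cderive f x l -> is_Cderive g x l.
Proof.
  intros E [H1 H2]; split; (eapply is_derive_ext_loc; [|eassumption]);
    exists d; intros t Ht; simpl; f_equal; now apply E.
Qed.

Lemma derive_nonneg_incr (f df : R -> R) (a b : R) : a <= b ->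
  (forall t, a <= t <= b -> is_derive f t (df t)) ->
  (forall t, a <= t <= b -> 0 <= df t) -> f a <= f b.
Proof.
  intros [Hab| ->] Hd Hp; [|lra].
  destruct (MVT_gen f a b df) as (c & Hc & E).
  - intros x; rewrite Rmin_left, Rmax_right by lra; intros; apply Hd; lra.
  - intros x; rewrite Rmin_left, Rmax_right by lra; intros Hx.
    apply continuity_pt_filterlim, (ex_derive_continuous f).
    eexists; apply Hd; lra.
  - rewrite Rmin_left, Rmax_right in Hc by lra.
    enough (0 <= df c * (b - a)) by lra.
    apply Rmult_le_pos; [apply Hp; lra|lra].
Qed.

Lemma derive_le_incr (f df g dg : R -> R) (a b : R) : a <= b ->
  (forall t, a <= t <= b -> is_derive f t (df t)) ->
  (forall t, a <= t <= b -> is_derive g t (dg t)) ->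
  (forall t, a <= t <= b -> df t <= dg t) -> f b - f a <= g b - g a.
Proof.
  intros Hab Hf Hg Hle.
  enough (g a - f a <= g b - f b) by lra.
  apply (derive_nonneg_incr (fun t => g t - f t) (fun t => dg t - df t)); [easy| |].
  - intros t Ht; apply is_derive_Rminus; auto.
  - intros t Ht; specialize (Hle t Ht); lra.
Qed.

(** Mean value inequality in place of an integral estimate. It is applied to the real and the
    imaginary part separately, whence the factor 2. *)
Lemma Cderive_le_incr (f df : R -> C) (g dg : R -> R) (a b : R) : a <= b ->
  (forall t, a <= t <= b -> is_Cderive f t (df t)) ->
  (forall t, a <= t <= b -> is_derive g t (dg t)) ->
  (forall t, a <= t <= b -> Cmod (df t) <= dg t) ->
  Cmod (f b - f a) <= 2 * (g b - g a).
Proof.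
  intros Hab Hf Hg Hle.
  assert (H : forall (p : C -> R), (forall z, Rabs (p z) <= Cmod z) ->
    (forall t, a <= t <= b -> is_derive (fun t => p (f t)) t (p (df t))) ->
    Rabs (p (f b) - p (f a)) <= g b - g a).
  { intros p Hp Hd; apply Rabs_le; split.
    - enough (- p (f b) - - p (f a) <= g b - g a) by lra.
      apply (derive_le_incr (fun t => - p (f t)) (fun t => - p (df t)) g dg); auto.
      + intros t Ht.
        apply (is_derive_opp (K := R_AbsRing) (V := R_NormedModule) (fun t => p (f t))); auto.
      + intros t Ht; specialize (Hle t Ht); specialize (Hp (df t)).
        destruct (Rabs_le_between (p (df t)) (Cmod (df t))) as [HH _].
        specialize (HH Hp); lra.
    - apply (derive_le_incr (fun t => p (f t)) (fun t => p (df t)) g dg); auto.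
      intros t Ht; specialize (Hle t Ht); specialize (Hp (df t)).
      pose proof (Rle_abs (p (df t))); lra. }
  eapply Rle_trans; [apply Cmod_le_Re_Im|].
  assert (H1 := H Re re_le_Cmod (fun t Ht => proj1 (Hf t Ht))).
  assert (H2 := H Im im_le_Cmod (fun t Ht => proj2 (Hf t Ht))).
  change (Re (f b - f a)%C) with (Re (f b) - Re (f a)).
  change (Im (f b - f a)%C) with (Im (f b) - Im (f a)). lra.
Qed.

(** * Smooth functions with exponentially bounded derivatives *)

Definition exp_bounded (f : R -> R) : Prop :=
  exists M N, 0 <= M /\ 0 <= N /\ forall x, Rabs (f x) <= M * exp (N * Rabs x).

(** The derivative is existential so that closure under sums and products is a bare induction on
    [n]; [esmooth_Derive] returns to [Derive] afterwards. *)
Fixpoint esm (n : nat) (f : R -> R) : Prop :=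
  exp_bounded f /\
  match n with
  | O => True
  | S m => exists df, (forall x, is_derive f x (df x)) /\ esm m df
  end.

Definition esmooth (f : R -> R) : Prop := forall n, esm n f.

Lemma exp_bounded_ext f g : (forall x, f x = g x) -> exp_bounded f -> exp_bounded g.
Proof.
  intros E (M & N & HM & HN & H); exists M, N; repeat split; auto.
  intros x; rewrite <- E; apply H.
Qed.

Lemma exp_le x y : x <= y -> exp x <= exp y.
Proof. intros [H| ->]; [now apply Rlt_le, exp_increasing|apply Rle_refl]. Qed.

Lemma exp_ge_1 x : 0 <= x -> 1 <= exp x.
Proof. rewrite <- exp_0 at 1; apply exp_le. Qed.

Lemma exp_bounded_plus f g :
  exp_bounded f -> exp_bounded g -> exp_bounded (fun x => f x + g x).
Proof.
  intros (M & N & HM & HN & H) (M' & N' & HM' & HN' & H').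
  exists (M + M'), (N + N'); repeat split; try lra.
  intros x; specialize (H x); specialize (H' x).
  pose proof (Rabs_pos x).
  eapply Rle_trans; [apply Rabs_triang|].
  assert (exp (N * Rabs x) <= exp ((N + N') * Rabs x)) by (apply exp_le; nra).
  assert (exp (N' * Rabs x) <= exp ((N + N') * Rabs x)) by (apply exp_le; nra).
  nra.
Qed.

Lemma exp_bounded_mult f g :
  exp_bounded f -> exp_bounded g -> exp_bounded (fun x => f x * g x).
Proof.
  intros (M & N & HM & HN & H) (M' & N' & HM' & HN' & H').
  exists (M * M'), (N + N'); repeat split; try nra.
  intros x; specialize (H x); specialize (H' x).
  rewrite Rabs_mult, Rmult_plus_distr_r, exp_plus.
  replace (M * M' * (exp (N * Rabs x) * exp (N' * Rabs x)))
    with ((M * exp (N * Rabs x)) * (M' * exp (N' * Rabs x))) by ring.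
  apply Rmult_le_compat; auto using Rabs_pos.
Qed.

Lemma esm_bounded n f : esm n f -> exp_bounded f.
Proof. destruct n; simpl; tauto. Qed.

Lemma esm_le n f : esm (S n) f -> esm n f.
Proof.
  revert f; induction n as [|n IH]; intros f (H & df & Hd & H1).
  - split; auto.
  - split; auto. exists df; auto.
Qed.

Lemma esm_ext n f g : (forall x, f x = g x) -> esm n f -> esm n g.
Proof.
  intros E; destruct n as [|n]; intros [H H1]; (split; [now apply exp_bounded_ext with f|]).
  - easy.
  - destruct H1 as (df & Hd & H2); exists df; split; auto.
    intros x; now apply is_derive_Rext with f.
Qed.

Lemma esm_plus n f g : esm n f -> esm n g -> esm n (fun x => f x + g x).
Proof.
  revert f g; induction n as [|n IH]; intros f g [H1 H2] [H3 H4];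
    (split; [now apply exp_bounded_plus|]); [easy|].
  destruct H2 as (df & Hd & H2), H4 as (dg & Hd' & H4).
  exists (fun x => df x + dg x); split; auto.
  intros x; now apply is_derive_Rplus.
Qed.

Lemma esm_mult n f g : esm n f -> esm n g -> esm n (fun x => f x * g x).
Proof.
  revert f g; induction n as [|n IH]; intros f g K1 K2.
  - destruct K1, K2; split; [now apply exp_bounded_mult|easy].
  - pose proof (esm_le _ _ K1); pose proof (esm_le _ _ K2).
    destruct K1 as [H1 (df & Hd & H2)], K2 as [H3 (dg & Hd' & H4)].
    split; [now apply exp_bounded_mult|].
    exists (fun x => df x * g x + f x * dg x); split.
    + intros x; now apply Derive.is_derive_mult.
    + apply esm_plus; auto.
Qed.

Lemma esm_const n c : esm n (fun _ => c).
Proof.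
  revert c; induction n as [|n IH]; intros c; split; try easy.
  1,2: exists (Rabs c), 0; repeat split; auto using Rabs_pos, Rle_refl;
    intros x; rewrite Rmult_0_l, exp_0; lra.
  exists (fun _ => 0); split; auto.
  intros x; apply is_derive_Rconst.
Qed.

Lemma esmooth_ext f g : (forall x, f x = g x) -> esmooth f -> esmooth g.
Proof. intros E H n; now apply esm_ext with f. Qed.

Lemma esmooth_plus f g : esmooth f -> esmooth g -> esmooth (fun x => f x + g x).
Proof. intros H1 H2 n; now apply esm_plus. Qed.

Lemma esmooth_mult f g : esmooth f -> esmooth g -> esmooth (fun x => f x * g x).
Proof. intros H1 H2 n; now apply esm_mult. Qed.

Lemma esmooth_const c : esmooth (fun _ => c).
Proof. intros n; apply esm_const. Qed.

Lemma esmooth_opp f : esmooth f -> esmooth (fun x => - f x).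
Proof.
  intros H; apply esmooth_ext with (fun x => -1 * f x); [intros; ring|].
  apply esmooth_mult; auto using esmooth_const.
Qed.

Lemma esmooth_is_derive f x : esmooth f -> is_derive f x (Derive f x).
Proof.
  intros H; destruct (H 1%nat) as (_ & df & Hd & _).
  apply Derive_correct; eexists; apply Hd.
Qed.

Lemma esmooth_Derive f : esmooth f -> esmooth (Derive f).
Proof.
  intros H n; destruct (H (S n)) as (_ & df & Hd & H1).
  apply esm_ext with df; auto.
  intros x; symmetry; now apply is_derive_unique.
Qed.

Lemma esmooth_Derive_n f n : esmooth f -> esmooth (Derive_n f n).
Proof.
  intros H; induction n as [|n IH]; simpl; [exact H|now apply esmooth_Derive].
Qed.

Lemma esmooth_bounded f : esmooth f -> exp_bounded f.
Proof. intros H; exact (esm_bounded _ _ (H O)). Qed.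

(** Bootstrap: when [df] is an algebraic expression in [f] and known functions, it is as regular as
    [f], and each pass gains one order. It serves for reciprocals and for the powers of [todd]. *)
Lemma esm_of_rec (f df : R -> R) :
  exp_bounded f -> (forall x, is_derive f x (df x)) ->
  (forall n, esm n f -> esm n df) -> esmooth f.
Proof.
  intros H1 H2 H3 n; induction n as [|n IH]; split; auto; eauto.
Qed.

Lemma esmooth_inv f :
  esmooth f -> (forall x, 0 < f x) -> exp_bounded (fun x => / f x) ->
  esmooth (fun x => / f x).
Proof.
  intros H Hp Hb.
  apply esm_of_rec with (fun x => - Derive f x * (/ f x * / f x)); auto.
  - intros x. eapply is_derive_eq.
    + apply is_derive_inv; [now apply esmooth_is_derive|]. specialize (Hp x); lra.
    + specialize (Hp x); field; lra.
  - intros n Hn; apply esm_mult; [|now apply esm_mult].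
    apply esmooth_opp; now apply esmooth_Derive.
Qed.

(** * Power series of exponential type *)

Lemma pow_fact_le_exp y n : 0 <= y -> y ^ n / INR (Factorial.fact n) <= exp y.
Proof.
  intros Hy; eapply Rle_trans; [|apply (exp_ge_taylor y n Hy)].
  destruct n as [|n]; [simpl; lra|].
  rewrite tech5.
  enough (0 <= sum_f_R0 (fun k => y ^ k / INR (Factorial.fact k)) n) by lra.
  apply cond_pos_sum; intros k.
  apply Rmult_le_pos; [now apply pow_le|].
  apply Rlt_le, Rinv_0_lt_compat, lt_0_INR, Factorial.lt_O_fact.
Qed.

Lemma CV_radius_exp_type (c : nat -> R) M N : 0 <= N ->
  (forall n, Rabs (c n) <= M * (N ^ n / INR (Factorial.fact n))) ->
  forall x, Rbar_lt (Rabs x) (CV_radius c).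
Proof.
  intros HN H x.
  apply Rbar_lt_le_trans with (Finite (Rabs x + 1)); [simpl; lra|].
  apply (CV_radius_bounded c).
  exists (M * exp (N * (Rabs x + 1))); intros n.
  pose proof (Rabs_pos x).
  assert (0 <= M).
  { specialize (H O); simpl in H. pose proof (Rabs_pos (c O)); lra. }
  rewrite Rabs_mult, <- RPow_abs, (Rabs_pos_eq (Rabs x + 1)) by lra.
  apply Rle_trans with (M * (N ^ n / INR (Factorial.fact n)) * (Rabs x + 1) ^ n).
  - apply Rmult_le_compat_r; auto. apply pow_le; lra.
  - replace (M * (N ^ n / INR (Factorial.fact n)) * (Rabs x + 1) ^ n)
      with (M * ((N * (Rabs x + 1)) ^ n / INR (Factorial.fact n)))
      by (rewrite Rpow_mult_distr; field; apply INR_fact_neq_0).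
    apply Rmult_le_compat_l; auto. apply pow_fact_le_exp; nra.
Qed.

Lemma exp_bounded_PSeries (c : nat -> R) M N : 0 <= N ->
  (forall n, Rabs (c n) <= M * (N ^ n / INR (Factorial.fact n))) ->
  exp_bounded (PSeries c).
Proof.
  intros HN H.
  assert (HM : 0 <= M).
  { specialize (H O); simpl in H. pose proof (Rabs_pos (c O)); lra. }
  exists M, N; repeat split; auto.
  intros x; unfold PSeries.
  assert (E := is_exp_Reals (N * Rabs x)).
  apply is_pseries_R, (is_series_scal_l M) in E.
  change (is_series (fun n => M * (/ INR (Factorial.fact n) * (N * Rabs x) ^ n))
            (M * exp (N * Rabs x))) in E.
  assert (B : forall n, 0 <= Rabs (c n * x ^ n) <=
     M * (/ INR (Factorial.fact n) * (N * Rabs x) ^ n)).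
  { intros n; split; [apply Rabs_pos|].
    rewrite Rabs_mult, <- RPow_abs.
    replace (M * (/ INR (Factorial.fact n) * (N * Rabs x) ^ n))
      with (M * (N ^ n / INR (Factorial.fact n)) * Rabs x ^ n)
      by (rewrite Rpow_mult_distr; field; apply INR_fact_neq_0).
    apply Rmult_le_compat_r; auto. apply pow_le, Rabs_pos. }
  assert (X : ex_series (fun n => Rabs (c n * x ^ n))).
  { apply (ex_series_le (K := R_AbsRing) (V := R_CompleteNormedModule)) with
      (fun n => M * (/ INR (Factorial.fact n) * (N * Rabs x) ^ n)).
    - intros n; destruct (B n).
      change (norm (Rabs (c n * x ^ n))) with (Rabs (Rabs (c n * x ^ n))).
      rewrite Rabs_Rabsolu; apply B.
    - eexists; apply E. }
  eapply Rle_trans; [apply Series_Rabs, X|].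
  rewrite <- (is_series_unique _ _ E).
  apply Series_le; [apply B|]. eexists; apply E.
Qed.

(** Bounds of the form [M * N^n / n!] are stable under differentiation with [M * N] in place of [M];
    the induction therefore fixes [N] and lets [M] vary. *)
Lemma esmooth_PSeries (c : nat -> R) M N : 0 <= N ->
  (forall n, Rabs (c n) <= M * (N ^ n / INR (Factorial.fact n))) ->
  esmooth (PSeries c).
Proof.
  intros HN H n; revert c M H; induction n as [|n IH]; intros c M H;
    (split; [now apply exp_bounded_PSeries with M N|]); [easy|].
  exists (PSeries (PS_derive c)); split.
  - intros x; apply is_derive_PSeries. now apply CV_radius_exp_type with M N.
  - apply IH with (M * N).
    intros k; unfold PS_derive.
    rewrite Rabs_mult, Rabs_pos_eq by apply pos_INR.
    apply Rle_trans with
      (INR (S k) * (M * (N ^ S k / INR (Factorial.fact (S k))))).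
    + apply Rmult_le_compat_l; [apply pos_INR|apply H].
    + right. change (Factorial.fact (S k)) with (S k * Factorial.fact k)%nat.
      rewrite mult_INR. simpl pow. field.
      split; [apply INR_fact_neq_0|apply not_0_INR; lia].
Qed.

Lemma Cderive_zero_const (f : R -> C) :
  (forall x, is_Cderive f x 0) -> forall x y, f x = f y.
Proof.
  intros H.
  assert (K : forall x y, x < y -> f x = f y).
  { intros x y Hxy; apply C_ext;
      apply (eq_is_derive (V := R_NormedModule)) with (f := fun t => _ (f t)); auto;
      intros t _; apply (H t). }
  intros x y; destruct (total_order_T x y) as [[h| ->]|h]; auto.
  symmetry; auto.
Qed.

Definition exp_coef (w : C) (n : nat) : C := (w ^ n / INR (Factorial.fact n))%C.

Lemma exp_coef_S (w : C) n : (INR (S n) * exp_coef w (S n) = w * exp_coef w n)%C.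
Proof.
  unfold exp_coef.
  change (Factorial.fact (S n)) with (S n * Factorial.fact n)%nat.
  rewrite mult_INR, RtoC_mult, Cpow_S.
  assert (RtoC (INR (S n)) <> 0) by (intros E; apply RtoC_inj in E; revert E; apply not_0_INR; lia).
  assert (RtoC (INR (Factorial.fact n)) <> 0)
    by (intros E; apply RtoC_inj in E; revert E; apply INR_fact_neq_0).
  cfield; auto.
Qed.

Lemma Cmod_exp_coef (w : C) n :
  Cmod (exp_coef w n) = Cmod w ^ n / INR (Factorial.fact n).
Proof.
  unfold exp_coef; rewrite Cmod_div, Cmod_pow, Cmod_R, Rabs_pos_eq; auto using pos_INR.
  intros E; apply RtoC_inj in E; revert E; apply INR_fact_neq_0.
Qed.

Lemma Re_exp_coef_bound (w : C) n :
  Rabs (Re (exp_coef w n)) <= 1 * (Cmod w ^ n / INR (Factorial.fact n)) /\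
  Rabs (Im (exp_coef w n)) <= 1 * (Cmod w ^ n / INR (Factorial.fact n)).
Proof.
  rewrite Rmult_1_l, <- Cmod_exp_coef; split; [apply re_le_Cmod|apply im_le_Cmod].
Qed.

(** The series [f] solves [f' = w f], so [Cexp (- w * t) * f t] has zero derivative and keeps its
    value 1 at the origin. Dropping the first coefficient of this series then divides [e^(w x) - 1]
    by [x] without a singularity. *)
Lemma Cexp_PSeries (w : C) (x : R) :
  Cexp (w * x) = (PSeries (fun n => Re (exp_coef w n)) x,
                  PSeries (fun n => Im (exp_coef w n)) x).
Proof.
  set (f := fun x => (PSeries (fun n => Re (exp_coef w n)) x,
                  PSeries (fun n => Im (exp_coef w n)) x) : C).
  change (Cexp (w * x) = f x).
  assert (R1 := CV_radius_exp_type (fun n => Re (exp_coef w n)) 1 (Cmod w) (Cmod_ge_0 w)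
                  (fun n => proj1 (Re_exp_coef_bound w n))).
  assert (R2 := CV_radius_exp_type (fun n => Im (exp_coef w n)) 1 (Cmod w) (Cmod_ge_0 w)
                  (fun n => proj2 (Re_exp_coef_bound w n))).
  assert (D : forall t, is_Cderive f t (w * f t)%C).
  { intros t; split.
    - eapply is_derive_eq; [apply is_derive_PSeries, R1|].
      change (Re (w * f t)%C) with (Re w * PSeries (fun n => Re (exp_coef w n)) t
         - Im w * PSeries (fun n => Im (exp_coef w n)) t).
      rewrite <- !PSeries_scal, <- PSeries_minus.
      + apply PSeries_ext; intros n.
        unfold PS_derive, PS_minus, PS_opp, PS_plus, PS_scal.
        change (INR (S n) * Re (exp_coef w (S n)) =
          Re w * Re (exp_coef w n) + - (Im w * Im (exp_coef w n))).
        transitivity (Re (w * exp_coef w n)%C).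
        * rewrite <- exp_coef_S; unfold Re; simpl; ring.
        * unfold Re, Im; simpl; ring.
      + apply CV_radius_inside.
        destruct (Req_dec (Re w) 0) as [E|E].
        * rewrite (CV_radius_ext _ (fun _ => 0)); [rewrite CV_radius_const_0; easy|].
          intros n; unfold PS_scal; rewrite E; apply Rmult_0_l.
        * rewrite CV_radius_scal; auto.
      + apply CV_radius_inside.
        destruct (Req_dec (Im w) 0) as [E|E].
        * rewrite (CV_radius_ext _ (fun _ => 0)); [rewrite CV_radius_const_0; easy|].
          intros n; unfold PS_scal; rewrite E; apply Rmult_0_l.
        * rewrite CV_radius_scal; auto.
    - eapply is_derive_eq; [apply is_derive_PSeries, R2|].
      change (Im (w * f t)%C) with (Re w * PSeries (fun n => Im (exp_coef w n)) t
         + Im w * PSeries (fun n => Re (exp_coef w n)) t).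
      rewrite <- !PSeries_scal, <- PSeries_plus.
      + apply PSeries_ext; intros n.
        unfold PS_derive, PS_plus, PS_scal.
        change (INR (S n) * Im (exp_coef w (S n)) =
          Re w * Im (exp_coef w n) + Im w * Re (exp_coef w n)).
        transitivity (Im (w * exp_coef w n)%C).
        * rewrite <- exp_coef_S; unfold Im; simpl; ring.
        * unfold Re, Im; simpl; ring.
      + apply CV_radius_inside.
        destruct (Req_dec (Re w) 0) as [E|E].
        * rewrite (CV_radius_ext _ (fun _ => 0)); [rewrite CV_radius_const_0; easy|].
          intros n; unfold PS_scal; rewrite E; apply Rmult_0_l.
        * rewrite CV_radius_scal; auto.
      + apply CV_radius_inside.
        destruct (Req_dec (Im w) 0) as [E|E].
        * rewrite (CV_radius_ext _ (fun _ => 0)); [rewrite CV_radius_const_0; easy|].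
          intros n; unfold PS_scal; rewrite E; apply Rmult_0_l.
        * rewrite CV_radius_scal; auto. }
  assert (Z : forall t : R, (Cexp (- w * t) * f t)%C = RtoC 1).
  { intros t; transitivity (Cexp (- w * 0%R) * f 0)%C.
    - apply (Cderive_zero_const (fun t : R => Cexp (- w * t) * f t)%C).
      intros y; eapply is_Cderive_eq.
      + apply is_Cderive_mult; [apply is_Cderive_Cexp|apply D].
      + cring.
    - unfold f; rewrite !PSeries_0.
      replace (- w * 0)%C with (RtoC 0) by ring; rewrite Cexp_0.
      apply C_ext; unfold exp_coef, Re, Im; simpl; field. }
  specialize (Z x).
  replace (- w * x)%C with (- (w * x))%C in Z by ring.
  rewrite Cexp_opp in Z.
  pose proof (Cexp_nz (w * x)).
  replace (f x) with (Cexp (w * x) * (/ Cexp (w * x) * f x))%C by (field; auto).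
  rewrite Z; ring.
Qed.

(* [psi w x = (e^(w x) - 1) / x], with value [w] at [x = 0]. *)
Definition psi (w : C) (x : R) : C :=
  (PSeries (PS_decr_1 (fun n => Re (exp_coef w n))) x,
   PSeries (PS_decr_1 (fun n => Im (exp_coef w n))) x).

Lemma psi_spec (w : C) (x : R) : (x * psi w x)%C = (Cexp (w * x) - 1)%C.
Proof.
  rewrite Cexp_PSeries.
  rewrite (PSeries_decr_1 (fun n => Re (exp_coef w n))), (PSeries_decr_1 (fun n => Im (exp_coef w n))).
  - apply C_ext; unfold psi, exp_coef, Re, Im; simpl; field.
  - apply CV_radius_inside, (CV_radius_exp_type _ 1 (Cmod w) (Cmod_ge_0 w)).
    intros n; apply Re_exp_coef_bound.
  - apply CV_radius_inside, (CV_radius_exp_type _ 1 (Cmod w) (Cmod_ge_0 w)).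
    intros n; apply Re_exp_coef_bound.
Qed.

Lemma psi_0 (w : C) : psi w 0 = w.
Proof.
  unfold psi; rewrite !PSeries_0; unfold PS_decr_1, exp_coef.
  apply C_ext; unfold Re, Im; simpl; field.
Qed.

Lemma exp_coef_decr_bound (w : C) n :
  Cmod w ^ S n / INR (Factorial.fact (S n)) <= Cmod w * (Cmod w ^ n / INR (Factorial.fact n)).
Proof.
  change (Factorial.fact (S n)) with (S n * Factorial.fact n)%nat.
  rewrite mult_INR; simpl pow.
  pose proof (Cmod_ge_0 w). pose proof (pow_le _ n H).
  assert (0 < INR (Factorial.fact n)) by apply lt_0_INR, Factorial.lt_O_fact.
  assert (1 <= INR (S n)) by (rewrite S_INR; pose proof (pos_INR n); lra).
  replace (Cmod w * Cmod w ^ n / (INR (S n) * INR (Factorial.fact n)))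
    with ((Cmod w * (Cmod w ^ n / INR (Factorial.fact n))) * / INR (S n)) by (field; lra).
  rewrite <- Rmult_1_r. apply Rmult_le_compat_l.
  - apply Rmult_le_pos; auto. apply Rdiv_le_0_compat; auto.
  - rewrite <- Rinv_1. apply Rinv_le_contravar; lra.
Qed.

Lemma esmooth_psi (w : C) :
  esmooth (fun x => Re (psi w x)) /\ esmooth (fun x => Im (psi w x)).
Proof.
  split; (apply esmooth_PSeries with (Cmod w) (Cmod w); [apply Cmod_ge_0|]); intros n;
    (eapply Rle_trans; [|apply exp_coef_decr_bound]); unfold PS_decr_1;
    rewrite <- (Rmult_1_l (Cmod w ^ S n / _)); apply Re_exp_coef_bound.
Qed.

Lemma esmooth_Cexp (w : C) :
  esmooth (fun x => Re (Cexp (w * x))) /\ esmooth (fun x => Im (Cexp (w * x))).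
Proof.
  split; (eapply esmooth_ext; [intros x; rewrite Cexp_PSeries; reflexivity|]);
    apply esmooth_PSeries with 1 (Cmod w); try apply Cmod_ge_0;
    intros n; apply Re_exp_coef_bound.
Qed.

(** * Polynomials with real coefficients *)

Fixpoint peval (l : list R) (x : C) : C :=
  match l with
  | [] => RtoC 0
  | c :: t => (c + x * peval t x)%C
  end.

Fixpoint rpeval (l : list R) (x : R) : R :=
  match l with
  | [] => 0
  | c :: t => c + x * rpeval t x
  end.

(* The differential operator with symbol [l], where [U i] is the [i]-th derivative. *)
Fixpoint diffop (l : list R) (U : nat -> C) : C :=
  match l with
  | [] => RtoC 0
  | c :: t => (c * U O + diffop t (fun n => U (S n)))%C
  end.

Lemma peval_RtoC l x : peval l (RtoC x) = RtoC (rpeval l x).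
Proof.
  induction l as [|c t IH]; simpl; auto.
  now rewrite IH, RtoC_plus, RtoC_mult.
Qed.

Fixpoint padd (l m : list R) : list R :=
  match l, m with
  | [], _ => m
  | _, [] => l
  | a :: l', b :: m' => (a + b) :: padd l' m'
  end.

Definition pscal (c : R) (l : list R) : list R := map (Rmult c) l.

Fixpoint pmul (l m : list R) : list R :=
  match l with
  | [] => []
  | c :: t => padd (pscal c m) (0 :: pmul t m)
  end.

Lemma peval_padd l m x : peval (padd l m) x = (peval l x + peval m x)%C.
Proof.
  revert m; induction l as [|a l IH]; intros [|b m]; simpl; try ring.
  rewrite IH, RtoC_plus; ring.
Qed.

Lemma peval_pscal c l x : peval (pscal c l) x = (c * peval l x)%C.
Proof.
  induction l as [|a l IH]; [simpl; ring|].
  change (pscal c (a :: l)) with (c * a :: pscal c l); simpl.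
  rewrite RtoC_mult, IH; ring.
Qed.

Lemma peval_pmul l m x : peval (pmul l m) x = (peval l x * peval m x)%C.
Proof.
  induction l as [|a l IH]; simpl; try ring.
  rewrite peval_padd, peval_pscal; simpl; rewrite IH; ring.
Qed.

Lemma length_padd l m d : (length l <= d -> length m <= d -> length (padd l m) <= d)%nat.
Proof.
  revert m d; induction l as [|a l IH]; intros [|b m] d; simpl; auto.
  intros H1 H2; destruct d as [|d]; [lia|].
  enough (length (padd l m) <= d)%nat by lia; apply IH; lia.
Qed.

Lemma length_pmul l m d e :
  (length l <= S d -> length m <= S e -> length (pmul l m) <= S (d + e))%nat.
Proof.
  revert d; induction l as [|a l IH]; intros d H1 H2; simpl; [lia|].
  apply length_padd.
  - unfold pscal; rewrite length_map; lia.
  - simpl in *. destruct l as [|b l]; [simpl; lia|].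
    destruct d as [|d]; [simpl in H1; lia|].
    enough (length (pmul (b :: l) m) <= S (d + e))%nat by lia.
    apply IH; lia.
Qed.

(** Coefficients are real but the argument is complex, since evaluation at [nu] is needed. The list
    matters as much as the function: it is read as a differential operator by [diffop]. *)
Definition is_poly (d : nat) (f : C -> C) : Prop :=
  exists l, (length l <= S d)%nat /\ forall x, f x = peval l x.

Lemma is_poly_ext d f g : (forall x, f x = g x) -> is_poly d f -> is_poly d g.
Proof. intros E (l & H1 & H2); exists l; split; auto; intros; now rewrite <- E. Qed.

Lemma is_poly_le d e f : (d <= e)%nat -> is_poly d f -> is_poly e f.
Proof. intros E (l & H1 & H2); exists l; split; auto; lia. Qed.

Lemma is_poly_const d (c : R) : is_poly d (fun _ => RtoC c).
Proof. exists [c]; simpl; split; [lia|intros; ring]. Qed.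

Lemma is_poly_id : is_poly 1 (fun x => x).
Proof. exists [0; 1]; simpl; split; [lia|intros; ring]. Qed.

Lemma is_poly_plus d f g :
  is_poly d f -> is_poly d g -> is_poly d (fun x => f x + g x)%C.
Proof.
  intros (l & H1 & H2) (m & H3 & H4); exists (padd l m); split.
  - now apply length_padd.
  - intros x; now rewrite H2, H4, peval_padd.
Qed.

Lemma is_poly_mult d e f g :
  is_poly d f -> is_poly e g -> is_poly (d + e) (fun x => f x * g x)%C.
Proof.
  intros (l & H1 & H2) (m & H3 & H4); exists (pmul l m); split.
  - now apply length_pmul.
  - intros x; now rewrite H2, H4, peval_pmul.
Qed.

Lemma is_poly_scal d (c : R) f : is_poly d f -> is_poly d (fun x => c * f x)%C.
Proof. apply (is_poly_mult 0 d (fun _ => RtoC c)), is_poly_const. Qed.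

Lemma is_poly_affine (a b : R) : is_poly 1 (fun x => a * x + b)%C.
Proof.
  apply is_poly_plus; [apply is_poly_scal, is_poly_id|apply is_poly_const].
Qed.

Lemma is_poly_comp d f (a b : R) :
  is_poly d f -> is_poly d (fun x => f (a * x + b)%C).
Proof.
  intros (l & H1 & H2).
  apply is_poly_ext with (fun x => peval l (a * x + b)%C); [intros; now rewrite H2|].
  clear f H2; revert d H1; induction l as [|c t IH]; intros d H1; simpl.
  - apply is_poly_const.
  - apply is_poly_plus; [apply is_poly_const|].
    simpl in H1; destruct d as [|d].
    + destruct t; [|simpl in H1; lia]. simpl.
      apply is_poly_ext with (fun _ => RtoC 0); [intros; ring|apply is_poly_const].
    + apply (is_poly_mult 1 d); [apply is_poly_affine|apply IH; lia].
Qed.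

(** A limit is assumed rather than vanishing because it passes to the tail of the list:
    [t(n) = (p(n) - c) / n] tends to 0 as well. Once the tail is known to be zero, the limit of the
    constant [c] is [c] itself. *)
Lemma rpeval_zero_limit l :
  is_lim_seq (fun n => rpeval l (INR n)) 0 -> List.Forall (eq 0) l.
Proof.
  induction l as [|c t IH]; simpl; intros H; constructor.
  2: apply IH.
  1: assert (Ht : List.Forall (eq 0) t).
  1: apply IH.
  1, 3: apply is_lim_seq_incr_1;
    apply is_lim_seq_ext with
      (fun n => (c + INR (S n) * rpeval t (INR (S n)) - c) * / INR (S n));
    [intros n; field; apply not_0_INR; lia|];
    apply is_lim_seq_incr_1 in H;
    apply (is_lim_seq_incr_1
      (fun n => (c + INR n * rpeval t (INR n) - c) * / INR n));
    apply is_lim_seq_incr_1;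
    replace (Finite 0) with (Finite ((0 - c) * 0)) by (f_equal; ring);
    apply is_lim_seq_mult';
    [apply is_lim_seq_minus'; [exact H|apply is_lim_seq_const]|];
    apply (is_lim_seq_incr_1 (fun n => / INR n));
    replace (Finite 0) with (Rbar_inv p_infty) by easy;
    apply is_lim_seq_inv; [apply is_lim_seq_INR|easy].
  assert (Z : forall x, rpeval t x = 0).
  { clear - Ht; induction Ht; intros; simpl; auto. rewrite IHHt; subst; ring. }
  apply is_lim_seq_ext with (v := fun _ => c) in H.
  - assert (E := is_lim_seq_unique _ _ H). rewrite Lim_seq_const in E. now inversion E.
  - intros n; rewrite Z; ring.
Qed.

Lemma peval_zero_coefs l x : List.Forall (eq 0) l -> peval l x = 0.
Proof. induction 1; simpl; auto. subst; rewrite IHForall; ring. Qed.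

Lemma diffop_zero_coefs l U : List.Forall (eq 0) l -> diffop l U = 0.
Proof.
  intros H; revert U; induction H; intros U; simpl; auto. subst; rewrite IHForall; ring.
Qed.

Lemma poly_zero_coefs l : (forall n, peval l (INR n) = 0) -> List.Forall (eq 0) l.
Proof.
  intros H; apply rpeval_zero_limit, is_lim_seq_ext with (fun _ => 0).
  - intros n; apply RtoC_inj; rewrite <- peval_RtoC; auto.
  - apply is_lim_seq_const.
Qed.

(** Identity principle over the naturals. It carries relations proved with real binomials and real
    powers to complex arguments. *)
Lemma is_poly_eq d e f g : is_poly d f -> is_poly e g ->
  (forall n, f (RtoC (INR n)) = g (RtoC (INR n))) -> forall x, f x = g x.
Proof.
  intros (l & _ & H2) (m & _ & H4) E x.
  assert (Z : List.Forall (eq 0) (padd l (pscal (-1) m))).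
  { apply poly_zero_coefs; intros n.
    rewrite peval_padd, peval_pscal, <- H2, <- H4, E; ring. }
  assert (Y := peval_zero_coefs _ x Z).
  rewrite peval_padd, peval_pscal, <- H2, <- H4 in Y.
  replace (f x) with (f x + (-1) * g x + g x)%C by ring.
  rewrite Y; ring.
Qed.

Lemma diffop_padd l m U : diffop (padd l m) U = (diffop l U + diffop m U)%C.
Proof.
  revert m U; induction l as [|a l IH]; intros [|b m] U; simpl; try ring.
  rewrite IH, RtoC_plus; ring.
Qed.

Lemma diffop_pscal c l U : diffop (pscal c l) U = (c * diffop l U)%C.
Proof.
  revert U; induction l as [|a l IH]; intros U; [simpl; ring|].
  change (pscal c (a :: l)) with (c * a :: pscal c l); simpl.
  rewrite RtoC_mult, IH; ring.
Qed.

(** Lists with equal values may still differ by trailing zeros, so operators are identified through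
    the values of their symbols. *)
Lemma diffop_eq l m U : (forall n, peval l (INR n) = peval m (INR n)) -> diffop l U = diffop m U.
Proof.
  intros E.
  assert (Z : List.Forall (eq 0) (padd l (pscal (-1) m))).
  { apply poly_zero_coefs; intros n. rewrite peval_padd, peval_pscal, E; ring. }
  apply (diffop_zero_coefs _ U) in Z.
  rewrite diffop_padd, diffop_pscal in Z.
  replace (diffop l U) with (diffop l U + (-1) * diffop m U + diffop m U)%C by ring.
  rewrite Z; ring.
Qed.

(** * Taylor coefficients of a polynomial at 0 *)

Fixpoint pder (l : list R) : list R :=
  match l with
  | [] => []
  | c :: t => padd t (0 :: pder t)
  end.

Lemma rpeval_padd l m x : rpeval (padd l m) x = rpeval l x + rpeval m x.
Proof.
  revert m; induction l as [|a l IH]; intros [|b m]; simpl; try ring.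
  rewrite IH; ring.
Qed.

Lemma is_derive_rpeval l x : is_derive (rpeval l) x (rpeval (pder l) x).
Proof.
  induction l as [|c t IH].
  - simpl; apply is_derive_Rconst.
  - change (is_derive (fun x => c + x * rpeval t x) x (rpeval (pder (c :: t)) x)).
    simpl pder; rewrite rpeval_padd; simpl.
    eapply is_derive_eq.
    + apply is_derive_Rplus; [apply is_derive_Rconst|].
      apply Derive.is_derive_mult; [|exact IH].
      apply (is_derive_id (K := R_AbsRing)).
    + change (one (K := R_AbsRing)) with 1; simpl.
      change (@eq R (0 + (1 * rpeval t x + x * rpeval (pder t) x)) (rpeval t x + (0 + x * rpeval (pder t) x))).
      ring.
Qed.

Lemma nth_padd l m k : nth k (padd l m) 0 = nth k l 0 + nth k m 0.
Proof.
  revert m k; induction l as [|a l IH]; intros [|b m] [|k]; simpl; try ring; auto.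
Qed.

Lemma nth_pder l k : nth k (pder l) 0 = INR (S k) * nth (S k) l 0.
Proof.
  revert k; induction l as [|c t IH]; intros k.
  - destruct k; simpl nth; ring.
  - simpl pder; rewrite nth_padd. destruct k as [|k].
    + simpl; ring.
    + change (nth (S k) (0 :: pder t) 0) with (nth k (pder t) 0).
      rewrite IH. change (nth (S (S k)) (c :: t) 0) with (nth (S k) t 0).
      rewrite (S_INR (S k)); ring.
Qed.

Lemma Derive_n_rpeval l k x : Derive_n (rpeval l) k x = rpeval (Nat.iter k pder l) x.
Proof.
  revert x; induction k as [|k IH]; intros x; simpl; auto.
  rewrite (Derive_ext _ _ _ IH). apply is_derive_unique, is_derive_rpeval.
Qed.

(** The factorial weights on both sides keep falling factorials out of the induction. *)
Lemma nth_iter_pder l k j :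
  INR (Factorial.fact j) * nth j (Nat.iter k pder l) 0 = INR (Factorial.fact (k + j)) * nth (k + j) l 0.
Proof.
  revert j; induction k as [|k IH]; intros j; simpl Nat.iter; auto.
  rewrite nth_pder.
  replace (S k + j)%nat with (k + S j)%nat by lia.
  rewrite <- IH. change (Factorial.fact (S j)) with (S j * Factorial.fact j)%nat.
  rewrite mult_INR; ring.
Qed.

(** This reads [pcoef] as an entry of a coefficient list, so that the sum over [l] in the theorem
    becomes the operator [P_{2k}(D)]. *)
Lemma Derive_n_poly_0 (p : R -> R) l k : (forall x, p x = rpeval l x) ->
  / INR (Factorial.fact k) * Derive_n p k 0 = nth k l 0.
Proof.
  intros H; rewrite (Derive_n_ext _ _ k 0 H), Derive_n_rpeval.
  assert (E := nth_iter_pder l k 0). rewrite Nat.add_0_r in E. simpl in E.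
  rewrite Rmult_1_l in E.
  replace (rpeval (Nat.iter k pder l) 0) with (nth 0 (Nat.iter k pder l) 0).
  - rewrite E; field. apply INR_fact_neq_0.
  - destruct (Nat.iter k pder l); simpl; ring.
Qed.

Lemma Csum_n_S (f : nat -> C) n : sum_n f (S n) = (sum_n f n + f (S n))%C.
Proof. now rewrite sum_Sn. Qed.

Lemma Csum_n_shift (f : nat -> C) n : sum_n f (S n) = (f O + sum_n (fun k => f (S k)) n)%C.
Proof.
  induction n as [|n IH].
  - rewrite Csum_n_S, !sum_O; auto.
  - rewrite Csum_n_S, IH, Csum_n_S; cring.
Qed.

Lemma diffop_sum_n l U d : (length l <= S d)%nat ->
  diffop l U = sum_n (fun i => nth i l 0%R * U i)%C d.
Proof.
  revert U d; induction l as [|c t IH]; intros U d H.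
  - simpl diffop. induction d as [|d IHd].
    + rewrite sum_O; simpl; cring.
    + rewrite Csum_n_S, <- IHd; simpl; [cring|lia].
  - simpl diffop; destruct d as [|d].
    + destruct t; [|simpl in H; lia]. rewrite sum_O; simpl; cring.
    + rewrite Csum_n_shift, (IH _ d); [reflexivity|simpl in H; lia].
Qed.

(** * Norlund polynomials *)

(** The entire function [(e^x - 1) / x], reciprocal of [todd]; regularity of [todd] is inherited
    from it. *)
Definition phi (x : R) : R := Re (psi 1 x).

Lemma phi_spec x : x * phi x = exp x - 1.
Proof.
  assert (E := psi_spec 1 x).
  rewrite Cmult_1_l, Cexp_RtoC in E.
  apply (f_equal Re) in E.
  change (x * Re (psi 1 x) - 0 * Im (psi 1 x) = exp x - 1) in E.
  unfold phi; lra.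
Qed.

Lemma phi_0 : phi 0 = 1.
Proof. unfold phi; now rewrite psi_0. Qed.

Lemma exp_ineq_le x : 1 + x <= exp x.
Proof.
  destruct (Req_dec x 0) as [->|H]; [rewrite exp_0; lra|].
  now apply Rlt_le, exp_ineq1.
Qed.

(** Both bounds follow from [1 + x <= e^x] at [x] and at [- x]. The lower one bounds [todd], and the
    pair bounds powers of [todd] with exponents of either sign. *)
Lemma phi_bounds x : exp (- Rabs x) <= phi x <= exp (Rabs x).
Proof.
  assert (E := phi_spec x).
  assert (H1 := exp_ineq_le x); assert (H2 := exp_ineq_le (- x)).
  assert (P := exp_pos x).
  assert (I : exp x * exp (- x) = 1) by (rewrite <- exp_plus, Rplus_opp_r; apply exp_0).
  destruct (total_order_T x 0) as [[h|h]|h].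
  - rewrite Rabs_left, Ropp_involutive by easy.
    assert (P' := exp_pos (- x)).
    split; apply Rmult_le_reg_l with (- x); try lra; nra.
  - rewrite h, Rabs_R0, Ropp_0, exp_0, phi_0; lra.
  - rewrite Rabs_pos_eq by lra.
    assert (P' := exp_pos (- x)).
    split; apply Rmult_le_reg_l with x; try lra; nra.
Qed.

Lemma phi_pos x : 0 < phi x.
Proof. eapply Rlt_le_trans; [apply exp_pos|apply phi_bounds]. Qed.

Lemma todd_inv_phi x : todd x = / phi x.
Proof.
  unfold todd; destruct (Req_EM_T x 0) as [->|H].
  - rewrite phi_0; field.
  - rewrite <- phi_spec; pose proof (phi_pos x); field; lra.
Qed.

Lemma esmooth_phi : esmooth phi.
Proof. exact (proj1 (esmooth_psi 1)). Qed.

Lemma todd_pos x : 0 < todd x.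
Proof. rewrite todd_inv_phi; apply Rinv_0_lt_compat, phi_pos. Qed.

Lemma todd_bounds x : exp (- Rabs x) <= todd x <= exp (Rabs x).
Proof.
  rewrite todd_inv_phi; destruct (phi_bounds x) as [H1 H2].
  pose proof (phi_pos x); pose proof (exp_pos (- Rabs x)); pose proof (exp_pos (Rabs x)).
  split.
  - rewrite exp_Ropp. now apply Rinv_le_contravar.
  - rewrite <- (Rinv_inv (exp (Rabs x))), <- exp_Ropp. now apply Rinv_le_contravar.
Qed.

Lemma esmooth_todd : esmooth todd.
Proof.
  apply esmooth_ext with (fun x => / phi x); [intros; now rewrite todd_inv_phi|].
  apply esmooth_inv; auto using esmooth_phi, phi_pos.
  exists 1, 1; repeat split; try lra.
  intros x; rewrite <- todd_inv_phi, !Rmult_1_l, Rabs_pos_eq; [apply todd_bounds|].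
  apply Rlt_le, todd_pos.
Qed.

Lemma todd_0 : todd 0 = 1.
Proof. rewrite todd_inv_phi, phi_0; field. Qed.

(** Differentiating [t * phi t = exp t - 1] and inserting [todd = 1 / phi]. This equation is the
    source of the recursion for the Norlund polynomials. *)
Lemma todd_ode t : t * Derive todd t = todd t * (1 - t - todd t).
Proof.
  assert (E : forall x, Derive (fun x => x * phi x) x = exp x).
  { intros x; rewrite (Derive_ext _ (fun x => exp x - 1)) by apply phi_spec.
    apply is_derive_unique; auto_derive; auto; ring. }
  specialize (E t).
  assert (D := esmooth_is_derive _ t esmooth_phi).
  rewrite (is_derive_unique _ _ (1 * phi t + t * Derive phi t)) in E
    by (apply Derive.is_derive_mult; [apply (is_derive_id (K := R_AbsRing))|exact D]).
  assert (S := phi_spec t).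
  assert (D2 : Derive todd t = - Derive phi t / phi t ^ 2).
  { rewrite (Derive_ext _ _ _ todd_inv_phi).
    apply is_derive_unique, is_derive_inv; auto. pose proof (phi_pos t); lra. }
  rewrite D2, todd_inv_phi. pose proof (phi_pos t).
  replace (t * (- Derive phi t / phi t ^ 2)) with (- (t * Derive phi t) / phi t ^ 2) by (field; lra).
  replace (t * Derive phi t) with (1 + t * phi t - phi t) by lra.
  field; lra.
Qed.

Definition toddpow (s t : R) : R := Rpower (todd t) s.

Lemma toddpow_pos s t : 0 < toddpow s t.
Proof. apply exp_pos. Qed.

Definition logder (t : R) : R := Derive todd t * phi t.

Lemma is_derive_toddpow s t : is_derive (toddpow s) t (s * logder t * toddpow s t).
Proof.
  unfold toddpow, Rpower, logder.
  pose proof (todd_pos t).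
  eapply is_derive_eq.
  - apply (is_derive_Rcomp exp (fun t => s * ln (todd t))); [apply is_derive_exp|].
    apply is_derive_scal, (is_derive_Rcomp ln todd); [now apply is_derive_ln|].
    apply esmooth_is_derive, esmooth_todd.
  - rewrite todd_inv_phi at 1. rewrite Rinv_inv. ring.
Qed.

Lemma esmooth_logder : esmooth logder.
Proof.
  apply esmooth_mult; [apply esmooth_Derive, esmooth_todd|apply esmooth_phi].
Qed.

Lemma esmooth_toddpow s : esmooth (toddpow s).
Proof.
  apply esm_of_rec with (fun t => s * logder t * toddpow s t).
  - exists 1, (Rabs s); repeat split; try lra; try apply Rabs_pos.
    intros t; rewrite Rabs_pos_eq by apply Rlt_le, toddpow_pos.
    rewrite Rmult_1_l; apply exp_le.
    eapply Rle_trans; [apply Rle_abs|]. rewrite Rabs_mult.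
    apply Rmult_le_compat_l; [apply Rabs_pos|].
    destruct (todd_bounds t) as [H1 H2].
    pose proof (todd_pos t).
    apply Rabs_le; split.
    + rewrite <- (ln_exp (- Rabs t)). apply ln_le; [apply exp_pos|easy].
    + rewrite <- (ln_exp (Rabs t)). now apply ln_le.
  - apply is_derive_toddpow.
  - intros n Hn; apply esm_mult; auto.
    apply esm_mult; [apply esm_const|apply esmooth_logder].
Qed.

Lemma toddpow_S s t : toddpow s t * todd t = toddpow (s + 1) t.
Proof.
  unfold toddpow; rewrite Rpower_plus, Rpower_1; auto. apply todd_pos.
Qed.

Lemma toddpow_ode s t :
  t * Derive (toddpow s) t =
  s * toddpow s t + (- s * (t * toddpow s t) + - s * toddpow (s + 1) t).
Proof.
  rewrite (is_derive_unique _ _ _ (is_derive_toddpow s t)), <- toddpow_S.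
  unfold logder.
  replace (t * (s * (Derive todd t * phi t) * toddpow s t))
    with (s * phi t * toddpow s t * (t * Derive todd t)) by ring.
  rewrite todd_ode, todd_inv_phi. pose proof (phi_pos t); field; lra.
Qed.

Lemma Derive_n_lin f g a b n t : esmooth f -> esmooth g ->
  Derive_n (fun t => a * f t + b * g t) n t = a * Derive_n f n t + b * Derive_n g n t.
Proof.
  intros Hf Hg; revert t; induction n as [|n IH]; intros t; simpl; auto.
  rewrite (Derive_ext _ _ _ IH). apply is_derive_unique.
  apply is_derive_Rplus; apply is_derive_scal, esmooth_is_derive, esmooth_Derive_n; auto.
Qed.

Lemma Derive_n_id_mult f k t : esmooth f ->
  Derive_n (fun t => t * f t) k t = t * Derive_n f k t + INR k * Derive_n f (pred k) t.
Proof.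
  intros Hf; revert t; induction k as [|k IH]; intros t; [simpl; ring|].
  simpl Derive_n at 1.
  rewrite (Derive_ext _ _ _ IH). apply is_derive_unique.
  eapply is_derive_eq.
  - apply is_derive_Rplus.
    + apply Derive.is_derive_mult; [apply (is_derive_id (K := R_AbsRing))|].
      apply esmooth_is_derive, esmooth_Derive_n, Hf.
    + apply is_derive_scal, esmooth_is_derive, esmooth_Derive_n, Hf.
  - change (one (K := R_AbsRing)) with 1. rewrite S_INR.
    destruct k as [|k]; simpl; ring.
Qed.

(** Compares the derivatives of order [S m] at 0 of both sides of [toddpow_ode]. On the left the
    factor [t] becomes the number [INR (S m)]; on the right it produces the term with
    [norlund m]. *)
Lemma norlund_rec s m :
  s * norlund (S m) (s + 1) =
  (s - INR (S m)) * norlund (S m) s - INR (S m) * s * norlund m s.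
Proof.
  assert (I := esmooth_toddpow s); assert (I' := esmooth_toddpow (s + 1)).
  (* The identity function has the required growth and regularity because it equals
     [todd t * (exp t - 1)]. *)
  assert (Iid : esmooth (fun t => t * toddpow s t)).
  { apply esmooth_mult; auto.
    intros n; apply esm_ext with (fun t => phi t * todd t * t).
    - intros t; rewrite todd_inv_phi; pose proof (phi_pos t); field; lra.
    - apply esm_ext with (fun t => todd t * (exp t - 1)).
      + intros t; rewrite <- phi_spec; ring.
      + apply esm_mult; [apply esmooth_todd|].
        apply esm_plus; [|apply esm_const].
        apply esm_ext with (fun t => Re (Cexp (1 * RtoC t))); [|apply esmooth_Cexp].
        intros t; now rewrite Cmult_1_l, Cexp_RtoC. }
  assert (E := Derive_n_ext _ _ (S m) 0 (toddpow_ode s)).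
  rewrite Derive_n_id_mult in E by now apply esmooth_Derive.
  rewrite Rmult_0_l, Rplus_0_l in E; simpl pred in E.
  assert (E2 : Derive_n (Derive (toddpow s)) m 0 = norlund (S m) s).
  { unfold norlund. change (fun t => Rpower (todd t) s) with (toddpow s).
    replace (S m) with (m + 1)%nat by lia. symmetry.
    rewrite <- Derive_n_comp. reflexivity. }
  rewrite E2 in E.
  rewrite (Derive_n_ext _ (fun t => s * toddpow s t + 1 * (- s * (t * toddpow s t) + - s * toddpow (s + 1) t)))
    in E by (intros; ring).
  rewrite Derive_n_lin in E; auto.
  2:{ apply esmooth_plus; apply esmooth_mult; auto using esmooth_const. }
  rewrite Derive_n_lin, Derive_n_id_mult in E; auto.
  unfold norlund.
  change (fun t => Rpower (todd t) s) with (toddpow s).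
  change (fun t => Rpower (todd t) (s + 1)) with (toddpow (s + 1)).
  unfold norlund in E. change (fun t => Rpower (todd t) s) with (toddpow s) in E.
  simpl pred in E. lra.
Qed.

Lemma norlund_0 s : norlund 0 s = 1.
Proof.
  unfold norlund; simpl; rewrite todd_0; unfold Rpower; rewrite ln_1, Rmult_0_r; apply exp_0.
Qed.

(** * Polynomial dependence of the Norlund polynomials on the order *)

(** A list of functions stands for a polynomial in [s] whose coefficients depend on [t]; [at_point]
    freezes [t]. *)
Fixpoint fadd (l m : list (R -> R)) : list (R -> R) :=
  match l, m with
  | [], _ => m
  | _, [] => l
  | a :: l', b :: m' => (fun t => a t + b t) :: fadd l' m'
  end.

Definition at_point (t : R) (L : list (R -> R)) : list R := map (fun c => c t) L.

Lemma rpeval_fadd l m t x :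
  rpeval (at_point t (fadd l m)) x = rpeval (at_point t l) x + rpeval (at_point t m) x.
Proof.
  revert m; induction l as [|a l IH]; intros [|b m]; simpl; try ring.
  fold (at_point t (fadd l m)); rewrite IH; unfold at_point; ring.
Qed.

Lemma length_fadd l m d : (length l <= d -> length m <= d -> length (fadd l m) <= d)%nat.
Proof.
  revert m d; induction l as [|a l IH]; intros [|b m] d; simpl; auto.
  intros H1 H2; destruct d as [|d]; [lia|].
  enough (length (fadd l m) <= d)%nat by lia; apply IH; lia.
Qed.

Lemma esmooth_fadd l m :
  List.Forall esmooth l -> List.Forall esmooth m -> List.Forall esmooth (fadd l m).
Proof.
  intros H; revert m; induction H; intros m Hm; simpl; auto.
  inversion Hm; subst; constructor; auto. now apply esmooth_plus.
Qed.

Lemma is_derive_at_point L s t : List.Forall esmooth L ->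
  is_derive (fun t => rpeval (at_point t L) s) t (rpeval (at_point t (map Derive L)) s).
Proof.
  induction 1 as [|c L Hc HL IH]; simpl.
  - apply is_derive_Rconst.
  - apply is_derive_Rplus; [now apply esmooth_is_derive|]. now apply is_derive_scal.
Qed.

Lemma rpeval_at_point_cons c L t s :
  rpeval (at_point t (c :: L)) s = c t + s * rpeval (at_point t L) s.
Proof. reflexivity. Qed.

Lemma rpeval_at_point_map_mult (w : R -> R) L t s :
  rpeval (at_point t (map (fun c t => w t * c t) L)) s = w t * rpeval (at_point t L) s.
Proof.
  induction L as [|c L IH]; [simpl; ring|].
  change (map (fun c t => w t * c t) (c :: L)) with
    ((fun t => w t * c t) :: map (fun c t => w t * c t) L).
  rewrite !rpeval_at_point_cons, IH; ring.
Qed.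

(** Each differentiation either acts on a coefficient or brings down [s * logder t], so the degree
    in [s] grows by at most one per derivative. *)
Lemma Derive_n_toddpow n : exists L, (length L <= S n)%nat /\ List.Forall esmooth L /\
  forall s t, Derive_n (toddpow s) n t = rpeval (at_point t L) s * toddpow s t.
Proof.
  induction n as [|n (L & H1 & H2 & H3)].
  - exists [fun _ => 1]; repeat split; auto.
    + constructor; auto using esmooth_const.
    + intros; simpl; ring.
  - exists (fadd (map Derive L) ((fun _ => 0) :: map (fun c t => logder t * c t) L)).
    repeat split.
    + apply length_fadd; simpl; rewrite ?length_map; lia.
    + apply esmooth_fadd; [|constructor; auto using esmooth_const].
      * clear H1 H3; induction H2; simpl; constructor; auto using esmooth_Derive.
      * clear H1 H3; induction H2; simpl; constructor; auto.
        apply esmooth_mult; auto using esmooth_logder.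
    + intros s t; simpl. rewrite (Derive_ext _ _ _ (H3 s)).
      apply is_derive_unique. eapply is_derive_eq.
      * apply Derive.is_derive_mult; [now apply is_derive_at_point|apply is_derive_toddpow].
      * rewrite rpeval_fadd, rpeval_at_point_cons, rpeval_at_point_map_mult; ring.
Qed.

Lemma norlund_poly n :
  exists l, (length l <= S n)%nat /\ forall s, norlund n s = rpeval l s.
Proof.
  destruct (Derive_n_toddpow n) as (L & H1 & _ & H3).
  exists (at_point 0 L); split.
  - unfold at_point; now rewrite length_map.
  - intros s; unfold norlund. change (fun t => Rpower (todd t) s) with (toddpow s).
    rewrite H3; unfold toddpow, Rpower; rewrite todd_0, ln_1, Rmult_0_r, exp_0; ring.
Qed.

(** [norlund] is defined through a real power and thus at real orders only; a coefficient list
    extends it to complex orders. *)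
Definition norlund_list (n : nat) : list R :=
  epsilon (inhabits []) (fun l => (length l <= S n)%nat /\ forall s, norlund n s = rpeval l s).

Lemma norlund_list_spec n :
  (length (norlund_list n) <= S n)%nat /\ forall s, norlund n s = rpeval (norlund_list n) s.
Proof. unfold norlund_list; apply epsilon_spec, norlund_poly. Qed.

(** * Coefficients in the expansion of a Gamma quotient *)

Fixpoint cbinom (x : C) (m : nat) : C :=
  match m with
  | O => RtoC 1
  | S i => (cbinom x i * ((x - INR i) / INR (S i)))%C
  end.

Lemma INR_S_nz n : RtoC (INR (S n)) <> 0.
Proof. intros E; apply RtoC_inj in E; revert E; apply not_0_INR; lia. Qed.

Lemma cbinom_RtoC (x : R) m : cbinom x m = RtoC (gbinom x m).
Proof.
  induction m as [|m IH]; auto.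
  cbn [cbinom gbinom]; rewrite IH, RtoC_div, RtoC_mult, RtoC_minus.
  - pose proof (INR_S_nz m); cfield; auto.
  - apply not_0_INR; lia.
Qed.

Lemma is_poly_cbinom m : is_poly m (fun x => cbinom x m).
Proof.
  induction m as [|m IH]; cbn [cbinom].
  - apply is_poly_const.
  - apply is_poly_le with (m + 1)%nat; [lia|].
    apply is_poly_mult; auto.
    apply is_poly_ext with (fun x => RtoC (/ INR (S m)) * x + RtoC (- INR m / INR (S m)))%C.
    + intros x. pose proof (INR_S_nz m) as N.
      assert (INR (S m) <> 0) by (apply not_0_INR; lia).
      rewrite RtoC_div, RtoC_inv, RtoC_opp by auto; revert N; generalize (RtoC (INR (S m))); intros y N. cfield; auto.
    + apply is_poly_affine.
Qed.

(* [Gamma(a) / Gamma(a - x) ~ a^x sum_m (qpoly m x) / a^m] as [a -> +oo]. *)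
Definition qpoly (m : nat) (x : C) : C := (cbinom x m * peval (norlund_list m) (1 + x))%C.

Lemma qpoly_RtoC m (x : R) : qpoly m x = RtoC (gbinom x m * norlund m (1 + x)).
Proof.
  unfold qpoly. rewrite cbinom_RtoC, <- RtoC_plus, peval_RtoC.
  rewrite <- (proj2 (norlund_list_spec m)), RtoC_mult; auto.
Qed.

Lemma is_poly_qpoly m : is_poly (2 * m) (qpoly m).
Proof.
  apply is_poly_le with (m + m)%nat; [lia|].
  apply is_poly_mult; [apply is_poly_cbinom|].
  apply is_poly_ext with (fun x => peval (norlund_list m) (1%R * x + 1%R)%C).
  - intros x; apply (f_equal (peval _)); ring.
  - apply (is_poly_comp m (peval (norlund_list m))).
    exists (norlund_list m); split; auto. apply norlund_list_spec.
Qed.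

Lemma qpoly_0 x : qpoly 0 x = 1.
Proof.
  apply (is_poly_eq 0 0 (qpoly 0) (fun _ => RtoC 1)).
  - apply (is_poly_qpoly 0).
  - apply is_poly_const.
  - intros n; rewrite qpoly_RtoC, norlund_0; simpl gbinom. rewrite Rmult_1_l; auto.
Qed.

Lemma gbinom_0_S m : gbinom 0 (S m) = 0.
Proof.
  induction m as [|m IH].
  - simpl; field.
  - cbn [gbinom]; cbn [gbinom] in IH; rewrite IH; unfold Rdiv; ring.
Qed.

Lemma qpoly_S_0 m : qpoly (S m) 0 = 0.
Proof. rewrite qpoly_RtoC, gbinom_0_S; f_equal; ring. Qed.

Lemma gbinom_shift x m : x + 1 <> 0 ->
  gbinom (x + 1) m * (x + 1 - INR m) = (x + 1) * gbinom x m /\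
  gbinom (x + 1) (S m) * INR (S m) = (x + 1) * gbinom x m.
Proof.
  intros Hx.
  assert (A : gbinom (x + 1) m * (x + 1 - INR m) = (x + 1) * gbinom x m).
  { induction m as [|m IH]; [simpl; ring|].
    cbn [gbinom].
    assert (INR (S m) <> 0) by (apply not_0_INR; lia).
    apply Rmult_eq_reg_r with (INR (S m)); auto.
    replace (gbinom (x + 1) m * (x + 1 - INR m) / INR (S m) * (x + 1 - INR (S m)) * INR (S m))
      with ((gbinom (x + 1) m * (x + 1 - INR m)) * (x + 1 - INR (S m))) by (field; auto).
    rewrite IH, (S_INR m) in *. field; auto. }
  split; auto.
  cbn [gbinom]. rewrite <- A. field. apply not_0_INR; lia.
Qed.

(** Term by term this is [Gamma(a) / Gamma(a - x - 1) = (a - x - 1) Gamma(a) / Gamma(a - x)]. For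
    [x + 1 <> 0] it results from [norlund_rec] at [x + 1] and the absorption rules of
    [gbinom_shift]; the naturals are such points and determine both polynomials. *)
Lemma qpoly_rec m x : qpoly (S m) (x + 1) = (qpoly (S m) x - (x + 1) * qpoly m x)%C.
Proof.
  revert x.
  apply (is_poly_eq (2 * S m) (2 * S m)
    (fun x => qpoly (S m) (x + 1)%C) (fun x => qpoly (S m) x - (x + 1) * qpoly m x)%C).
  - apply is_poly_ext with (fun x => qpoly (S m) (1%R * x + 1%R)%C).
    + intros x; apply (f_equal (qpoly _)); ring.
    + apply is_poly_comp, is_poly_qpoly.
  - apply is_poly_ext with (fun x => qpoly (S m) x + (-1)%R * ((1%R * x + 1%R) * qpoly m x))%C.
    + intros x; cring.
    + apply is_poly_plus; [apply is_poly_qpoly|]. apply is_poly_scal.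
      apply is_poly_le with (1 + 2 * m)%nat; [lia|].
      apply is_poly_mult; [apply is_poly_affine|apply is_poly_qpoly].
  - intros n. rewrite <- !RtoC_plus, !qpoly_RtoC, <- RtoC_mult, <- RtoC_minus.
    apply f_equal.
    pose proof (pos_INR n) as P. set (x := INR n) in *.
    assert (Hx : x + 1 <> 0) by lra.
    assert (R := norlund_rec (x + 1) m).
    destruct (gbinom_shift x (S m) Hx) as [G1 _].
    destruct (gbinom_shift x m Hx) as [_ G2].
    replace (1 + (x + 1)) with (x + 1 + 1) by ring. replace (1 + x) with (x + 1) by ring.
    apply Rmult_eq_reg_l with (x + 1); auto.
    transitivity (gbinom (x + 1) (S m) * ((x + 1) * norlund (S m) (x + 1 + 1))); [ring|].
    rewrite R.
    transitivity ((gbinom (x + 1) (S m) * (x + 1 - INR (S m))) * norlund (S m) (x + 1) -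
      (gbinom (x + 1) (S m) * INR (S m)) * (x + 1) * norlund m (x + 1)); [ring|].
    rewrite G1, G2; ring.
Qed.

(** * Taylor expansions at 0+ and the binomial series *)

Fixpoint csum (f : nat -> C) (n : nat) : C :=
  match n with
  | O => RtoC 0
  | S k => (csum f k + f k)%C
  end.

Lemma csum_ext f g n : (forall i, (i < n)%nat -> f i = g i) -> csum f n = csum g n.
Proof.
  induction n as [|n IH]; intros H; simpl; auto.
  rewrite IH, (H n) by (intros; try apply H; lia); auto.
Qed.

Lemma csum_plus f g n : csum (fun i => f i + g i)%C n = (csum f n + csum g n)%C.
Proof. induction n as [|n IH]; simpl; [|rewrite IH]; ring. Qed.

Lemma csum_scal c f n : csum (fun i => c * f i)%C n = (c * csum f n)%C.
Proof. induction n as [|n IH]; simpl; [|rewrite IH]; ring. Qed.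

Lemma csum_shift f n : csum f (S n) = (f O + csum (fun i => f (S i)) n)%C.
Proof.
  induction n as [|n IH]; [simpl; ring|].
  simpl in *; rewrite IH; ring.
Qed.

Lemma csum_sum_n f n : csum f (S n) = sum_n f n.
Proof.
  induction n as [|n IH]; [rewrite sum_O; simpl; cring|].
  rewrite Csum_n_S, <- IH; reflexivity.
Qed.

(** The bound holds on all of [[0, 1]] and not merely near 0, so it applies at every
    [h = 1 / (a + n)] without a threshold. *)
Definition bigO0 (J : nat) (f : R -> C) : Prop :=
  exists M, forall h, 0 <= h <= 1 -> Cmod (f h) <= M * h ^ J.

Lemma bigO0_ext J f g : (forall h, 0 <= h <= 1 -> f h = g h) -> bigO0 J f -> bigO0 J g.
Proof. intros E (M & H); exists M; intros h Hh; rewrite <- E; auto. Qed.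

Lemma bigO0_plus J f g : bigO0 J f -> bigO0 J g -> bigO0 J (fun h => f h + g h)%C.
Proof.
  intros (M & H) (M' & H'); exists (M + M'); intros h Hh.
  eapply Rle_trans; [apply Cmod_triangle|].
  specialize (H h Hh); specialize (H' h Hh); lra.
Qed.

Lemma bigO0_mult J J' f g : bigO0 J f -> bigO0 J' g -> bigO0 (J + J') (fun h => f h * g h)%C.
Proof.
  intros (M & H) (M' & H'); exists (M * M'); intros h Hh.
  rewrite Cmod_mult, pow_add.
  replace (M * M' * (h ^ J * h ^ J')) with ((M * h ^ J) * (M' * h ^ J')) by ring.
  apply Rmult_le_compat; auto using Cmod_ge_0.
Qed.

Lemma bigO0_const c : bigO0 0 (fun _ => c).
Proof. exists (Cmod c); intros; simpl; lra. Qed.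

Lemma bigO0_pow k : bigO0 k (fun h => RtoC h ^ k)%C.
Proof.
  exists 1; intros h Hh; rewrite Cmod_pow, Cmod_R, Rabs_pos_eq by lra; lra.
Qed.

Lemma bigO0_scal J c f : bigO0 J f -> bigO0 J (fun h => c * f h)%C.
Proof. apply (bigO0_mult 0 J (fun _ => c)), bigO0_const. Qed.

Lemma bigO0_le J J' f : (J' <= J)%nat -> bigO0 J f -> bigO0 J' f.
Proof.
  intros HJ (M & H); exists (Rmax M 0); intros h Hh.
  eapply Rle_trans; [now apply H|].
  pose proof (Rmax_l M 0); pose proof (Rmax_r M 0).
  assert (0 <= h ^ J) by (apply pow_le; lra).
  apply Rle_trans with (Rmax M 0 * h ^ J); [nra|].
  apply Rmult_le_compat_l; auto.
  replace J with (J' + (J - J'))%nat by lia. rewrite pow_add.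
  assert (0 <= h ^ J') by (apply pow_le; lra).
  assert (h ^ (J - J') <= 1) by (rewrite <- (pow1 (J - J')); apply pow_incr; lra).
  nra.
Qed.

(** * Complex powers of a positive base and the binomial series *)

Lemma Rcpow_mult x y w : 0 < x -> 0 < y -> Rcpow (x * y) w = (Rcpow x w * Rcpow y w)%C.
Proof.
  intros Hx Hy; unfold Rcpow; rewrite <- Cexp_plus, ln_mult, RtoC_plus; auto.
  apply (f_equal Cexp); ring.
Qed.

Lemma Rcpow_plus x w v : Rcpow x (w + v) = (Rcpow x w * Rcpow x v)%C.
Proof. unfold Rcpow; rewrite <- Cexp_plus; apply (f_equal Cexp); ring. Qed.

Lemma Rcpow_0 x : Rcpow x 0 = 1.
Proof. unfold Rcpow; rewrite Cmult_0_l; apply Cexp_0. Qed.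

Lemma Rcpow_1 x : 0 < x -> Rcpow x 1 = x.
Proof. intros H; unfold Rcpow; rewrite Cmult_1_l, Cexp_RtoC, exp_ln; auto. Qed.

Lemma Rcpow_nz x w : Rcpow x w <> 0.
Proof. apply Cexp_nz. Qed.

Lemma Rcpow_opp x w : Rcpow x (- w) = (/ Rcpow x w)%C.
Proof. unfold Rcpow; rewrite <- Cexp_opp; apply (f_equal Cexp); ring. Qed.

Lemma Cpow_div (x y : C) n : y <> 0 -> ((x / y) ^ n)%C = (x ^ n / y ^ n)%C.
Proof. intros H; unfold Cdiv; now rewrite Cpow_mult_l, Cpow_inv. Qed.

Lemma Rcpow_minus_nat x w n : 0 < x -> Rcpow x (w - INR n) = (Rcpow x w / x ^ n)%C.
Proof.
  intros H. assert (RtoC x <> 0) by (intros E; apply RtoC_inj in E; lra).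
  induction n as [|n IH].
  - simpl; replace (w - 0)%C with w by ring. cfield.
  - rewrite S_INR, RtoC_plus.
    replace (w - (INR n + 1))%C with ((w - INR n) + - (1))%C by ring.
    rewrite Rcpow_plus, IH, Rcpow_opp, Rcpow_1 by auto.
    rewrite Cpow_S. pose proof (Cpow_nz x n H0). cfield; auto.
Qed.

Lemma cbinom_S_mult w i : (INR (S i) * cbinom w (S i) = w * cbinom (w - 1) i)%C.
Proof.
  induction i as [|i IH].
  - cbn [cbinom]. change (INR 1) with 1. change (INR 0) with 0. cfield.
  - cbn [cbinom]. cbn [cbinom] in IH.
    pose proof (INR_S_nz i); pose proof (INR_S_nz (S i)).
    replace (w * (cbinom (w - 1) i * ((w - 1 - INR i) / INR (S i))))%C
      with (w * cbinom (w - 1) i * ((w - 1 - INR i) / INR (S i)))%C by ring.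
    rewrite <- IH.
    replace (w - 1 - INR i)%C with (w - INR (S i))%C by (rewrite S_INR, RtoC_plus; ring).
    cfield; auto.
Qed.

Lemma ln_1p_bounds h : 0 <= h <= 1 -> 0 <= ln (1 + h) <= 1.
Proof.
  intros Hh; split.
  - rewrite <- ln_1; apply ln_le; lra.
  - apply Rle_trans with (ln (exp 1)); [|rewrite ln_exp; lra].
    pose proof (exp_ineq_le 1); apply ln_le; lra.
Qed.

Lemma is_Cderive_Rcpow_1p w h : -1 < h ->
  is_Cderive (fun t => Rcpow (1 + t) w) h (w * Rcpow (1 + h) (w - 1))%C.
Proof.
  intros Hh; unfold Rcpow at 1.
  eapply is_Cderive_eq.
  - apply (is_Cderive_comp (fun t => Cexp (w * t)) (fun t => ln (1 + t)));
      [apply is_Cderive_Cexp|].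
    instantiate (1 := / (1 + h)).
    auto_derive; [lra|field; lra].
  - change (Cexp (w * ln (1 + h))) with (Rcpow (1 + h) w).
    replace (w - 1)%C with (w - INR 1)%C by (simpl; ring).
    rewrite (Rcpow_minus_nat (1 + h) w 1) by lra.
    rewrite Cpow_1_r, RtoC_inv by lra.
    assert (RtoC (1 + h) <> 0) by (intros E; apply RtoC_inj in E; lra).
    cfield; auto.
Qed.

Lemma is_Cderive_pow k h :
  is_Cderive (fun t => RtoC t ^ S k)%C h (INR (S k) * RtoC h ^ k)%C.
Proof.
  induction k as [|k IH].
  - eapply is_Cderive_eq.
    + apply is_Cderive_mult; [|apply is_Cderive_const].
      apply (is_Cderive_RtoC (fun t => t) h 1), (is_derive_id (K := R_AbsRing)).
    + simpl; cring.
  - eapply is_Cderive_eq.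
    + apply is_Cderive_mult; [|exact IH].
      apply (is_Cderive_RtoC (fun t => t) h 1), (is_derive_id (K := R_AbsRing)).
    + rewrite (S_INR (S k)), RtoC_plus, (Cpow_S h k). fold Cpow; cring.
Qed.

Lemma is_Cderive_csum (f df : nat -> R -> C) n h :
  (forall i, (i < n)%nat -> is_Cderive (f i) h (df i h)) ->
  is_Cderive (fun t => csum (fun i => f i t) n) h (csum (fun i => df i h) n).
Proof.
  induction n as [|n IH]; intros H; simpl.
  - apply is_Cderive_const.
  - apply is_Cderive_plus; auto.
Qed.

(** The derivative of the remainder for [w] is [w] times the remainder for [w - 1] of one order
    less, and the remainder vanishes at 0; the mean value inequality raises the order. *)
Lemma binomial_expansion J w :
  bigO0 J (fun h => Rcpow (1 + h) w - csum (fun i => cbinom w i * h ^ i) J)%C.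
Proof.
  revert w; induction J as [|J IH]; intros w.
  - exists (exp (Rabs (Re w))); intros h Hh; simpl.
    replace (Rcpow (1 + h) w - 0)%C with (Rcpow (1 + h) w) by ring.
    rewrite Rmult_1_r; unfold Rcpow; rewrite Cmod_Cexp.
    apply exp_le. replace (Re (w * ln (1 + h))%C) with (Re w * ln (1 + h))
      by (unfold Re; simpl; ring).
    pose proof (ln_1p_bounds h Hh). pose proof (Rle_abs (Re w)); pose proof (Rabs_pos (Re w)). nra.
  - destruct (IH (w - 1)%C) as (M & HM).
    exists (2 * (Cmod w * M / INR (S J))); intros h Hh.
    set (D := fun h : R => (Rcpow (1 + h) w - csum (fun i => cbinom w i * h ^ i) (S J))%C).
    change (Cmod (D h) <= 2 * (Cmod w * M / INR (S J)) * h ^ S J).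
    assert (D0 : D 0 = 0).
    { unfold D; rewrite csum_shift.
      rewrite (csum_ext _ (fun _ => 0 * 0)%C).
      - rewrite csum_scal, Rplus_0_r. unfold Rcpow; rewrite ln_1, Cmult_0_r, Cexp_0.
        simpl; ring.
      - intros i _; simpl; ring. }
    replace (D h) with (D h - D 0)%C by (rewrite D0; ring).
    assert (HN : INR (S J) <> 0) by (apply not_0_INR; lia).
    replace (2 * (Cmod w * M / INR (S J)) * h ^ S J)
      with (2 * (Cmod w * M / INR (S J) * h ^ S J - Cmod w * M / INR (S J) * 0 ^ S J))
      by (simpl; ring).
    apply (Cderive_le_incr D (fun h => w * (Rcpow (1 + h) (w - 1)
        - csum (fun i => cbinom (w - 1) i * h ^ i) J))%C
      (fun h => Cmod w * M / INR (S J) * h ^ S J) (fun h => Cmod w * (M * h ^ J))); [lra| | |].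
    + intros t Ht.
      apply is_Cderive_ext with (fun h => Rcpow (1 + h) w -
        (cbinom w 0 + csum (fun i => cbinom w (S i) * h ^ S i) J))%C.
      { intros y; unfold D; rewrite csum_shift; simpl; ring. }
      eapply is_Cderive_eq.
      * apply is_Cderive_minus; [apply is_Cderive_Rcpow_1p; lra|].
        apply is_Cderive_plus; [apply is_Cderive_const|].
        apply (is_Cderive_csum (fun i t => cbinom w (S i) * t ^ S i)%C
           (fun i t => cbinom w (S i) * (INR (S i) * RtoC t ^ i))%C).
        intros i _; apply is_Cderive_scal, is_Cderive_pow.
      * replace (csum (fun i => cbinom w (S i) * (INR (S i) * RtoC t ^ i)) J)%C
          with (w * csum (fun i => cbinom (w - 1) i * t ^ i) J)%C; [cring|].
        rewrite <- csum_scal; apply csum_ext; intros i _.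
        rewrite Cmult_assoc, <- cbinom_S_mult; ring.
    + intros t _. eapply is_derive_eq; [apply is_derive_scal, (is_derive_pow (fun t => t)), (is_derive_id (K := R_AbsRing))|].
      change (one (K := R_AbsRing)) with 1. simpl pred. field; auto.
    + intros t Ht; rewrite Cmod_mult.
      apply Rmult_le_compat_l; [apply Cmod_ge_0|]. apply HM; lra.
Qed.

Lemma csum_bounded_1 (c : nat -> C) n :
  exists B, 0 <= B /\ forall h, 0 <= h <= 1 -> Cmod (csum (fun i => c i * h ^ i)%C n) <= B.
Proof.
  induction n as [|n (B & HB & H)].
  - exists 0; split; [lra|]; intros; simpl; rewrite Cmod_0; lra.
  - exists (B + Cmod (c n)); split; [pose proof (Cmod_ge_0 (c n)); lra|].
    intros h Hh; simpl. eapply Rle_trans; [apply Cmod_triangle|].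
    rewrite Cmod_mult, Cmod_pow, Cmod_R, Rabs_pos_eq by lra.
    specialize (H h Hh). pose proof (Cmod_ge_0 (c n)).
    assert (h ^ n <= 1) by (rewrite <- (pow1 n); apply pow_incr; lra). nra.
Qed.

(** The constant term is bounded by a multiple of [h], hence is zero; after division by [h] the same
    argument meets the next coefficient. *)
Lemma poly_bigO0_zero J (c : nat -> C) M :
  (forall h, 0 < h <= 1 -> Cmod (csum (fun i => c i * h ^ i)%C J) <= M * h ^ J) ->
  forall i, (i < J)%nat -> c i = 0.
Proof.
  revert c; induction J as [|J IH]; intros c H i Hi; [lia|].
  destruct (csum_bounded_1 (fun i => c (S i)) J) as (B & HB & HB').
  assert (SH : forall h : R, csum (fun i => c i * h ^ i)%C (S J) =
      (c O + h * csum (fun i => c (S i) * h ^ i) J)%C).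
  { intros h; rewrite csum_shift, <- csum_scal; f_equal; [simpl; ring|].
    apply csum_ext; intros k _; rewrite Cpow_S; ring. }
  assert (C0 : c O = 0).
  { apply Cmod_eq_0. destruct (Req_dec (Cmod (c O)) 0) as [E|E]; auto.
    exfalso. assert (P : 0 < Cmod (c O)) by (pose proof (Cmod_ge_0 (c O)); lra).
    set (M' := Rmax M 0). assert (0 <= M') by apply Rmax_r.
    assert (K : forall h, 0 < h <= 1 -> Cmod (c O) <= (M' + B) * h).
    { intros h Hh. specialize (H h Hh); rewrite SH in H.
      replace (c O) with ((c O + h * csum (fun i => c (S i) * h ^ i) J)
         - h * csum (fun i => c (S i) * h ^ i) J)%C by ring.
      eapply Rle_trans; [apply Cmod_sub_le|].
      rewrite (Cmod_mult h), Cmod_R, Rabs_pos_eq by lra.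
      specialize (HB' h ltac:(lra)).
      assert (M * h ^ S J <= M' * h).
      { simpl pow. assert (0 <= h ^ J <= 1).
        { split; [apply pow_le; lra|rewrite <- (pow1 J); apply pow_incr; lra]. }
        assert (M <= M') by apply Rmax_l.
        apply Rle_trans with (M' * (h * h ^ J)); [|apply Rmult_le_compat_l; nra].
        apply Rmult_le_compat_r; nra. }
      nra. }
    assert (L : M' + B < M' + B + 1) by lra.
    (* At this [h] the right side of [K] is at most half of [Cmod (c O)]. *)
    specialize (K (Rmin 1 (Cmod (c O) / (2 * (M' + B + 1))))).
    assert (Q : 0 < Cmod (c O) / (2 * (M' + B + 1))) by (apply Rdiv_lt_0_compat; lra).
    assert (Q2 := Rmin_r 1 (Cmod (c O) / (2 * (M' + B + 1)))).
    assert (Q3 := Rmin_l 1 (Cmod (c O) / (2 * (M' + B + 1)))).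
    assert (Q4 : 0 < Rmin 1 (Cmod (c O) / (2 * (M' + B + 1)))) by (apply Rmin_glb_lt; lra).
    specialize (K ltac:(lra)).
    assert ((M' + B) * (Cmod (c O) / (2 * (M' + B + 1))) <= Cmod (c O) / 2).
    { replace (Cmod (c O) / 2) with ((M' + B + 1) * (Cmod (c O) / (2 * (M' + B + 1)))) by (field; lra).
      nra. }
    nra. }
  destruct i as [|i]; auto.
  apply (IH (fun i => c (S i))); [|lia].
  intros h Hh. specialize (H h Hh); rewrite SH, C0, Cplus_0_l, Cmod_mult, Cmod_R, Rabs_pos_eq in H by lra.
  apply Rmult_le_reg_l with h; [lra|]. simpl in H. lra.
Qed.

(** * Taylor expansions whose coefficients are polynomials in a parameter *)

Definition taylor_poly (f : C -> R -> C) : Prop :=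
  exists (c : nat -> C -> C), (forall i, exists d, is_poly d (c i)) /\
    forall s J, bigO0 J (fun h => f s h - csum (fun i => c i s * h ^ i) J)%C.

Lemma taylor_poly_ext f g :
  (forall s h, 0 <= h <= 1 -> f s h = g s h) -> taylor_poly f -> taylor_poly g.
Proof.
  intros E (c & H1 & H2); exists c; split; auto.
  intros s J; eapply bigO0_ext; [|apply (H2 s J)]. intros h Hh; simpl; now rewrite E.
Qed.

Lemma taylor_poly_plus f g :
  taylor_poly f -> taylor_poly g -> taylor_poly (fun s h => f s h + g s h)%C.
Proof.
  intros (c & H1 & H2) (c' & H3 & H4); exists (fun i s => c i s + c' i s)%C; split.
  - intros i; destruct (H1 i) as [d Hd], (H3 i) as [d' Hd'].
    exists (Nat.max d d'); apply is_poly_plus.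
    + apply is_poly_le with d; auto; lia.
    + apply is_poly_le with d'; auto; lia.
  - intros s J; eapply bigO0_ext; [|apply bigO0_plus; [apply (H2 s J)|apply (H4 s J)]].
    intros h Hh; simpl.
    rewrite (csum_ext (fun i => (c i s + c' i s) * h ^ i)%C
       (fun i => c i s * h ^ i + c' i s * h ^ i)%C) by (intros; ring).
    rewrite csum_plus; ring.
Qed.

Lemma taylor_poly_scal p d f :
  is_poly d p -> taylor_poly f -> taylor_poly (fun s h => p s * f s h)%C.
Proof.
  intros Hp (c & H1 & H2); exists (fun i s => p s * c i s)%C; split.
  - intros i; destruct (H1 i) as [e He]; exists (d + e)%nat; now apply is_poly_mult.
  - intros s J; eapply bigO0_ext; [|apply (bigO0_scal J (p s)), (H2 s J)].
    intros h Hh; simpl.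
    rewrite (csum_ext (fun i => (p s * c i s) * h ^ i)%C
       (fun i => p s * (c i s * h ^ i))%C) by (intros; ring).
    rewrite csum_scal; ring.
Qed.

Lemma taylor_poly_mult_h f : taylor_poly f -> taylor_poly (fun s h => h * f s h)%C.
Proof.
  intros (c & H1 & H2).
  exists (fun i s => match i with O => RtoC 0 | S k => c k s end); split.
  - intros [|i]; auto. exists O; apply is_poly_const.
  - intros s [|J].
    + apply bigO0_ext with (fun h => RtoC h ^ 1 * (f s h - csum (fun i => c i s * h ^ i) 0))%C.
      * intros; simpl; ring.
      * apply bigO0_le with (1 + 0)%nat; [lia|]. apply bigO0_mult; [apply bigO0_pow|apply H2].
    + apply bigO0_ext with (fun h => RtoC h ^ 1 * (f s h - csum (fun i => c i s * h ^ i) J))%C.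
      * intros h _; rewrite csum_shift.
        rewrite (csum_ext (fun i => c i s * h ^ S i)%C (fun i => h * (c i s * h ^ i))%C)
          by (intros; rewrite Cpow_S; ring).
        rewrite csum_scal; simpl; ring.
      * apply (bigO0_mult 1 J); [apply bigO0_pow|apply H2].
Qed.

Lemma taylor_poly_mult_pow m f : taylor_poly f -> taylor_poly (fun s h => h ^ m * f s h)%C.
Proof.
  intros H; induction m as [|m IH].
  - eapply taylor_poly_ext; [|exact H]. intros; simpl; ring.
  - eapply taylor_poly_ext; [|apply taylor_poly_mult_h, IH]. intros; simpl; ring.
Qed.

Lemma taylor_poly_1 : taylor_poly (fun _ _ => RtoC 1).
Proof.
  exists (fun i _ => match i with O => RtoC 1 | S _ => RtoC 0 end); split.
  - intros [|i]; exists O; apply is_poly_const.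
  - intros _ [|J].
    + apply bigO0_ext with (fun _ => RtoC 1); [intros; simpl; ring|apply bigO0_const].
    + exists 0; intros h _; rewrite csum_shift.
      rewrite (csum_ext _ (fun _ => 0 * 0)%C) by (intros; ring).
      rewrite csum_scal. replace (1 - (1 * h ^ 0 + 0 * csum (fun _ => RtoC 0) J))%C with (RtoC 0)
        by (simpl; ring).
      rewrite Cmod_0; lra.
Qed.

Lemma taylor_poly_Rcpow m : taylor_poly (fun s h => Rcpow (1 + h) (s - INR m)).
Proof.
  exists (fun i s => cbinom (s - INR m) i); split.
  - intros i; exists i.
    apply is_poly_ext with (fun s => cbinom (1%R * s + (- INR m)%R)%C i).
    + intros x; rewrite RtoC_opp. apply (f_equal (fun y => cbinom y i)); ring.
    + apply (is_poly_comp i (fun x => cbinom x i)), is_poly_cbinom.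
  - intros s J; apply binomial_expansion.
Qed.

Lemma taylor_poly_csum (f : nat -> C -> R -> C) n :
  (forall i, (i < n)%nat -> taylor_poly (f i)) -> taylor_poly (fun s h => csum (fun i => f i s h) n).
Proof.
  induction n as [|n IH]; intros H; simpl.
  - apply taylor_poly_ext with (fun _ _ => RtoC 0 * RtoC 1)%C; [intros; ring|].
    apply (taylor_poly_scal (fun _ => RtoC 0) 0); [apply is_poly_const|apply taylor_poly_1].
  - apply taylor_poly_plus; auto.
Qed.

(* The Taylor coefficients are polynomials in [s], so they vanish if they do at all naturals. *)
Lemma taylor_poly_bigO0 f J : taylor_poly f ->
  (forall n, bigO0 J (f (RtoC (INR n)))) -> forall s, bigO0 J (f s).
Proof.
  intros (c & H1 & H2) H s.
  assert (Z : forall i, (i < J)%nat -> forall s, c i s = 0).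
  { intros i Hi; destruct (H1 i) as [d Hd].
    apply (is_poly_eq d 0 (c i) (fun _ => RtoC 0)); auto using is_poly_const.
    intros n.
    assert (Q : bigO0 J (fun h => csum (fun i => c i (INR n) * h ^ i) J)%C).
    { apply bigO0_ext with (fun h => f (INR n) h +
        -1 * (f (INR n) h - csum (fun i => c i (INR n) * h ^ i) J))%C; [intros; ring|].
      apply bigO0_plus; auto. apply bigO0_scal; auto. }
    destruct Q as [M HM].
    apply (poly_bigO0_zero J (fun i => c i (INR n)) M); auto.
    intros h Hh; apply HM; lra. }
  eapply bigO0_ext; [|apply (H2 s J)]. intros h _; simpl.
  rewrite (csum_ext _ (fun _ => 0 * 0)%C) by (intros i Hi; rewrite Z by auto; ring).
  rewrite csum_scal; ring.
Qed.

(** * Defect of the truncated series in the functional equation *)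

Definition qsum (K : nat) (s h : C) : C := csum (fun m => qpoly m s * h ^ m)%C (S K).

(* Defect of [a^s qsum] in the functional equation [H(a+1) (a-s) / a = H(a)] of
   [H(a) = Gamma(a) / Gamma(a-s)], divided by [a^s], with [h = 1/a]. *)
Definition defect (K : nat) (s : C) (h : R) : C :=
  (Rcpow (1 + h) s * qsum K s (h / (1 + h))%R * (1 - s * h) - qsum K s h)%C.

Lemma qsum_rec K s h :
  qsum K (s + 1) h = ((1 - (s + 1) * h) * qsum K s h + (s + 1) * qpoly K s * h ^ S K)%C.
Proof.
  induction K as [|K IH].
  - unfold qsum; simpl; rewrite !qpoly_0; ring.
  - change (qsum (S K) (s + 1) h) with (qsum K (s + 1) h + qpoly (S K) (s + 1) * h ^ S K)%C.
    change (qsum (S K) s h) with (qsum K s h + qpoly (S K) s * h ^ S K)%C.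
    rewrite IH, qpoly_rec, (Cpow_S h (S K)); ring.
Qed.

(** The factor beside [h ^ S K] is [O(h)], so raising [s] by 1 adds only [O(h^(K+2))] to the defect.
    Since the defect is 0 at [s = 0], all natural [s] follow. *)
Lemma defect_rec K s h : 0 <= h ->
  defect K (s + 1) h = ((1 - (s + 1) * h) * defect K s h + (s + 1) * qpoly K s *
    (RtoC h ^ S K * ((Rcpow (1 + h) (s - INR K) - 1) * (1 - (s + 1) * h) + (- (s + 1)) * h)))%C.
Proof.
  intros Hh; unfold defect.
  assert (N : RtoC (1 + h) <> 0) by (intros E; apply RtoC_inj in E; lra).
  rewrite !qsum_rec, Rcpow_plus, Rcpow_1, Rcpow_minus_nat by lra.
  rewrite RtoC_div by lra.
  rewrite Cpow_div by auto.
  rewrite (Cpow_S (RtoC (1 + h))).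
  pose proof (Cpow_nz _ K N).
  rewrite RtoC_plus in *.
  cfield; auto.
Qed.

Lemma bigO0_1m c : bigO0 0 (fun h => 1 - c * h)%C.
Proof.
  apply bigO0_ext with (fun h => 1 + (- c) * RtoC h ^ 1)%C; [intros; simpl; ring|].
  apply bigO0_plus; [apply bigO0_const|]. apply bigO0_scal, bigO0_le with 1%nat; [lia|apply bigO0_pow].
Qed.

Lemma defect_bigO0_nat K n : bigO0 (K + 2) (defect K (INR n)).
Proof.
  induction n as [|n IH].
  - exists 0; intros h Hh.
    assert (E : forall h, qsum K 0 h = 1).
    { intros y; unfold qsum; rewrite csum_shift, qpoly_0.
      rewrite (csum_ext _ (fun _ => 0 * 0)%C) by (intros; rewrite qpoly_S_0; ring).
      rewrite csum_scal; simpl; ring. }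
    unfold defect; simpl INR. rewrite !E, Rcpow_0.
    replace (1 * 1 * (1 - 0 * h) - 1)%C with (RtoC 0) by ring.
    rewrite Cmod_0; lra.
  - rewrite S_INR, RtoC_plus.
    eapply bigO0_ext; [intros h Hh; symmetry; apply defect_rec; lra|].
    apply bigO0_plus.
    + apply (bigO0_mult 0 (K + 2)); auto using bigO0_1m.
    + apply bigO0_scal. replace (K + 2)%nat with (S K + 1)%nat by lia.
      apply bigO0_mult; [apply bigO0_pow|]. apply bigO0_plus.
      * apply (bigO0_mult 1 0); auto using bigO0_1m.
        eapply bigO0_ext; [|apply (binomial_expansion 1 (INR n - INR K)%C)].
        intros h _; simpl; ring.
      * apply bigO0_scal. eapply bigO0_ext; [|apply (bigO0_pow 1)]. intros; simpl; ring.
Qed.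

Lemma taylor_poly_defect K : taylor_poly (defect K).
Proof.
  (* Rests on [(1 + h)^s (h / (1 + h))^m = h^m (1 + h)^(s - m)], which removes the quotient and
     leaves binomial series. *)
  apply taylor_poly_ext with (fun (s : C) (h : R) => csum (fun m => qpoly m s *
    (h ^ m * ((Rcpow (1 + h) (s - INR m) + (- s) * (h * Rcpow (1 + h) (s - INR m))) + (-1)%R * 1)))%C (S K)).
  - intros s h Hh; unfold defect, qsum.
    assert (N : RtoC (1 + h) <> 0) by (intros E; apply RtoC_inj in E; lra).
    symmetry.
    match goal with |- (?a * ?x * ?b - ?y)%C = _ =>
      replace (a * x * b - y)%C with ((a * b) * x + (-1) * y)%C by ring end.
    rewrite <- !csum_scal, <- csum_plus; apply csum_ext; intros m _.
    rewrite Rcpow_minus_nat by lra.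
    rewrite RtoC_div by lra. rewrite Cpow_div by auto. unfold Cdiv; ring.
  - apply taylor_poly_csum; intros m _.
    apply (taylor_poly_scal (qpoly m) (2 * m)); [apply is_poly_qpoly|].
    apply taylor_poly_mult_pow, taylor_poly_plus.
    + apply taylor_poly_plus; [apply taylor_poly_Rcpow|].
      apply (taylor_poly_scal (fun s => - s)%C 1).
      * apply is_poly_ext with (fun s => (-1)%R * s)%C; [intros; cring|].
        apply is_poly_scal, is_poly_id.
      * apply taylor_poly_mult_h, taylor_poly_Rcpow.
    + apply (taylor_poly_scal (fun _ => RtoC (-1)) 0); [apply is_poly_const|apply taylor_poly_1].
Qed.

(** The exponent [K + 2] is what makes the defects along [a, a + 1, a + 2, ...] summable with total
    [O(a^(-K-1))]. *)
Lemma defect_bigO0 K s : bigO0 (K + 2) (defect K s).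
Proof. apply taylor_poly_bigO0; [apply taylor_poly_defect|apply defect_bigO0_nat]. Qed.

(** * The Gamma function *)

Definition is_Clim (u : nat -> C) (l : C) : Prop :=
  is_lim_seq (fun n => Re (u n)) (Re l) /\ is_lim_seq (fun n => Im (u n)) (Im l).

Lemma is_Clim_ext u v l : (forall n, u n = v n) -> is_Clim u l -> is_Clim v l.
Proof.
  intros E [H1 H2]; split; (eapply is_lim_seq_ext; [|eassumption]); intros n; simpl; now rewrite E.
Qed.

Lemma is_Clim_eq u l m : is_Clim u l -> l = m -> is_Clim u m.
Proof. now intros H <-. Qed.

Lemma is_Clim_const c : is_Clim (fun _ => c) c.
Proof. split; apply is_lim_seq_const. Qed.

Lemma is_Clim_mult u v l m : is_Clim u l -> is_Clim v m -> is_Clim (fun n => u n * v n)%C (l * m)%C.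
Proof.
  intros [H1 H2] [H3 H4]; split.
  - apply (is_lim_seq_minus' (fun n => Re (u n) * Re (v n)) (fun n => Im (u n) * Im (v n)));
      now apply is_lim_seq_mult'.
  - apply (is_lim_seq_plus' (fun n => Re (u n) * Im (v n)) (fun n => Im (u n) * Re (v n)));
      now apply is_lim_seq_mult'.
Qed.

Lemma is_Clim_plus u v l m : is_Clim u l -> is_Clim v m -> is_Clim (fun n => u n + v n)%C (l + m)%C.
Proof. intros [H1 H2] [H3 H4]; split; now apply is_lim_seq_plus'. Qed.

Lemma is_Clim_RtoC (u : nat -> R) (l : R) : is_lim_seq u l -> is_Clim (fun n => RtoC (u n)) (RtoC l).
Proof. intros H; split; simpl; [exact H|apply is_lim_seq_const]. Qed.

Lemma is_Clim_inv u (l : C) : l <> 0 -> is_Clim u l -> is_Clim (fun n => / u n)%C (/ l)%C.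
Proof.
  intros Hl [H1 H2].
  assert (Hn : Re l ^ 2 + Im l ^ 2 <> 0).
  { intros E; apply Hl; apply C_ext; simpl; nra. }
  assert (Hd : is_lim_seq (fun n => Re (u n) ^ 2 + Im (u n) ^ 2) (Re l ^ 2 + Im l ^ 2)).
  { apply is_lim_seq_plus'; simpl.
    - apply is_lim_seq_mult'; auto. apply is_lim_seq_mult'; auto. apply is_lim_seq_const.
    - apply is_lim_seq_mult'; auto. apply is_lim_seq_mult'; auto. apply is_lim_seq_const. }
  split.
  - apply (is_lim_seq_div' (fun n => Re (u n))); auto.
  - apply (is_lim_seq_div' (fun n => - Im (u n))); auto.
    now apply (is_lim_seq_opp _ (Im l)).
Qed.

Lemma is_Clim_unique u l m : is_Clim u l -> is_Clim u m -> l = m.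
Proof.
  intros [H1 H2] [H3 H4]; apply C_ext.
  - apply is_lim_seq_unique in H1, H3; congruence.
  - apply is_lim_seq_unique in H2, H4; congruence.
Qed.

Lemma CLim_seq_eq u l : is_Clim u l -> CLim_seq u = l.
Proof.
  intros [H1 H2]; unfold CLim_seq; apply C_ext; simpl.
  - now rewrite (is_lim_seq_unique _ _ H1).
  - now rewrite (is_lim_seq_unique _ _ H2).
Qed.

Lemma is_Clim_incr_n u l n : is_Clim (fun k => u (k + n)%nat) l <-> is_Clim u l.
Proof.
  unfold is_Clim.
  rewrite <- (is_lim_seq_incr_n (fun k => Re (u k)) n), <- (is_lim_seq_incr_n (fun k => Im (u k)) n).
  tauto.
Qed.

Lemma is_Clim_Cmod u l : is_Clim u l -> is_lim_seq (fun n => Cmod (u n)) (Cmod l).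
Proof.
  intros [H1 H2].
  apply is_lim_seq_ext with (fun n => sqrt (Re (u n) * Re (u n) + Im (u n) * Im (u n))).
  - intros n; unfold Cmod, Re, Im; f_equal; ring.
  - replace (Cmod l) with (sqrt (Re l * Re l + Im l * Im l)) by (unfold Cmod, Re, Im; f_equal; ring).
    apply (is_lim_seq_continuous sqrt).
    + apply continuity_pt_sqrt. nra.
    + apply is_lim_seq_plus'; now apply is_lim_seq_mult'.
Qed.

Lemma Rcpow_0_cont w u : is_lim_seq u 1 -> is_Clim (fun n => Rcpow (u n) w) 1.
Proof.
  intros H.
  assert (L : is_lim_seq (fun n => ln (u n)) 0).
  { rewrite <- ln_1. apply is_lim_seq_continuous; auto.
    apply continuity_pt_filterlim, (ex_derive_continuous ln). eexists; apply is_derive_ln; lra. }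
  assert (K : forall a, is_lim_seq (fun n => a * ln (u n)) 0).
  { intros a; replace (Finite 0) with (Rbar_mult a 0) by (simpl; f_equal; ring).
    now apply is_lim_seq_scal_l. }
  assert (X : is_lim_seq (fun n => exp (Re w * ln (u n))) 1).
  { rewrite <- exp_0; apply is_lim_seq_continuous; auto.
    apply derivable_continuous_pt, derivable_pt_exp. }
  assert (Y : is_lim_seq (fun n => cos (Im w * ln (u n))) 1).
  { rewrite <- cos_0; apply is_lim_seq_continuous; auto. apply continuity_cos. }
  assert (Z : is_lim_seq (fun n => sin (Im w * ln (u n))) 0).
  { rewrite <- sin_0; apply is_lim_seq_continuous; auto. apply continuity_sin. }
  split.
  - apply is_lim_seq_ext with (fun n => exp (Re w * ln (u n)) * cos (Im w * ln (u n))).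
    + intros n; unfold Rcpow, Cexp, Re, Im; simpl.
      f_equal; [f_equal; ring|f_equal; ring].
    + simpl. rewrite <- (Rmult_1_l 1) at 1. now apply is_lim_seq_mult'.
  - apply is_lim_seq_ext with (fun n => exp (Re w * ln (u n)) * sin (Im w * ln (u n))).
    + intros n; unfold Rcpow, Cexp, Re, Im; simpl.
      f_equal; [f_equal; ring|f_equal; ring].
    + simpl. rewrite <- (Rmult_1_l 0). now apply is_lim_seq_mult'.
Qed.

(** * Sequences with summable relative increments *)

Fixpoint rsum (c : nat -> R) (n : nat) : R :=
  match n with O => 0 | S k => rsum c k + c k end.

Lemma rsum_incr c n m : (forall k, 0 <= c k) -> (n <= m)%nat -> rsum c n <= rsum c m.
Proof.
  intros Hc H; induction H as [|m H IH]; [lra|]. simpl; specialize (Hc m); lra.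
Qed.

(** The bound on [b n - b O] closes up by induction because [sg <= 1 / 2] keeps [b n] below twice
    [b O]. The final estimate has two uses: it shows that a limit is nonzero, and it is the error
    term in the Gamma quotient expansion. *)
Lemma slow_variation_limit (b : nat -> C) (c : nat -> R) (sg : R) :
  (forall n, 0 <= c n) -> (forall n, rsum c n <= sg) -> sg <= 1 / 2 ->
  (forall n, Cmod (b (S n) - b n) <= c n * Cmod (b n)) ->
  exists l, is_Clim b l /\ Cmod (l - b O) <= 2 * sg * Cmod (b O).
Proof.
  intros Hc Hs Hsg Hb.
  assert (B : forall n, Cmod (b n - b O) <= 2 * rsum c n * Cmod (b O)).
  { induction n as [|n IH].
    - replace (b O - b O)%C with (RtoC 0) by ring. rewrite Cmod_0; simpl; lra.
    - replace (b (S n) - b O)%C with ((b (S n) - b n) + (b n - b O))%C by ring.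
      eapply Rle_trans; [apply Cmod_triangle|]. simpl.
      specialize (Hb n). pose proof (Cmod_triangle_sub (b n) (b O)).
      pose proof (Cmod_ge_0 (b O)). specialize (Hs n). specialize (Hc n).
      assert (Cmod (b n) <= 2 * Cmod (b O)) by nra. nra. }
  assert (B2 : forall n, Cmod (b n) <= 2 * Cmod (b O)).
  { intros n; pose proof (Cmod_triangle_sub (b n) (b O)). specialize (B n).
    pose proof (Cmod_ge_0 (b O)). specialize (Hs n). nra. }
  assert (B3 : forall n k, Cmod (b (n + k)%nat - b n) <= 2 * Cmod (b O) * (rsum c (n + k) - rsum c n)).
  { intros n; induction k as [|k IH].
    - rewrite Nat.add_0_r. replace (b n - b n)%C with (RtoC 0) by ring. rewrite Cmod_0; lra.
    - rewrite Nat.add_succ_r.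
      replace (b (S (n + k)) - b n)%C with ((b (S (n + k)) - b (n + k)%nat) + (b (n + k)%nat - b n))%C by ring.
      eapply Rle_trans; [apply Cmod_triangle|]. simpl.
      specialize (Hb (n + k)%nat). specialize (B2 (n + k)%nat). specialize (Hc (n + k)%nat). nra. }
  destruct (ex_finite_lim_seq_incr (rsum c) sg) as [S HS].
  { intros n; simpl; specialize (Hc n); lra. }
  { exact Hs. }
  assert (CS : ex_lim_seq_cauchy (rsum c)).
  { apply ex_lim_seq_cauchy_corr; eexists; exact HS. }
  assert (CB : forall p : C -> R, (forall z, Rabs (p z) <= Cmod z) -> (forall x y, p (x - y)%C = p x - p y) ->
    ex_finite_lim_seq (fun n => p (b n))).
  { intros p Hp Hlin; apply ex_lim_seq_cauchy_corr; intros eps.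
    assert (P : 0 < eps / (2 * Cmod (b O) + 1)).
    { apply Rdiv_lt_0_compat; [apply eps|]. pose proof (Cmod_ge_0 (b O)); lra. }
    destruct (CS (mkposreal _ P)) as [N HN]; exists N.
    assert (W : forall n m, (N <= n)%nat -> (n <= m)%nat -> Rabs (p (b m) - p (b n)) < eps).
    { intros n m Hn Hm. rewrite <- Hlin.
      eapply Rle_lt_trans; [apply Hp|].
      replace m with (n + (m - n))%nat by lia.
      eapply Rle_lt_trans; [apply B3|].
      specialize (HN (n + (m - n))%nat n ltac:(lia) ltac:(lia)); simpl in HN.
      apply Rabs_def2 in HN. pose proof (Cmod_ge_0 (b O)).
      assert (0 <= rsum c (n + (m - n)) - rsum c n).
      { enough (rsum c n <= rsum c (n + (m - n))) by lra. apply rsum_incr; auto; lia. }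
      apply Rle_lt_trans with ((2 * Cmod (b O) + 1) * (rsum c (n + (m - n)) - rsum c n)); [nra|].
      replace (pos eps) with ((2 * Cmod (b O) + 1) * (eps / (2 * Cmod (b O) + 1))) by (field; lra).
      apply Rmult_lt_compat_l; lra. }
    intros n m Hn Hm. destruct (Nat.le_ge_cases n m).
    - rewrite Rabs_minus_sym; auto.
    - auto. }
  destruct (CB Re) as [x Hx]; [apply re_le_Cmod|reflexivity|].
  destruct (CB Im) as [y Hy]; [apply im_le_Cmod|reflexivity|].
  assert (L : is_Clim b (x, y)) by (split; auto).
  exists (x, y); split; auto.
  assert (L2 : is_lim_seq (fun n => Cmod (b n - b O)) (Cmod ((x, y) - b O)%C)).
  { apply is_Clim_Cmod, is_Clim_plus; auto. apply is_Clim_const. }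
  apply (is_lim_seq_le _ (fun _ => 2 * sg * Cmod (b O)) _ _) with (2 := L2) (3 := is_lim_seq_const _).
  intros n. specialize (B n); specialize (Hs n). pose proof (Cmod_ge_0 (b O)). nra.
Qed.

(** With [y = a + k], each term is at most [1 / (y - 1) - 1 / y], and these differences
    telescope. *)
Lemma rsum_inv_sq (a : R) n : 1 < a -> rsum (fun k => / (a + INR k) ^ 2) n <= / (a - 1).
Proof.
  intros Ha.
  assert (H : rsum (fun k => / (a + INR k) ^ 2) n <= / (a - 1) - / (a + INR n - 1)).
  { induction n as [|n IH]; [simpl; right; field; lra|].
    cbn [rsum]. rewrite S_INR. pose proof (pos_INR n) as P. set (y := a + INR n) in *.
    replace (a + (INR n + 1) - 1) with y by (unfold y; ring).
    enough (/ y ^ 2 <= / (y - 1) - / y) by lra.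
    assert (1 < y) by (unfold y; lra).
    replace (/ (y - 1) - / y) with (/ ((y - 1) * y)) by (field; lra).
    apply Rinv_le_contravar; nra. }
  pose proof (pos_INR n).
  assert (0 < / (a + INR n - 1)) by (apply Rinv_0_lt_compat; lra). lra.
Qed.

(* Euler's product for [1 / Gamma]. *)
Definition rgamma_seq (s : C) (n : nat) : C :=
  (Rcpow (INR n + 1) (1 - s) * rising s n / INR (Factorial.fact n))%C.

Definition nonpole (s : C) : Prop := forall n, (s + INR n)%C <> 0.

Lemma rising_nz s n : nonpole s -> rising s n <> 0.
Proof.
  intros H; induction n as [|n IH]; simpl; [apply C1_nz|]. apply Cmult_neq_0; auto.
Qed.

Lemma fact_nz n : RtoC (INR (Factorial.fact n)) <> 0.
Proof. intros E; apply RtoC_inj in E; revert E; apply INR_fact_neq_0. Qed.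

Lemma rgamma_seq_nz s n : nonpole s -> rgamma_seq s n <> 0.
Proof.
  intros H; unfold rgamma_seq, Cdiv; apply Cmult_neq_0.
  - apply Cmult_neq_0; [apply Rcpow_nz|now apply rising_nz].
  - apply Cinv_neq_0; apply fact_nz.
Qed.

Lemma RtoC_nz x : x <> 0 -> RtoC x <> 0.
Proof. intros H E; apply RtoC_inj in E; auto. Qed.

(** As [qsum 0] is 1, the relative increment is exactly the defect of order 0 at [1 - s] with
    [h = 1 / (n + 1)], hence [O(n^(-2))]. *)
Lemma rgamma_seq_S s n :
  (rgamma_seq s (S n) - rgamma_seq s n)%C = (rgamma_seq s n * defect 0 (1 - s) (/ (INR n + 1)))%C.
Proof.
  unfold rgamma_seq, defect, qsum; cbn [csum rising].
  rewrite !qpoly_0.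
  pose proof (pos_INR n) as P.
  change (Factorial.fact (S n)) with (S n * Factorial.fact n)%nat. rewrite mult_INR, S_INR.
  replace (INR n + 1 + 1) with ((INR n + 1) * (1 + / (INR n + 1))) by (field; lra).
  assert (0 < / (INR n + 1)) by (apply Rinv_0_lt_compat; lra).
  rewrite Rcpow_mult by lra.
  rewrite RtoC_inv, RtoC_mult by lra.
  replace (s + INR n)%C with (s + (RtoC (INR n + 1) - 1))%C by (rewrite RtoC_plus; ring).
  assert (N : RtoC (INR n + 1) <> 0) by (apply RtoC_nz; lra).
  pose proof (fact_nz n) as N2.
  revert N N2. generalize (RtoC (INR n + 1)) (RtoC (INR (Factorial.fact n))). intros y z N N2.
  simpl. cfield; auto.
Qed.

Lemma rgamma_seq_limit s : nonpole s -> exists l : C, l <> 0 /\ is_Clim (rgamma_seq s) l.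
Proof.
  intros Hs.
  destruct (defect_bigO0 0 (1 - s)%C) as [M HM].
  set (M' := Rmax M 1).
  assert (HM1 : 1 <= M') by apply Rmax_r. assert (HM2 : M <= M') by apply Rmax_l.
  (* Beyond [n0] the relative increments sum to at most [1 / 4], so the limit stays within half of
     [Cmod (b O)] of [b O] and cannot be 0. *)
  destruct (INR_unbounded (4 * M')) as [n0 Hn0].
  set (b := fun k => rgamma_seq s (k + n0)%nat).
  destruct (slow_variation_limit b (fun k => M' * / (INR n0 + 1 + INR k) ^ 2) (1 / 4)) as (l & Hl & Hl').
  - intros n. pose proof (pos_INR n).
    apply Rmult_le_pos; [lra|]. apply Rlt_le, Rinv_0_lt_compat, pow_lt; lra.
  - intros n.
    assert (E : rsum (fun k => M' * / (INR n0 + 1 + INR k) ^ 2) n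
       = M' * rsum (fun k => / (INR n0 + 1 + INR k) ^ 2) n).
    { induction n as [|n IH]; cbn [rsum]; [|rewrite IH]; ring. }
    rewrite E.
    pose proof (rsum_inv_sq (INR n0 + 1) n ltac:(lra)) as Q.
    replace (INR n0 + 1 - 1) with (INR n0) in Q by ring.
    apply Rle_trans with (M' * / INR n0); [apply Rmult_le_compat_l; lra|].
    apply Rmult_le_reg_r with (INR n0); [lra|]. field_simplify; lra.
  - lra.
  - intros n; unfold b. change (S n + n0)%nat with (S (n + n0)).
    rewrite rgamma_seq_S, Cmod_mult, Rmult_comm. apply Rmult_le_compat_r; [apply Cmod_ge_0|].
    rewrite plus_INR. pose proof (pos_INR n).
    assert (0 < / (INR n + INR n0 + 1) <= 1).
    { split; [apply Rinv_0_lt_compat; lra|].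
      rewrite <- Rinv_1. apply Rinv_le_contravar; lra. }
    eapply Rle_trans; [apply HM; lra|].
    simpl (0 + 2)%nat. rewrite pow_inv.
    replace (INR n0 + 1 + INR n) with (INR n + INR n0 + 1) by ring.
    apply Rmult_le_compat_r; auto. apply Rlt_le, Rinv_0_lt_compat, pow_lt; lra.
  - exists l; split.
    + intros E. rewrite E in Hl'.
      replace (0 - b O)%C with (- b O)%C in Hl' by ring. rewrite Cmod_opp in Hl'.
      assert (P : 0 < Cmod (b O)) by (apply Cmod_gt_0, rgamma_seq_nz; auto). lra.
    + apply is_Clim_incr_n with n0. exact Hl.
Qed.

Lemma ratio_lim (x y : R) : is_lim_seq (fun n => (INR n + x) / (INR n + y)) 1.
Proof.
  assert (I : is_lim_seq (fun n => / (INR n + y)) 0).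
  { replace (Finite 0) with (Rbar_inv p_infty) by easy.
    apply is_lim_seq_inv; [|easy].
    apply is_lim_seq_plus with p_infty (Finite y); [apply is_lim_seq_INR|apply is_lim_seq_const|easy]. }
  apply is_lim_seq_ext_loc with (fun n => 1 + (x - y) * / (INR n + y)).
  - destruct (INR_unbounded (- y)) as [N HN]; exists N; intros n Hn.
    apply le_INR in Hn. field. lra.
  - replace (Finite 1) with (Finite (1 + (x - y) * 0)) by (f_equal; ring).
    apply is_lim_seq_plus'; [apply is_lim_seq_const|].
    apply is_lim_seq_mult'; [apply is_lim_seq_const|exact I].
Qed.

Lemma inv_INR_lim (y : R) : is_lim_seq (fun n => / (INR n + y)) 0.
Proof.
  replace (Finite 0) with (Rbar_inv p_infty) by easy.
  apply is_lim_seq_inv; [|easy].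
  apply is_lim_seq_plus with p_infty (Finite y); [apply is_lim_seq_INR|apply is_lim_seq_const|easy].
Qed.

Lemma cratio_lim (s : C) : is_Clim (fun n => (INR n + s) / (INR n + 1)%R)%C 1.
Proof.
  apply is_Clim_ext with (fun n => RtoC 1 + (s - 1) * RtoC (/ (INR n + 1)))%C.
  - intros n. pose proof (pos_INR n).
    assert (N : RtoC (INR n + 1) <> 0) by (apply RtoC_nz; lra).
    rewrite RtoC_inv by lra.
    replace (RtoC (INR n)) with (RtoC (INR n + 1) - 1)%C by (rewrite RtoC_plus; ring).
    cfield; auto.
  - eapply is_Clim_eq.
    + apply is_Clim_plus; [apply is_Clim_const|].
      apply is_Clim_mult; [apply is_Clim_const|].
      apply is_Clim_RtoC, inv_INR_lim.
    + ring.
Qed.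

Lemma CGamma_rgamma_seq (s l : C) : nonpole s -> l <> 0 -> is_Clim (rgamma_seq s) l -> CGamma s = (/ l)%C.
Proof.
  intros Hs Hl H.
  unfold CGamma; apply CLim_seq_eq.
  (* The term of index 0 is skipped, since it would involve [ln 0]. *)
  apply is_Clim_incr_n with 1%nat.
  apply is_Clim_ext with (fun n => / rgamma_seq s (S n) * (Rcpow ((INR n + 1) / (INR n + 2)) s *
     / ((INR (S n) + s) / (INR (S n) + 1)%R)))%C.
  - intros n. replace (n + 1)%nat with (S n) by lia.
    unfold rgamma_seq. change (rising s (S (S n))) with (rising s (S n) * (s + INR (S n)))%C.
    pose proof (rising_nz s (S n) Hs). pose proof (fact_nz (S n)).
    specialize (Hs (S n)). pose proof (pos_INR n).
    assert (Hs' : (INR (S n) + s)%C <> 0) by (rewrite Cplus_comm; auto).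
    unfold Cminus at 1. rewrite Rcpow_plus, Rcpow_opp, Rcpow_1 by (rewrite S_INR; lra).
    replace (INR n + 1) with (INR (S n)) by (rewrite S_INR; ring).
    replace (INR n + 2) with (INR (S n) + 1) by (rewrite S_INR; ring).
    set (y := INR (S n)) in *. assert (0 < y) by (unfold y; rewrite S_INR; lra).
    unfold Rdiv. rewrite Rcpow_mult by first [lra|apply Rinv_0_lt_compat; lra].
    replace (Rcpow (/ (y + 1)) s) with (/ Rcpow (y + 1) s)%C.
    2:{ unfold Rcpow; rewrite <- Cexp_opp, ln_Rinv by lra. apply (f_equal Cexp).
        rewrite RtoC_opp; ring. }
    pose proof (Rcpow_nz (y + 1) s). assert (RtoC (y + 1) <> 0) by (apply RtoC_nz; lra).
    cfield. repeat split; auto.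
  - apply is_Clim_eq with (/ l * (RtoC 1 * / RtoC 1))%C; [|field; auto].
    apply is_Clim_mult.
    + apply is_Clim_inv; auto.
      apply (is_Clim_incr_n (rgamma_seq s) l 1) in H.
      apply is_Clim_ext with (2 := H). intros n; f_equal; lia.
    + apply is_Clim_mult.
      * apply Rcpow_0_cont, ratio_lim.
      * apply is_Clim_inv; [apply C1_nz|].
        pose proof (proj2 (is_Clim_incr_n _ _ 1) (cratio_lim s)) as Q.
        apply is_Clim_ext with (2 := Q). intros n; simpl; replace (n + 1)%nat with (S n) by lia; auto.
Qed.

Lemma CGamma_nz s : nonpole s -> CGamma s <> 0.
Proof.
  intros Hs; destruct (rgamma_seq_limit s Hs) as (l & Hl & H).
  rewrite (CGamma_rgamma_seq s l); auto. now apply Cinv_neq_0.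
Qed.

Lemma rgamma_seq_lim s : nonpole s -> is_Clim (rgamma_seq s) (/ CGamma s)%C.
Proof.
  intros Hs; destruct (rgamma_seq_limit s Hs) as (l & Hl & H).
  rewrite (CGamma_rgamma_seq s l); auto.
  replace (/ / l)%C with l by (field; auto). exact H.
Qed.

Lemma rising_shift s n : (s * rising (s + 1) n)%C = (rising s n * (s + INR n))%C.
Proof.
  induction n as [|n IH]; [simpl; ring|].
  cbn [rising]. rewrite Cmult_assoc, IH, S_INR, RtoC_plus; ring.
Qed.

Lemma nonpole_S s : nonpole s -> nonpole (s + 1)%C.
Proof.
  intros H n E; apply (H (S n)). rewrite <- E, S_INR, RtoC_plus; ring.
Qed.

(** Euler's products at [s] and [s + 1] differ by the factor [(n + s) / (n + 1)], which tends to
    1. *)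
Lemma CGamma_S s : nonpole s -> CGamma (s + 1) = (s * CGamma s)%C.
Proof.
  intros Hs.
  assert (H1 := rgamma_seq_lim s Hs). assert (H2 := rgamma_seq_lim _ (nonpole_S s Hs)).
  assert (N1 := CGamma_nz s Hs). assert (N2 := CGamma_nz _ (nonpole_S s Hs)).
  assert (E : (s * / CGamma (s + 1))%C = (/ CGamma s * 1)%C).
  { apply is_Clim_unique with (fun n => s * rgamma_seq (s + 1) n)%C.
    - apply is_Clim_mult; auto using is_Clim_const.
    - apply is_Clim_ext with (fun n => rgamma_seq s n * ((INR n + s) / (INR n + 1)%R))%C.
      + intros n; unfold rgamma_seq.
        pose proof (fact_nz n) as P. pose proof (pos_INR n).
        assert (N : RtoC (INR n + 1) <> 0) by (apply RtoC_nz; lra).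
        transitivity (Rcpow (INR n + 1) (1 - (s + 1)) * (s * rising (s + 1) n) / INR (Factorial.fact n))%C;
          [|cfield; auto].
        rewrite rising_shift.
        replace (1 - (s + 1))%C with (1 - s - INR 1)%C by (simpl; ring).
        rewrite (Rcpow_minus_nat _ (1 - s)%C 1) by lra. rewrite Cpow_1_r.
        cfield; auto.
      + apply is_Clim_mult; auto. apply cratio_lim. }
  assert (E2 : (s * CGamma s * (s * / CGamma (s + 1)))%C = (s * CGamma s * (/ CGamma s * 1))%C)
    by now rewrite E.
  assert (Hs0 : s <> 0).
  { specialize (Hs O); intros Z; apply Hs; rewrite Z; simpl; ring. }
  replace (CGamma (s + 1)) with (CGamma (s + 1) * (/ s) * (s * CGamma s * (/ CGamma s * 1)))%C
    by (cfield; auto).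
  rewrite <- E2. cfield; auto.
Qed.

Lemma nonpole_Re s : 0 < Re s -> nonpole s.
Proof.
  intros H n E. apply (f_equal Re) in E.
  change (Re s + INR n = 0) in E. pose proof (pos_INR n); lra.
Qed.

Lemma qsum_lim K s (u : nat -> R) : is_lim_seq u 0 -> is_Clim (fun n => qsum K s (u n)) 1.
Proof.
  intros H; induction K as [|K IH].
  - apply is_Clim_ext with (fun _ => RtoC 1); [|apply is_Clim_const].
    intros n; unfold qsum; simpl; rewrite qpoly_0; ring.
  - apply is_Clim_ext with (fun n => qsum K s (u n) + qpoly (S K) s * (RtoC (u n) * RtoC (u n) ^ K))%C.
    + intros n; unfold qsum; reflexivity.
    + apply is_Clim_eq with (RtoC 1 + qpoly (S K) s * (RtoC 0 * RtoC 0 ^ K))%C; [|ring].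
      apply is_Clim_plus; auto. apply is_Clim_mult; [apply is_Clim_const|].
      apply is_Clim_mult; [now apply is_Clim_RtoC|].
      clear IH; induction K as [|K IHK]; simpl; [apply is_Clim_const|].
      apply is_Clim_mult; auto. now apply is_Clim_RtoC.
Qed.

Lemma qsum_bound K s : exists B, 0 <= B /\ forall h, 0 <= h <= 1 -> Cmod (qsum K s h) <= B /\ Cmod (qsum K s h - 1) <= B * h.
Proof.
  destruct (csum_bounded_1 (fun m => qpoly m s) (S K)) as (B & HB & H).
  destruct (csum_bounded_1 (fun m => qpoly (S m) s) K) as (B' & HB' & H').
  exists (B + B'); split; [lra|]. intros h Hh. split.
  - unfold qsum. specialize (H h Hh); lra.
  - unfold qsum; rewrite csum_shift, qpoly_0.
    replace (1 * h ^ 0 + csum (fun i => qpoly (S i) s * h ^ S i) K - 1)%C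
      with (h * csum (fun i => qpoly (S i) s * h ^ i) K)%C.
    + rewrite Cmod_mult, Cmod_R, Rabs_pos_eq by lra. specialize (H' h Hh). nra.
    + rewrite (csum_ext (fun i => qpoly (S i) s * h ^ S i)%C (fun i => h * (qpoly (S i) s * h ^ i))%C)
        by (intros; rewrite Cpow_S; ring).
      rewrite csum_scal; simpl; ring.
Qed.

(** * Asymptotic expansion of Gamma quotients *)

(** The truncated series for [Gamma(a + n) / Gamma(a + n - s)], carried back to [a] by the
    functional equation. It joins the truncated series at [a], for [n = 0], to the exact quotient in
    the limit. *)
Definition ratseq (K : nat) (s : C) (a : R) (n : nat) : C :=
  (Rcpow (a + INR n) s * qsum K s (/ (a + INR n))%R * (rising (a - s) n / rising a n))%C.

Lemma ratseq_S K s a n : 0 < a ->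
  (ratseq K s a (S n) - ratseq K s a n)%C =
  (Rcpow (a + INR n) s * (rising (a - s) n / rising a n) * defect K s (/ (a + INR n)))%C.
Proof.
  intros Ha; unfold ratseq, defect; cbn [rising].
  pose proof (pos_INR n) as P. rewrite S_INR.
  set (y := a + INR n). assert (Hy : 0 < y) by (unfold y; lra).
  replace (a + (INR n + 1)) with (y * (1 + / y)) by (unfold y; field; fold y; lra).
  assert (Hi : 0 < / y) by now apply Rinv_0_lt_compat.
  rewrite Rcpow_mult by lra.
  replace (/ (y * (1 + / y))) with (/ y / (1 + / y)) by (field; lra).
  replace (a - s + INR n)%C with (RtoC y - s)%C by (unfold y; rewrite RtoC_plus; ring).
  replace (RtoC a + INR n)%C with (RtoC y) by (unfold y; now rewrite RtoC_plus).
  rewrite (RtoC_inv y) by lra.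
  assert (RtoC y <> 0) by (apply RtoC_nz; lra).
  assert (rising a n <> 0) by (apply rising_nz, nonpole_Re; simpl; lra).
  cfield; auto.
Qed.

Lemma ratseq_lim K s (a : R) : 0 < a -> nonpole (a - s)%C ->
  is_Clim (ratseq K s a) (CGamma a / CGamma (a - s))%C.
Proof.
  intros Ha Hs.
  assert (Hp : nonpole a) by (apply nonpole_Re; simpl; lra).
  apply is_Clim_ext with (fun n => rgamma_seq (a - s) n * / rgamma_seq a n *
     (Rcpow ((INR n + a) / (INR n + 1)) s * qsum K s (/ (INR n + a))%R))%C.
  - intros n; unfold rgamma_seq, ratseq.
    pose proof (fact_nz n). pose proof (rising_nz _ n Hp). pose proof (pos_INR n).
    replace (1 - (a - s))%C with ((1 - a) + s)%C by ring.
    rewrite Rcpow_plus. unfold Rdiv.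
    rewrite Rcpow_mult by first [lra|apply Rinv_0_lt_compat; lra].
    replace (Rcpow (/ (INR n + 1)) s) with (/ Rcpow (INR n + 1) s)%C.
    2:{ unfold Rcpow; rewrite <- Cexp_opp, ln_Rinv by lra. apply (f_equal Cexp).
        rewrite RtoC_opp; ring. }
    pose proof (Rcpow_nz (INR n + 1) s). pose proof (Rcpow_nz (INR n + 1) (1 - a)%C).
    rewrite (Rplus_comm a (INR n)).
    cfield. repeat split; auto.
  - apply is_Clim_eq with (/ CGamma (a - s) * / / CGamma a * (RtoC 1 * RtoC 1))%C.
    2:{ pose proof (CGamma_nz _ Hp). pose proof (CGamma_nz _ Hs). cfield; auto. }
    apply is_Clim_mult.
    + apply is_Clim_mult; [now apply rgamma_seq_lim|].
      apply is_Clim_inv; [apply Cinv_neq_0, CGamma_nz, Hp|now apply rgamma_seq_lim].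
    + apply is_Clim_mult; [apply Rcpow_0_cont, ratio_lim|apply qsum_lim, inv_INR_lim].
Qed.

(** The relative increments of [ratseq] are [O((a + n)^(-K-2))]; their sum, which is [O(a^(-K-1))],
    bounds the distance from the first term of the sequence to its limit. *)
Lemma gamma_ratio_expansion K s : exists M A, 1 <= A /\ 0 <= M /\ forall a : R, A <= a ->
  Cmod (CGamma a / CGamma (a - s) * Rcpow a (- s) - qsum K s (/ a)%R) <= M * (/ a) ^ (K + 1).
Proof.
  destruct (defect_bigO0 K s) as [M0 HM0].
  destruct (qsum_bound K s) as (B & HB & HB').
  set (M := Rmax M0 1). assert (HM1 : 1 <= M) by apply Rmax_r. assert (HM2 : M0 <= M) by apply Rmax_l.
  (* [8 * M] brings the total relative variation below [1 / 2], [2 * B] keeps [qsum] within [1 / 2]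
     of 1, and the part with [Re s] keeps [a - s] away from the poles. *)
  set (A := 8 * M + 2 * B + Rabs (Re s) + 3).
  exists (16 * M * B), A.
  assert (HA : 2 <= A) by (unfold A; pose proof (Rabs_pos (Re s)); lra).
  repeat split; [lra|nra|].
  intros a Ha.
  assert (HAb : 8 * M <= a /\ 2 * B <= a /\ Re s < a).
  { unfold A in Ha; pose proof (Rabs_pos (Re s)); pose proof (Rle_abs (Re s)); lra. }
  assert (Hs : nonpole (a - s)%C).
  { apply nonpole_Re. change (0 < a - Re s). lra. }
  assert (Hinv : forall n, 0 < / (a + INR n) <= / a).
  { intros n; pose proof (pos_INR n); split; [apply Rinv_0_lt_compat; lra|].
    apply Rinv_le_contravar; lra. }
  assert (Hia : 0 < / a <= 1 / 2).
  { split; [apply Rinv_0_lt_compat; lra|].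
    replace (1 / 2) with (/ 2) by field. apply Rinv_le_contravar; lra. }
  set (d := (/ a) ^ K). assert (Hd : 0 < d) by (apply pow_lt; lra).
  assert (Hd1 : d <= 1) by (unfold d; rewrite <- (pow1 K); apply pow_incr; lra).
  destruct (slow_variation_limit (ratseq K s a) (fun n => 2 * M * d * / (a + INR n) ^ 2) (2 * M * d * (2 * / a)))
    as (l & Hl & Hl').
  - intros n. specialize (Hinv n). rewrite <- pow_inv.
    apply Rmult_le_pos; [nra|]. apply pow_le; lra.
  - intros n.
    assert (E : rsum (fun n => 2 * M * d * / (a + INR n) ^ 2) n = 2 * M * d * rsum (fun n => / (a + INR n) ^ 2) n).
    { induction n as [|n IH]; cbn [rsum]; [|rewrite IH]; ring. }
    rewrite E. apply Rmult_le_compat_l; [nra|].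
    eapply Rle_trans; [apply rsum_inv_sq; lra|].
    replace (2 * / a) with (/ (a / 2)) by (field; lra). apply Rinv_le_contravar; lra.
  - assert (4 * M * / a <= 1 / 2); [|nra].
    apply Rmult_le_reg_r with a; [lra|]. field_simplify; lra.
  - intros n. rewrite ratseq_S by lra.
    unfold ratseq. pose proof (Hinv n) as Hn.
    destruct (HB' (/ (a + INR n)) ltac:(lra)) as [_ HQ].
    (* Increments must be measured against [ratseq] itself, which contains the factor [qsum] where
       they contain the defect; hence a lower bound for [qsum]. *)
    assert (HQ2 : 1 / 2 <= Cmod (qsum K s (/ (a + INR n))%R)).
    { pose proof (Cmod_triangle_sub 1 (qsum K s (/ (a + INR n))%R)) as T.
      rewrite Cmod_1, Cmod_sub_sym in T.
      assert (B * / (a + INR n) <= 1 / 2); [|lra].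
      apply Rle_trans with (B * / a); [nra|].
      apply Rmult_le_reg_r with a; [lra|]. field_simplify; lra. }
    rewrite !Cmod_mult.
    set (X := Cmod (Rcpow (a + INR n) s)). set (Y := Cmod (rising (a - s) n / rising a n)).
    assert (0 <= X) by apply Cmod_ge_0. assert (0 <= Y) by apply Cmod_ge_0.
    assert (HD := HM0 (/ (a + INR n)) ltac:(lra)).
    assert (HP : (/ (a + INR n)) ^ (K + 2) <= d * / (a + INR n) ^ 2).
    { rewrite pow_add, <- (pow_inv _ 2). apply Rmult_le_compat_r; [apply pow_le; lra|].
      apply pow_incr; lra. }
    assert (HP0 : 0 <= (/ (a + INR n)) ^ (K + 2)) by (apply pow_le; lra).
    assert (HD2 : Cmod (defect K s (/ (a + INR n))) <= M * (d * / (a + INR n) ^ 2)) by nra.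
    set (Z := d * / (a + INR n) ^ 2) in *.
    replace (2 * M * d * / (a + INR n) ^ 2) with (2 * M * Z) by (unfold Z; ring).
    assert (0 <= Z) by lra.
    assert (0 <= X * Y) by nra. assert (0 <= M * Z) by nra.
    apply Rle_trans with (X * Y * (M * Z)); [apply Rmult_le_compat_l; auto|].
    replace (2 * M * Z * (X * Cmod (qsum K s (/ (a + INR n))%R) * Y))
      with (X * Y * (M * Z) * (2 * Cmod (qsum K s (/ (a + INR n))%R))) by ring.
    rewrite <- (Rmult_1_r (X * Y * (M * Z))) at 1. apply Rmult_le_compat_l; [nra|lra].
  - rewrite (is_Clim_unique _ _ _ (ratseq_lim K s a ltac:(lra) Hs) Hl).
    assert (E0 : ratseq K s a 0 = (Rcpow a s * qsum K s (/ a)%R)%C).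
    { unfold ratseq; simpl. rewrite Rplus_0_r. cfield. }
    rewrite E0 in Hl'.
    replace (l * Rcpow a (- s) - qsum K s (/ a)%R)%C
      with ((l - Rcpow a s * qsum K s (/ a)%R) * Rcpow a (- s))%C.
    2:{ rewrite Rcpow_opp. pose proof (Rcpow_nz a s). cfield; auto. }
    rewrite Cmod_mult, Rcpow_opp, Cmod_inv by apply Rcpow_nz.
    rewrite Cmod_mult in Hl'.
    assert (P : 0 < Cmod (Rcpow a s)) by (apply Cmod_gt_0, Rcpow_nz).
    apply Rmult_le_reg_r with (Cmod (Rcpow a s)); auto.
    rewrite Rmult_assoc, Rinv_l, Rmult_1_r by lra.
    eapply Rle_trans; [apply Hl'|].
    destruct (HB' (/ a) ltac:(lra)) as [HQ _].
    rewrite pow_add, pow_1. fold d.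
    replace (2 * (2 * M * d * (2 * / a)) * (Cmod (Rcpow a s) * Cmod (qsum K s (/ a)%R)))
      with (8 * M * d * / a * Cmod (Rcpow a s) * Cmod (qsum K s (/ a)%R)) by ring.
    replace (16 * M * B * (d * / a) * Cmod (Rcpow a s))
      with (8 * M * d * / a * Cmod (Rcpow a s) * (2 * B)) by ring.
    apply Rmult_le_compat_l; [|lra].
    repeat apply Rmult_le_pos; lra.
Qed.

(** * Power series along a line *)

Lemma Re_sum_n (f : nat -> C) n : Re (sum_n f n) = sum_n (fun k => Re (f k)) n.
Proof.
  induction n as [|n IH]; [now rewrite !sum_O|].
  rewrite Csum_n_S, sum_Sn, <- IH; reflexivity.
Qed.

Lemma Im_sum_n (f : nat -> C) n : Im (sum_n f n) = sum_n (fun k => Im (f k)) n.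
Proof.
  induction n as [|n IH]; [now rewrite !sum_O|].
  rewrite Csum_n_S, sum_Sn, <- IH; reflexivity.
Qed.

Definition is_Cpseries (a : nat -> C) (w l : C) : Prop :=
  is_pseries (K := C_AbsRing) (V := C_NormedModule) a w l.

(** On a line through the centre a complex series splits into two real power series, to which the
    real theory of radius, derivative and zeros applies. *)
Lemma is_Cpseries_line (a : nat -> C) (h : R) (e l : C) :
  is_Cpseries a (h * e)%C l ->
  is_pseries (fun n => Re (a n * e ^ n)%C) h (Re l) /\
  is_pseries (fun n => Im (a n * e ^ n)%C) h (Im l).
Proof.
  intros H.
  assert (E : forall k, scal (K := C_AbsRing) (V := C_NormedModule)
     (pow_n (K := AbsRing.Ring C_AbsRing) (h * e)%C k) (a k) = (RtoC (h ^ k) * (a k * e ^ k))%C).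
  { intros k.
    refine (eq_trans (f_equal (fun v => (v * a k)%C) (C_pow_n (h * e)%C k)) _).
    rewrite Cpow_mult_l, RtoC_pow; ring. }
  assert (T : forall n, sum_n (fun k => RtoC (h ^ k) * (a k * e ^ k))%C n =
    sum_n (G := NormedModule.AbelianMonoid C_AbsRing C_NormedModule)
      (fun k => scal (K := C_AbsRing) (V := C_NormedModule)
     (pow_n (K := AbsRing.Ring C_AbsRing) (h * e)%C k) (a k)) n).
  { intros n; symmetry; exact (sum_n_ext _ _ n E). }
  split; apply is_pseries_R; intros P [eps HP].
  - destruct (H (fun z : C => P (Re z))) as [N HN].
    + exists eps; intros z Hz; apply HP; apply Hz.
    + exists N; intros n Hn. specialize (HN n Hn).
      cbv beta in HN. rewrite <- T, Re_sum_n in HN.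
      erewrite sum_n_ext; [exact HN|]. intros k; unfold Re, Im; simpl; ring.
  - destruct (H (fun z : C => P (Im z))) as [N HN].
    + exists eps; intros z Hz; apply HP; apply Hz.
    + exists N; intros n Hn. specialize (HN n Hn).
      cbv beta in HN. rewrite <- T, Im_sum_n in HN.
      erewrite sum_n_ext; [exact HN|]. intros k; unfold Re, Im; simpl; ring.
Qed.

Definition rps (b : nat -> R) (f : R -> R) (t0 r : R) : Prop :=
  forall h, Rabs h < r -> is_pseries b h (f (t0 + h)).

Lemma rps_CV_radius b f t0 r h : rps b f t0 r -> Rabs h < r -> Rbar_lt (Rabs h) (CV_radius b).
Proof.
  intros H Hh.
  set (x := (Rabs h + r) / 2). pose proof (Rabs_pos h).
  assert (Hx : Rabs h < x < r) by (unfold x; lra).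
  apply Rbar_lt_le_trans with (Finite x); [apply Hx|].
  apply Rbar_not_lt_le; intros L.
  apply (CV_disk_outside b x).
  - now rewrite Rabs_pos_eq by lra.
  - apply ex_series_lim_0. exists (f (t0 + x)).
    refine (proj1 (is_pseries_R _ _ _) (H x _)). rewrite Rabs_pos_eq; lra.
Qed.

Lemma rps_value b f t0 r h : rps b f t0 r -> Rabs h < r -> f (t0 + h) = PSeries b h.
Proof. intros H Hh; symmetry; apply is_pseries_unique; auto. Qed.

Lemma rps_derive b f t0 r h : rps b f t0 r -> Rabs h < r ->
  is_derive f (t0 + h) (PSeries (PS_derive b) h).
Proof.
  intros H Hh.
  assert (P : 0 < r - Rabs h) by lra.
  apply (is_derive_ext_loc (K := R_AbsRing) (V := R_NormedModule) (fun t => PSeries b (t - t0))).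
  - exists (mkposreal _ P); intros t Ht.
    change (Rabs (t - (t0 + h)) < r - Rabs h) in Ht.
    replace t with (t0 + (t - t0)) at 2 by ring. symmetry; apply rps_value with r; auto.
    replace (t - t0) with ((t - (t0 + h)) + h) by ring.
    pose proof (Rabs_triang (t - (t0 + h)) h); lra.
  - eapply is_derive_eq.
    + apply (is_derive_Rcomp (PSeries b) (fun t => t - t0)).
      * apply is_derive_PSeries. replace (t0 + h - t0) with h by ring. eapply rps_CV_radius; eauto.
      * instantiate (1 := 1). auto_derive; auto; ring.
    + replace (t0 + h - t0) with h by ring; ring.
Qed.

Lemma PSeries_zero_left b r d : 0 < r -> 0 < d ->
  (forall h, Rabs h < r -> Rbar_lt (Rabs h) (CV_radius b)) ->
  (forall h, - d < h < 0 -> Rabs h < r -> PSeries b h = 0) -> b O = 0.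
Proof.
  intros Hr Hd HR HZ.
  assert (C0 : continuity_pt (PSeries b) 0).
  { apply PSeries_continuity, HR. now rewrite Rabs_R0. }
  assert (L : is_lim_seq (fun n => PSeries b (- / (INR n + 1))) (PSeries b 0)).
  { apply is_lim_seq_continuous; auto. rewrite <- Ropp_0.
    apply (is_lim_seq_opp (fun n => / (INR n + 1)) 0), inv_INR_lim. }
  rewrite <- PSeries_0.
  assert (L2 : is_lim_seq (fun n => PSeries b (- / (INR n + 1))) 0).
  { apply is_lim_seq_ext_loc with (fun _ => 0); [|apply is_lim_seq_const].
    destruct (INR_unbounded (/ Rmin r d)) as [N HN]; exists N; intros n Hn.
    assert (P : 0 < Rmin r d) by now apply Rmin_glb_lt.
    apply le_INR in Hn.
    assert (0 < / (INR n + 1) < Rmin r d).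
    { pose proof (pos_INR n). split; [apply Rinv_0_lt_compat; lra|].
      rewrite <- (Rinv_inv (Rmin r d)).
      apply Rinv_lt_contravar; [|lra].
      apply Rmult_lt_0_compat; [now apply Rinv_0_lt_compat|lra]. }
    pose proof (Rmin_l r d); pose proof (Rmin_r r d).
    symmetry; apply HZ; [lra|]. rewrite Rabs_Ropp, Rabs_pos_eq; lra. }
  apply is_lim_seq_unique in L, L2. congruence.
Qed.

(** Continuity from the left gives the constant coefficient, and division by [h] moves on to the
    next. Only zeros to the left of [t0] are assumed, to match [continuous_induction], where the
    property is known only before the current point. *)
Lemma rps_zero_coefs b f t0 r d : 0 < r -> 0 < d -> rps b f t0 r ->
  (forall h, - d < h < 0 -> f (t0 + h) = 0) -> forall n, b n = 0.
Proof.
  intros Hr Hd H H0.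
  assert (K : forall n b, (forall h, Rabs h < r -> Rbar_lt (Rabs h) (CV_radius b)) ->
    (forall h, - d < h < 0 -> Rabs h < r -> PSeries b h = 0) -> b n = 0).
  { clear b f H H0; induction n as [|n IH]; intros b HR HZ.
    - now apply PSeries_zero_left with r d.
    - change (b (S n)) with (PS_decr_1 b n). apply IH.
      + intros h Hh. rewrite CV_radius_decr_1; auto.
      + intros h Hh Hh'.
        assert (E := HZ h Hh Hh').
        rewrite PSeries_decr_1, (PSeries_zero_left b r d), Rplus_0_l in E
          by first [apply CV_radius_inside; auto|auto].
        apply Rmult_integral in E; destruct E; auto; lra. }
  intros n; apply K.
  - intros h Hh; eapply rps_CV_radius; eauto.
  - intros h Hh Hh'. rewrite <- (rps_value b f t0 r); auto.
Qed.

Lemma rps_zero_coefs_value b f t0 r h : rps b f t0 r -> (forall n, b n = 0) -> Rabs h < r -> f (t0 + h) = 0.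
Proof.
  intros H Z Hh. rewrite (rps_value b f t0 r); auto.
  rewrite (PSeries_ext _ (fun _ => 0)) by auto. apply PSeries_const_0.
Qed.

(** Induction along a real interval, by a supremum. It plays the part of connectedness wherever an
    identity between analytic functions is continued along a path. *)
Lemma continuous_induction (P : R -> Prop) (T : R) :
  (exists d, 0 < d /\ forall t, 0 <= t < d -> P t) ->
  (forall t, 0 < t <= T -> (forall s, 0 <= s < t -> P s) ->
     exists d, 0 < d /\ forall s, t - d < s < t + d -> P s) ->
  forall t, 0 <= t <= T -> P t.
Proof.
  intros (d0 & Hd0 & H0) Hs t Ht.
  set (E := fun x => 0 <= x <= T /\ forall s, 0 <= s < x -> P s).
  assert (B : bound E) by (exists T; intros x [Hx _]; lra).
  assert (NE : exists x, E x) by (exists 0; split; [lra|intros; lra]).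
  destruct (completeness E B NE) as [tau [U L]].
  assert (Htau : 0 <= tau <= T).
  { split; [apply U; split; [lra|intros; lra]|apply L; intros x [Hx _]; lra]. }
  assert (A : forall s, 0 <= s < tau -> P s).
  { intros s Hs'. destruct (classic (exists x, E x /\ s < x)) as [(x & [_ Hx] & Hsx)|N].
    - apply Hx; lra.
    - exfalso. enough (tau <= s) by lra. apply L; intros x Hx.
      apply Rnot_lt_le; intros Hlt; apply N; eauto. }
  assert (P0 : exists d, 0 < d /\ forall s, 0 <= s < tau + d -> P s).
  { destruct (Req_dec tau 0) as [E0|E0].
    - exists d0; split; auto. intros s Hs'; apply H0; lra.
    - destruct (Hs tau ltac:(lra) A) as (d & Hd & HP). exists d; split; auto.
      intros s Hs'. destruct (Rlt_le_dec s tau); [apply A; lra|apply HP; lra]. }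
  destruct P0 as (d & Hd & HP).
  apply HP. split; [lra|].
  destruct (Rlt_le_dec T (tau + d / 2)).
  - lra.
  - exfalso. assert (tau + d / 2 <= tau); [|lra].
    apply U; split; [lra|]. intros s Hs'; apply HP; lra.
Qed.

(** * The hypergeometric function on the negative axis *)

(** The coefficients in [h] of [t (1 + t) f' + (c0 + c1 t) f + (d0 + d1 t) g + e] at [t = t0 + h].
    Two series [al] and [be] occur because the real and imaginary parts of a complex equation are
    coupled. *)
Definition ode_coef (al be : nat -> R) (t0 c0 c1 d0 d1 e : R) (n : nat) : R :=
  t0 * (1 + t0) * (INR (S n) * al (S n)) + (1 + 2 * t0) * (INR n * al n)
  + match n with O => 0 | S m => INR m * al m end
  + (c0 + c1 * t0) * al n + c1 * match n with O => 0 | S m => al m end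
  + (d0 + d1 * t0) * be n + d1 * match n with O => 0 | S m => be m end
  + match n with O => e | S _ => 0 end.

Lemma is_pseries_Rplus (a b : nat -> R) (x l m : R) :
  is_pseries a x l -> is_pseries b x m -> is_pseries (fun n => a n + b n) x (l + m).
Proof. apply (is_pseries_plus (K := R_AbsRing) (V := R_NormedModule)). Qed.

Lemma is_pseries_Rscal (c : R) (a : nat -> R) (x l : R) :
  is_pseries a x l -> is_pseries (fun n => c * a n) x (c * l).
Proof. apply (is_pseries_scal (K := R_AbsRing) (V := R_NormedModule)), Rmult_comm. Qed.

Lemma is_pseries_Rincr (a : nat -> R) (x l : R) :
  is_pseries a x l -> is_pseries (fun n => match n with O => 0 | S m => a m end) x (x * l).
Proof. apply (is_pseries_incr_1 (K := R_AbsRing) (V := R_NormedModule)). Qed.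

Lemma is_pseries_Rconst (e x : R) : is_pseries (fun n => match n with O => e | S _ => 0 end) x e.
Proof.
  apply is_pseries_R.
  apply (is_lim_seq_ext (fun _ => e) _ e); [|apply is_lim_seq_const].
  induction n as [|n IH].
  - rewrite sum_O. change (e = e * 1). ring.
  - rewrite sum_Sn, <- IH. change (e = e + 0 * x ^ S n). ring.
Qed.

Lemma rps_ode al be f g t0 r c0 c1 d0 d1 e : rps al f t0 r -> rps be g t0 r ->
  rps (ode_coef al be t0 c0 c1 d0 d1 e)
    (fun t => t * (1 + t) * Derive f t + (c0 + c1 * t) * f t + (d0 + d1 * t) * g t + e) t0 r.
Proof.
  intros Hf Hg h Hh.
  assert (F := Hf h Hh); assert (G := Hg h Hh).
  assert (D : is_pseries (PS_derive al) h (Derive f (t0 + h))).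
  { rewrite (is_derive_unique _ _ _ (rps_derive al f t0 r h Hf Hh)).
    apply PSeries_correct, CV_radius_inside. rewrite CV_radius_derive. eapply rps_CV_radius; eauto. }
  set (F' := Derive f (t0 + h)) in *. set (f' := f (t0 + h)) in *. set (g' := g (t0 + h)) in *.
  replace ((t0 + h) * (1 + (t0 + h)) * F' + (c0 + c1 * (t0 + h)) * f' + (d0 + d1 * (t0 + h)) * g' + e)
    with (t0 * (1 + t0) * F' + (1 + 2 * t0) * (h * F') + h * (h * F')
          + (c0 + c1 * t0) * f' + c1 * (h * f') + (d0 + d1 * t0) * g' + d1 * (h * g') + e) by ring.
  clearbody F' f' g'. eapply is_pseries_ext.
  2:{ repeat match goal with
      | |- is_pseries _ _ (_ + _) => apply is_pseries_Rplus
      | |- is_pseries _ _ (h * _) => apply is_pseries_Rincr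
      | |- is_pseries _ _ (_ * _) => apply is_pseries_Rscal
      | |- is_pseries _ _ F' => exact D
      | |- is_pseries _ _ f' => exact F
      | |- is_pseries _ _ g' => exact G
      end. apply is_pseries_Rconst. }
  intros [|[|n]]; unfold ode_coef, PS_derive; rewrite ?S_INR; change (INR 0) with 0;
    match goal with |- @eq _ ?a ?b => change (@eq R a b) end; ring.
Qed.


Lemma ode_coef_zero (B : nat -> C) (b c : C) :
  B O = 1 -> (forall n, ((c + INR n) * B (S n) + (b + INR n) * B n)%C = 0) -> forall n,
  ode_coef (fun n => Re (B n)) (fun n => Im (B n)) 0 (Re c - 1) (Re b) (- Im c) (- Im b)
    (- (Re c - 1)) n = 0 /\
  ode_coef (fun n => Im (B n)) (fun n => Re (B n)) 0 (Re c - 1) (Re b) (Im c) (Im b) (- Im c) n = 0.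
Proof.
  intros B0 BS [|n]; unfold ode_coef.
  - rewrite B0; simpl; split; ring.
  - specialize (BS n). rewrite !S_INR.
    assert (E1 := f_equal Re BS). assert (E2 := f_equal Im BS).
    generalize dependent (B (S n)); generalize dependent (B n).
    destruct b as [b1 b2], c as [c1 c2]. intros [x1 x2] [y1 y2] _ E1 E2.
    unfold Re, Im in *; simpl in E1, E2; simpl fst; simpl snd. split; lra.
Qed.

(** With first parameter 1, [rising 1 n] cancels the factorial and consecutive coefficients are
    linked by [(c + n) B(n+1) + (b + n) B(n) = 0]: a first-order inhomogeneous equation near 0. Its
    left side has power series at every [t >= 0], so it remains 0 along the half-line. *)
Lemma Gauss_ode (F : C -> C -> C -> C -> C) (b c : C) (t : R) :
  is_Gauss_2F1 F -> nonpole c -> 0 <= t ->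
  exists fd : C, is_Cderive (fun t => F 1 b c (- RtoC t)%C) t fd /\
   (t * (1 + t) * fd + (c - 1 + b * t) * F 1 b c (- RtoC t) - (c - 1))%C = 0.
Proof.
  intros HF Hc Ht.
  assert (Hc' : forall n, c <> (- INR n)%C).
  { intros n E; apply (Hc n); rewrite E; ring. }
  destruct (HF 1 b c Hc') as [H1 H2].
  set (f := fun t : R => F 1 b c (- RtoC t)%C).
  set (A := fun n => (rising 1 n * rising b n / (rising c n * INR (Factorial.fact n)))%C) in *.
  assert (LOC : forall t0, 0 <= t0 -> exists a r, 0 < r /\
     rps (fun n => Re (a n * (-1) ^ n)%C) (fun t => Re (f t)) t0 r /\
     rps (fun n => Im (a n * (-1) ^ n)%C) (fun t => Im (f t)) t0 r).
  { intros t0 Ht0. destruct (H2 (- RtoC t0)%C) as (a & r & Hr).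
    { unfold cut_plane; simpl; lra. }
    exists a, r; split; [apply r|].
    assert (Q : forall h, Rabs h < r -> is_Cpseries a (h * (-1))%C (f (t0 + h))).
    { intros h Hh. specialize (Hr (- RtoC (t0 + h))%C).
      replace (- RtoC (t0 + h) - - RtoC t0)%C with (h * (-1))%C in Hr by (rewrite RtoC_plus; ring).
      apply Hr. rewrite Cmod_mult, !Cmod_R, (Rabs_left (-1)); lra. }
    split; intros h Hh; apply (is_Cpseries_line a h (-1)), Q, Hh. }
  set (B := fun n => (A n * (-1) ^ n)%C).
  assert (B0 : B O = 1).
  { unfold B, A; simpl. field. }
  assert (BS : forall n, ((c + INR n) * B (S n) + (b + INR n) * B n)%C = 0).
  { intros n; unfold B, A; cbn [rising].
    assert (R1 : rising 1 n = INR (Factorial.fact n)).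
    { clear; induction n as [|n IH]; cbn [rising]; auto.
      change (Factorial.fact (S n)) with (S n * Factorial.fact n)%nat.
      rewrite IH, mult_INR, S_INR, !RtoC_mult, RtoC_plus; ring. }
    rewrite R1. change (Factorial.fact (S n)) with (S n * Factorial.fact n)%nat.
    rewrite mult_INR, RtoC_mult, (Cpow_S (-1)).
    replace (1 + INR n)%C with (RtoC (INR (S n))) by (rewrite S_INR, RtoC_plus; ring).
    pose proof (INR_S_nz n). pose proof (fact_nz n). pose proof (rising_nz c n Hc). pose proof (Hc n).
    cfield; auto. }
  assert (L0 : rps (fun n => Re (B n)) (fun t => Re (f t)) 0 1 /\
               rps (fun n => Im (B n)) (fun t => Im (f t)) 0 1).
  { split; intros h Hh; rewrite Rplus_0_l; apply (is_Cpseries_line A h (-1));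
      replace (f h) with (F 1 b c (h * (-1)))%C by (unfold f; apply (f_equal (F 1 b c)); ring);
      apply H1; rewrite Cmod_mult, !Cmod_R, (Rabs_left (-1)); lra. }
  set (ZR := fun t => t * (1 + t) * Derive (fun t => Re (f t)) t + (Re c - 1 + Re b * t) * Re (f t)
     + (- Im c + - Im b * t) * Im (f t) + - (Re c - 1)).
  set (ZI := fun t => t * (1 + t) * Derive (fun t => Im (f t)) t + (Re c - 1 + Re b * t) * Im (f t)
     + (Im c + Im b * t) * Re (f t) + - Im c).
  assert (Z : forall t, 0 <= t <= Rmax t 0 -> ZR t = 0 /\ ZI t = 0).
  { intros t' Ht'. refine (continuous_induction (fun t => ZR t = 0 /\ ZI t = 0) (Rmax t' 0) _ _ t' _); auto.
    - exists 1; split; [lra|]. intros s Hs.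
      destruct L0 as [L1 L2].
      pose proof (rps_ode _ _ _ _ _ _ (Re c - 1) (Re b) (- Im c) (- Im b) (- (Re c - 1)) L1 L2) as E1.
      pose proof (rps_ode _ _ _ _ _ _ (Re c - 1) (Re b) (Im c) (Im b) (- Im c) L2 L1) as E2.
      split.
      + assert (Q := rps_zero_coefs_value _ _ _ _ s E1). rewrite Rplus_0_l in Q. apply Q.
        * intros n; apply (ode_coef_zero B b c B0 BS n).
        * rewrite Rabs_pos_eq; lra.
      + assert (Q := rps_zero_coefs_value _ _ _ _ s E2). rewrite Rplus_0_l in Q. apply Q.
        * intros n; apply (ode_coef_zero B b c B0 BS n).
        * rewrite Rabs_pos_eq; lra.
    - intros s Hs HZ.
      destruct (LOC s ltac:(lra)) as (a & r & Hr & L1 & L2).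
      pose proof (rps_ode _ _ _ _ _ _ (Re c - 1) (Re b) (- Im c) (- Im b) (- (Re c - 1)) L1 L2) as E1.
      pose proof (rps_ode _ _ _ _ _ _ (Re c - 1) (Re b) (Im c) (Im b) (- Im c) L2 L1) as E2.
      exists r; split; auto. intros y Hy.
      replace y with (s + (y - s)) by ring.
      assert (Hy' : Rabs (y - s) < r) by (apply Rabs_def1; lra).
      split.
      + apply (rps_zero_coefs_value _ _ _ _ (y - s) E1); auto.
        apply (rps_zero_coefs _ _ _ _ s Hr ltac:(lra) E1). intros h Hh; apply HZ; lra.
      + apply (rps_zero_coefs_value _ _ _ _ (y - s) E2); auto.
        apply (rps_zero_coefs _ _ _ _ s Hr ltac:(lra) E2). intros h Hh; apply HZ; lra. }
  destruct (LOC t Ht) as (a & r & Hr & L1 & L2).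
  destruct (Z t) as [Z1 Z2]; [split; auto; apply Rmax_l|].
  exists (Derive (fun t => Re (f t)) t, Derive (fun t => Im (f t)) t); split.
  - assert (D1 := rps_derive _ _ _ _ 0 L1 ltac:(rewrite Rabs_R0; lra)).
    assert (D2 := rps_derive _ _ _ _ 0 L2 ltac:(rewrite Rabs_R0; lra)).
    rewrite Rplus_0_r in D1, D2.
    split; simpl; apply Derive_correct; eexists; eassumption.
  - apply C_ext; unfold ZR, ZI in *; change (F 1 b c (- RtoC t)%C) with (f t);
      unfold Re, Im in *; simpl in *; lra.
Qed.

(** The value at 0 is 1 and each of the two parts moves by less than 1, whence 3. *)
Lemma Gauss_near_0 (F : C -> C -> C -> C -> C) (b c : C) :
  is_Gauss_2F1 F -> nonpole c ->
  exists d, 0 < d /\ forall t : R, 0 <= t < d -> Cmod (F 1 b c (- RtoC t)%C) <= 3.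
Proof.
  intros HF Hc.
  assert (E0 : F 1 b c (- RtoC 0)%C = 1).
  { destruct (Gauss_ode F b c 0 HF Hc ltac:(lra)) as (fd & _ & E).
    assert (Hc' : forall n, c <> (- INR n)%C).
    { intros n Z; apply (Hc n); rewrite Z; ring. }
    destruct (HF 1 b c Hc') as [H1 _].
    assert (Q := H1 (0 * 1)%C). apply is_Cpseries_line in Q.
    2:{ rewrite Cmult_0_l, Cmod_0; lra. }
    rewrite Cmult_0_l in Q. replace (- RtoC 0)%C with (RtoC 0) by ring.
    destruct Q as [Q1 Q2]. apply is_pseries_unique in Q1, Q2. rewrite PSeries_0 in Q1, Q2.
    apply C_ext; [rewrite <- Q1|rewrite <- Q2]; unfold Re, Im; simpl; field. }
  destruct (Gauss_ode F b c 0 HF Hc ltac:(lra)) as (fd & [D1 D2] & _).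
  assert (K : forall g : R -> R, (exists l, is_derive g 0 l) ->
    exists d, 0 < d /\ forall t, 0 <= t < d -> Rabs (g t - g 0) < 1).
  { intros g Hg. apply ex_derive_continuous in Hg.
    destruct (Hg (fun y => Rabs (y - g 0) < 1)) as [d Hd].
    - exists (mkposreal 1 Rlt_0_1); intros y Hy; exact Hy.
    - exists d; split; [apply d|]. intros t Ht; apply Hd.
      change (Rabs (t - 0) < d). rewrite Rabs_pos_eq; lra. }
  destruct (K _ (ex_intro _ _ D1)) as (d1 & P1 & K1).
  destruct (K _ (ex_intro _ _ D2)) as (d2 & P2 & K2).
  exists (Rmin d1 d2); split; [now apply Rmin_glb_lt|].
  intros t Ht. pose proof (Rmin_l d1 d2); pose proof (Rmin_r d1 d2).
  specialize (K1 t ltac:(lra)). specialize (K2 t ltac:(lra)).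
  eapply Rle_trans; [apply (Cmod_triangle_sub _ (F 1 b c (- RtoC 0)%C))|].
  rewrite E0 at 2. rewrite Cmod_1.
  eapply Rle_trans; [apply Rplus_le_compat_r, Cmod_le_Re_Im|].
  simpl in *. unfold Re, Im in *; simpl in *.
  change (Rabs (fst (F 1 b c (- t)%C) - fst (F 1 b c (- RtoC 0)%C)) +
   Rabs (snd (F 1 b c (- t)%C) - snd (F 1 b c (- RtoC 0)%C)) + 1 <= 3). lra.
Qed.

Definition kern (s y : R) : R := exp (- s * ln (1 + exp y)).

(* [A' = e^(p y) (1 + e^y)^(-s)] and [A] vanishes at -oo: an incomplete beta function. *)
Definition Abeta (F : C -> C -> C -> C -> C) (p : C) (s y : R) : C :=
  (Cexp (p * y) * kern (s - 1) y * F 1 (1 - s + p) (p + 1) (- RtoC (exp y)) / p)%C.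

Lemma is_derive_kern s y : is_derive (kern s) y (- s * (exp y / (1 + exp y)) * kern s y).
Proof.
  unfold kern; pose proof (exp_pos y). auto_derive; [lra|]. field; lra.
Qed.

Lemma kern_pos s y : 0 < kern s y.
Proof. apply exp_pos. Qed.

Lemma kern_plus s t y : kern (s + t) y = kern s y * kern t y.
Proof. unfold kern; rewrite <- exp_plus; f_equal; ring. Qed.

Lemma kern_m1 y : kern (-1) y = 1 + exp y.
Proof.
  unfold kern. replace (- -1 * ln (1 + exp y)) with (ln (1 + exp y)) by ring.
  apply exp_ln. pose proof (exp_pos y); lra.
Qed.

Lemma kern_1 y : kern 1 y = / (1 + exp y).
Proof.
  unfold kern. replace (- (1) * ln (1 + exp y)) with (- ln (1 + exp y)) by ring.
  rewrite exp_Ropp, exp_ln; auto. pose proof (exp_pos y); lra.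
Qed.

(** Once [Gauss_ode] is inserted for the derivative of the Gauss function, all terms still
    containing that function cancel and only the inhomogeneous term remains. *)
Lemma is_Cderive_Abeta F p s y : is_Gauss_2F1 F -> 0 < Re p ->
  is_Cderive (Abeta F p s) y (Cexp (p * y) * kern s y)%C.
Proof.
  intros HF Hp.
  assert (Hp0 : p <> 0) by (intros E; rewrite E in Hp; simpl in Hp; lra).
  assert (Hc : nonpole (p + 1)%C).
  { apply nonpole_S, nonpole_Re; auto. }
  pose proof (exp_pos y) as Pe.
  destruct (Gauss_ode F (1 - s + p)%C (p + 1)%C (exp y) HF Hc ltac:(lra)) as (fd & D & E).
  unfold Abeta.
  eapply is_Cderive_eq.
  - apply is_Cderive_ext with (fun y : R => (/ p) * (Cexp (p * y) * kern (s - 1) y *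
       (fun t : R => F 1 (1 - s + p) (p + 1) (- RtoC t)) (exp y)))%C.
    { intros t; unfold Cdiv; ring. }
    apply is_Cderive_scal, is_Cderive_mult.
    + apply is_Cderive_mult; [apply is_Cderive_Cexp|apply is_Cderive_RtoC, is_derive_kern].
    + apply (is_Cderive_comp (fun t : R => F 1 (1 - s + p) (p + 1) (- RtoC t))%C exp); [exact D|].
      apply is_derive_exp.
  - cbv beta. set (f := F 1 (1 - s + p)%C (p + 1)%C (- RtoC (exp y))%C) in *.
    replace s with ((s - 1) + 1) at 5 by ring.
    rewrite kern_plus, kern_1.
    assert (N : RtoC (1 + exp y) <> 0) by (apply RtoC_nz; lra).
    assert (Efd : (RtoC (exp y) * fd)%C = ((p - (p + (1 - s + p) * exp y) * f) / (1 + exp y)%R)%C).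
    { replace (RtoC (exp y) * fd)%C with ((exp y * (1 + exp y) * fd + (p + 1 - 1 + (1 - s + p) * exp y) * f - (p + 1 - 1)
         + (p - (p + (1 - s + p) * exp y) * f)) / (1 + exp y)%R)%C.
      - rewrite E. unfold Cdiv; ring.
      - rewrite RtoC_plus in *. cfield; auto. }
    rewrite Efd.
    rewrite !RtoC_mult, RtoC_div, RtoC_opp, RtoC_inv by lra.
    rewrite RtoC_minus, RtoC_plus in *.
    cfield; auto.
Qed.

Lemma Abeta_minf F p s : is_Gauss_2F1 F -> 0 < Re p ->
  exists M y0, 0 <= M /\ forall y, y <= y0 -> Cmod (Abeta F p s y) <= M * exp (Re p * y).
Proof.
  intros HF Hp.
  assert (Hp0 : p <> 0) by (intros E; rewrite E in Hp; simpl in Hp; lra).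
  assert (Hc : nonpole (p + 1)%C).
  { apply nonpole_S, nonpole_Re; auto. }
  destruct (Gauss_near_0 F (1 - s + p)%C (p + 1)%C HF Hc) as (d & Hd & H).
  set (y0 := Rmin (ln (d / 2)) 0).
  assert (Pp : 0 < Cmod p) by now apply Cmod_gt_0.
  exists (exp (Rabs (s - 1)) * 3 / Cmod p), y0.
  assert (HM : 0 <= exp (Rabs (s - 1)) * 3 / Cmod p).
  { pose proof (exp_pos (Rabs (s - 1))). apply Rdiv_le_0_compat; lra. }
  split; auto.
  intros y Hy.
  assert (Hy1 : y <= ln (d / 2)) by (eapply Rle_trans; [exact Hy|apply Rmin_l]).
  assert (Hy2 : y <= 0) by (eapply Rle_trans; [exact Hy|apply Rmin_r]).
  assert (He : exp y <= d / 2).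
  { rewrite <- (exp_ln (d / 2)) by lra. now apply exp_le. }
  assert (He1 : exp y <= 1) by (rewrite <- exp_0; now apply exp_le).
  pose proof (exp_pos y).
  unfold Abeta. rewrite Cmod_div, !Cmod_mult, Cmod_Cexp, Cmod_R by auto.
  rewrite Rabs_pos_eq by apply Rlt_le, kern_pos.
  replace (Re (p * y)%C) with (Re p * y) by (unfold Re, Im; simpl; ring).
  specialize (H (exp y) ltac:(lra)).
  assert (kern (s - 1) y <= exp (Rabs (s - 1))).
  { unfold kern; apply exp_le. destruct (ln_1p_bounds (exp y) ltac:(lra)).
    pose proof (Rle_abs (- (s - 1))) as Q. rewrite Rabs_Ropp in Q.
    pose proof (Rabs_pos (s - 1)). nra. }
  pose proof (exp_pos (Re p * y)). pose proof (kern_pos (s - 1) y).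
  unfold Rdiv.
  replace (exp (Rabs (s - 1)) * 3 * / Cmod p * exp (Re p * y))
    with (exp (Re p * y) * (exp (Rabs (s - 1)) * 3) * / Cmod p) by ring.
  apply Rmult_le_compat_r; [apply Rlt_le, Rinv_0_lt_compat; auto|].
  rewrite Rmult_assoc. apply Rmult_le_compat_l; [lra|].
  apply Rmult_le_compat; auto using Cmod_ge_0; lra.
Qed.

(** * Incomplete beta functions *)

Lemma exp_small (c M e : R) : 0 < c -> 0 < e -> exists y0, forall y, y <= y0 -> M * exp (c * y) <= e.
Proof.
  intros Hc He. set (M' := Rmax M 1). assert (1 <= M') by apply Rmax_r. assert (M <= M') by apply Rmax_l.
  exists (ln (e / M') / c). intros y Hy.
  assert (P : 0 < e / M') by (apply Rdiv_lt_0_compat; lra).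
  apply Rle_trans with (M' * (e / M')); [|right; field; lra].
  apply Rle_trans with (M' * exp (c * y)); [apply Rmult_le_compat_r; [apply Rlt_le, exp_pos|auto]|].
  apply Rmult_le_compat_l; [lra|].
  rewrite <- (exp_ln (e / M')) by auto. apply exp_le.
  apply Rmult_le_reg_r with (/ c); [now apply Rinv_0_lt_compat|].
  replace (c * y * / c) with y by (field; lra). exact Hy.
Qed.

Definition vanishes (f : R -> C) : Prop :=
  exists c M y0, 0 < c /\ 0 <= M /\ forall y, y <= y0 -> Cmod (f y) <= M * exp (c * y).

Lemma vanishes_plus f g : vanishes f -> vanishes g -> vanishes (fun y => f y + g y)%C.
Proof.
  intros (c & M & y0 & Hc & HM & H) (c' & M' & y0' & Hc' & HM' & H').
  exists (Rmin c c'), (M + M'), (Rmin (Rmin y0 y0') 0).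
  split; [now apply Rmin_glb_lt|split; [lra|]]. intros y Hy.
  assert (y <= y0 /\ y <= y0' /\ y <= 0).
  { pose proof (Rmin_l (Rmin y0 y0') 0); pose proof (Rmin_r (Rmin y0 y0') 0).
    pose proof (Rmin_l y0 y0'); pose proof (Rmin_r y0 y0'). lra. }
  eapply Rle_trans; [apply Cmod_triangle|].
  specialize (H y ltac:(lra)). specialize (H' y ltac:(lra)).
  assert (exp (c * y) <= exp (Rmin c c' * y)) by (apply exp_le; pose proof (Rmin_l c c'); nra).
  assert (exp (c' * y) <= exp (Rmin c c' * y)) by (apply exp_le; pose proof (Rmin_r c c'); nra).
  nra.
Qed.

Lemma vanishes_scal k f : vanishes f -> vanishes (fun y => k * f y)%C.
Proof.
  intros (c & M & y0 & Hc & HM & H).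
  exists c, (Cmod k * M), y0; split; auto. pose proof (Cmod_ge_0 k). split; [nra|].
  intros y Hy. rewrite Cmod_mult, Rmult_assoc. apply Rmult_le_compat_l; auto.
Qed.

Lemma vanishes_ext f g : (forall y, f y = g y) -> vanishes f -> vanishes g.
Proof.
  intros E (c & M & y0 & Hc & HM & H); exists c, M, y0; repeat split; auto.
  intros y Hy; rewrite <- E; auto.
Qed.

Lemma vanishes_small f e : vanishes f -> 0 < e -> exists y0, forall y, y <= y0 -> Cmod (f y) <= e.
Proof.
  intros (c & M & y0 & Hc & HM & H) He.
  destruct (exp_small c M e Hc He) as [y1 H1].
  exists (Rmin y0 y1); intros y Hy. pose proof (Rmin_l y0 y1); pose proof (Rmin_r y0 y1).
  eapply Rle_trans; [apply H; lra|apply H1; lra].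
Qed.

(** Replaces integration from -oo: quantities that decay there and have equal derivatives agree. *)
Lemma vanishes_const f : vanishes f -> (forall y, is_Cderive f y 0) -> forall y, f y = 0.
Proof.
  intros V D y. apply Cmod_eq_0.
  destruct (Req_dec (Cmod (f y)) 0) as [E|E]; auto. exfalso.
  assert (P : 0 < Cmod (f y)) by (pose proof (Cmod_ge_0 (f y)); lra).
  destruct (vanishes_small f (Cmod (f y) / 2) V ltac:(lra)) as [y0 H].
  specialize (H y0 ltac:(lra)). rewrite (Cderive_zero_const f D y0 y) in H. lra.
Qed.

Lemma vanishes_Abeta F p s : is_Gauss_2F1 F -> 0 < Re p -> vanishes (Abeta F p s).
Proof.
  intros HF Hp; destruct (Abeta_minf F p s HF Hp) as (M & y0 & HM & H).
  exists (Re p), M, y0; auto.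
Qed.

Lemma kern_le_1 s y : 0 <= s -> kern s y <= 1.
Proof.
  intros Hs.
  assert (0 <= ln (1 + exp y)).
  { rewrite <- ln_1 at 1; apply ln_le; pose proof (exp_pos y); lra. }
  apply Rle_trans with (exp 0); [apply exp_le; nra|rewrite exp_0; lra].
Qed.

Lemma vanishes_dens (p : C) s : 0 < Re p -> 0 <= s -> vanishes (fun y => Cexp (p * y) * kern s y)%C.
Proof.
  intros Hp Hs. exists (Re p), 1, 0; repeat split; auto; try lra.
  intros y Hy. rewrite Cmod_mult, Cmod_Cexp, Cmod_R, Rabs_pos_eq by apply Rlt_le, kern_pos.
  replace (Re (p * y)%C) with (Re p * y) by (unfold Re, Im; simpl; ring).
  pose proof (kern_le_1 s y Hs). pose proof (exp_pos (Re p * y)). nra.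
Qed.

Lemma is_Cderive_dens (p : C) s y :
  is_Cderive (fun y => Cexp (p * y) * kern s y)%C y
    (Cexp (p * y) * kern s y * (p - s * (exp y / (1 + exp y))%R))%C.
Proof.
  eapply is_Cderive_eq.
  - apply is_Cderive_mult; [apply is_Cderive_Cexp|apply is_Cderive_RtoC, is_derive_kern].
  - rewrite !RtoC_mult, RtoC_opp. cring.
Qed.

Lemma Cexp_S (p : C) (y : R) : Cexp ((p + 1) * y) = (Cexp (p * y) * exp y)%C.
Proof.
  rewrite <- Cexp_RtoC, <- Cexp_plus. apply (f_equal Cexp); ring.
Qed.

Lemma kern_S s y : RtoC (kern (s + 1) y) = (kern s y / (1 + exp y)%R)%C.
Proof.
  rewrite kern_plus, kern_1, RtoC_mult, RtoC_inv; auto. pose proof (exp_pos y); lra.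
Qed.

(** Integration by parts for the incomplete beta integral, done by comparing derivatives. The same
    method with [p] kept fixed gives [Abeta_rec2]. *)
Lemma Abeta_rec1 F (p : C) s y : is_Gauss_2F1 F -> 0 < Re p -> 0 <= s ->
  (s * Abeta F (p + 1) (s + 1) y)%C = (p * Abeta F p s y - Cexp (p * y) * kern s y)%C.
Proof.
  intros HF Hp Hs.
  assert (Hp1 : 0 < Re (p + 1)%C) by (change (0 < Re p + 1); lra).
  assert (Z := vanishes_const (fun y => s * Abeta F (p + 1) (s + 1) y + ((- p) * Abeta F p s y
     + 1 * (Cexp (p * y) * kern s y)))%C).
  rewrite <- (Cplus_0_l (p * Abeta F p s y - _)%C), <- (Z) with (y := y); [ring| |].
  - apply vanishes_plus; [now apply vanishes_scal, vanishes_Abeta|].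
    apply vanishes_plus; [now apply vanishes_scal, vanishes_Abeta|].
    now apply vanishes_scal, vanishes_dens.
  - intros t. eapply is_Cderive_eq.
    + apply is_Cderive_plus; [apply is_Cderive_scal, is_Cderive_Abeta; auto|].
      apply is_Cderive_plus; [apply is_Cderive_scal, is_Cderive_Abeta; auto|].
      apply is_Cderive_scal, is_Cderive_dens.
    + rewrite Cexp_S, kern_S. pose proof (exp_pos t).
      assert (RtoC (1 + exp t) <> 0) by (apply RtoC_nz; lra).
      rewrite RtoC_div by lra. cfield; auto.
Qed.

Lemma Abeta_rec2 F (p : C) s y : is_Gauss_2F1 F -> 0 < Re p -> 0 <= s ->
  (s * Abeta F p (s + 1) y)%C = ((s - p) * Abeta F p s y + Cexp (p * y) * kern s y)%C.
Proof.
  intros HF Hp Hs.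
  assert (Z := vanishes_const (fun y => s * Abeta F p (s + 1) y + ((- (s - p)) * Abeta F p s y
     + (-1) * (Cexp (p * y) * kern s y)))%C).
  rewrite <- (Cplus_0_l ((s - p) * Abeta F p s y + _)%C), <- (Z) with (y := y); [ring| |].
  - apply vanishes_plus; [now apply vanishes_scal, vanishes_Abeta|].
    apply vanishes_plus; [now apply vanishes_scal, vanishes_Abeta|].
    now apply vanishes_scal, vanishes_dens.
  - intros t. eapply is_Cderive_eq.
    + apply is_Cderive_plus; [apply is_Cderive_scal, is_Cderive_Abeta; auto|].
      apply is_Cderive_plus; [apply is_Cderive_scal, is_Cderive_Abeta; auto|].
      apply is_Cderive_scal, is_Cderive_dens.
    + rewrite kern_S. pose proof (exp_pos t).
      assert (N : RtoC (1 + exp t) <> 0) by (apply RtoC_nz; lra).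
      rewrite RtoC_div by lra. rewrite RtoC_plus in *. cfield; auto.
Qed.

(** Euler's beta integral of [e^(p y) (1 + e^y)^(-s)] over the whole line, cut at 0, with the right
    half folded over by [y -> - y], which replaces [p] by [s - p]. *)
Definition beta (F : C -> C -> C -> C -> C) (p : C) (s : R) : C :=
  (Abeta F p s 0 + Abeta F (s - p) s 0)%C.

Lemma kern_opp s y : kern s (- y) = exp (s * y) * kern s y.
Proof.
  unfold kern; rewrite <- exp_plus; f_equal.
  pose proof (exp_pos y).
  replace (1 + exp (- y)) with ((1 + exp y) * exp (- y)).
  - rewrite ln_mult, ln_exp by (try apply exp_pos; lra). ring.
  - rewrite Rmult_plus_distr_r, <- exp_plus, Rplus_opp_r, exp_0; ring.
Qed.

Lemma Abeta_reflection F (p : C) s y : is_Gauss_2F1 F -> 0 < Re p < s ->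
  (Abeta F p s y + Abeta F (s - p) s (- y))%C = beta F p s.
Proof.
  intros HF Hp; unfold beta. rewrite <- Ropp_0 at 2.
  apply (Cderive_zero_const (fun y => Abeta F p s y + Abeta F (s - p) s (- y))%C).
  intros t; eapply is_Cderive_eq.
  - apply is_Cderive_plus; [apply is_Cderive_Abeta; auto; lra|].
    apply (is_Cderive_comp (Abeta F (s - p) s) Ropp).
    + apply is_Cderive_Abeta; auto. change (0 < s - Re p); lra.
    + apply is_derive_Ropp, (is_derive_id (K := R_AbsRing)).
  - rewrite kern_opp, RtoC_mult, <- (Cexp_RtoC (s * t)).
    change (one (K := R_AbsRing)) with 1.
    replace (Cexp (p * t)) with (Cexp ((s - p) * (- t)%R) * Cexp (s * t)%R)%C.
    + rewrite (RtoC_opp 1); ring.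
    + rewrite <- Cexp_plus. apply (f_equal Cexp). rewrite RtoC_mult, RtoC_opp; ring.
Qed.

(** Both arguments [p] and [s - p] rise by 1, which is the effect of [(alpha_1 + 1, alpha_2 + 1)].
    Each of the two recursions of [Abeta] is used on both halves, where the boundary terms at 0
    cancel. *)
Lemma beta_rec F (p : C) s : is_Gauss_2F1 F -> 0 < Re p < s ->
  (s * (s + 1) * beta F (p + 1) (s + 1 + 1))%C = (p * (s - p) * beta F p s)%C.
Proof.
  intros HF Hp.
  assert (Hq : 0 < Re (s - p)%C) by (change (0 < s - Re p); lra).
  assert (E1 : (s * beta F (p + 1) (s + 1))%C = (p * beta F p s)%C).
  { unfold beta. replace (RtoC (s + 1) - (p + 1))%C with (s - p)%C by (rewrite RtoC_plus; ring).
    rewrite !Cmult_plus_distr_l, Abeta_rec1, (Abeta_rec2 F (s - p)%C) by (auto; lra).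
    replace ((s - p) * 0)%C with (p * 0)%C by ring. ring. }
  assert (E2 : ((s + 1) * beta F (p + 1) (s + 1 + 1))%C = ((s - p) * beta F (p + 1) (s + 1))%C).
  { unfold beta.
    assert (Hp1 : 0 < Re (p + 1)%C) by (change (0 < Re p + 1); lra).
    replace (RtoC (s + 1 + 1) - (p + 1))%C with (s - p + 1)%C by (rewrite !RtoC_plus; ring).
    replace (RtoC (s + 1) - (p + 1))%C with (s - p)%C by (rewrite RtoC_plus; ring).
    rewrite <- RtoC_plus.
    rewrite !Cmult_plus_distr_l, Abeta_rec2, (Abeta_rec1 F (s - p)%C) by (auto; lra).
    replace (RtoC (s + 1) - (p + 1))%C with (s - p)%C by (rewrite RtoC_plus; ring).
    replace ((p + 1) * 0)%C with ((s - p) * 0)%C by ring. ring. }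
  replace (s * (s + 1) * beta F (p + 1) (s + 1 + 1))%C with (s * ((s + 1) * beta F (p + 1) (s + 1 + 1)))%C by ring.
  rewrite E2.
  replace (s * ((s - p) * beta F (p + 1) (s + 1)))%C with ((s - p) * (s * beta F (p + 1) (s + 1)))%C by ring.
  rewrite E1; ring.
Qed.

(** [kern s] decreases, so replacing it by its value at [y] lowers the integral from -oo to [y], and
    the remaining exponential integrates to [e^(p y) / p]. *)
Lemma Abeta_lower F (p s y : R) : is_Gauss_2F1 F -> 0 < p -> 0 <= s ->
  exp (p * y) * kern s y <= p * Re (Abeta F p s y).
Proof.
  intros HF Hp Hs.
  apply Rnot_lt_le; intros L.
  set (e := exp (p * y) * kern s y - p * Re (Abeta F p s y)). assert (He : 0 < e) by (unfold e; lra).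
  destruct (vanishes_small _ (e / (2 * p)) (vanishes_Abeta F p s HF Hp)) as [y0 H0].
  { apply Rdiv_lt_0_compat; lra. }
  destruct (exp_small p (kern s y) (e / 4) Hp ltac:(lra)) as [y1 H1].
  (* At [y2] the exponential contributes at most [e / 4] and the incomplete beta function at most
     [e / 2], together less than the supposed gap [e]. *)
  set (y2 := Rmin (Rmin y0 y1) y).
  assert (Hy2 : y2 <= y0 /\ y2 <= y1 /\ y2 <= y).
  { unfold y2. pose proof (Rmin_l (Rmin y0 y1) y); pose proof (Rmin_r (Rmin y0 y1) y).
    pose proof (Rmin_l y0 y1); pose proof (Rmin_r y0 y1). lra. }
  assert (I := derive_le_incr (fun t => kern s y * exp (p * t)) (fun t => kern s y * (p * exp (p * t)))
    (fun t => p * Re (Abeta F p s t)) (fun t => p * (exp (p * t) * kern s t)) y2 y).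
  assert (K : kern s y * exp (p * y) - kern s y * exp (p * y2) <=
     p * Re (Abeta F p s y) - p * Re (Abeta F p s y2)).
  { apply I; [lra| | |].
    - intros t _. auto_derive; auto; ring.
    - intros t _. apply is_derive_scal. eapply is_derive_eq.
      + exact (proj1 (is_Cderive_Abeta F p s t HF Hp)).
      + rewrite <- RtoC_mult, Cexp_RtoC, <- RtoC_mult. reflexivity.
    - intros t Ht.
      assert (kern s y <= kern s t).
      { unfold kern; apply exp_le.
        assert (ln (1 + exp t) <= ln (1 + exp y)); [|nra].
        pose proof (exp_pos t). apply ln_le; [lra|]. pose proof (exp_le t y); lra. }
      pose proof (exp_pos (p * t)).
      replace (kern s y * (p * exp (p * t))) with (p * (exp (p * t) * kern s y)) by ring.
      apply Rmult_le_compat_l; [lra|]. apply Rmult_le_compat_l; lra. }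
  specialize (H1 y2 ltac:(lra)). specialize (H0 y2 ltac:(lra)).
  pose proof (re_le_Cmod (Abeta F p s y2)) as Q.
  assert (Q2 : Rabs (Re (Abeta F p s y2)) <= e / (2 * p)) by lra.
  apply Rabs_le_between in Q2.
  assert (p * Re (Abeta F p s y2) >= - (e / 2)).
  { replace (- (e / 2)) with (p * - (e / (2 * p))) by (field; lra). apply Rle_ge, Rmult_le_compat_l; lra. }
  unfold e in *. lra.
Qed.

Lemma beta_lower F (p s y : R) : is_Gauss_2F1 F -> 0 < p < s ->
  exp (p * y) * kern s y <= p * Cmod (beta F p s).
Proof.
  intros HF Hp.
  rewrite <- (Abeta_reflection F p s y HF Hp).
  pose proof (Abeta_lower F p s y HF ltac:(lra) ltac:(lra)) as L1.
  pose proof (Abeta_lower F (s - p) s (- y) HF ltac:(lra) ltac:(lra)) as L2.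
  rewrite RtoC_minus in L2.
  pose proof (exp_pos ((s - p) * - y)). pose proof (kern_pos s (- y)).
  assert (0 <= Re (Abeta F (s - p)%C s (- y))) by nra.
  pose proof (re_le_Cmod (Abeta F p s y + Abeta F (s - p) s (- y))%C) as R.
  pose proof (Rle_abs (Re (Abeta F p s y + Abeta F (s - p) s (- y))%C)) as R2.
  change (Re (Abeta F p s y + Abeta F (s - p) s (- y))%C)
    with (Re (Abeta F p s y) + Re (Abeta F (s - p)%C s (- y))) in *.
  eapply Rle_trans; [exact L1|]. apply Rmult_le_compat_l; lra.
Qed.

(** * A comparison principle *)

Definition Lop (a1 a2 x v dv : R) : R :=
  v + (dv - v) / a2 - exp x * (v - (dv + 2 * v) / a1).

Definition CLop (a1 a2 x : R) (v dv : C) : C :=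
  (v + (dv - v) * (/ a2)%R - exp x * (v - (dv + 2 * v) * (/ a1)%R))%C.

(** Integrating factor of [Lop], whose reciprocal is a homogeneous solution. The shift by
    [ln (a2 / a1)] makes [e^y = (a2 / a1) e^x] the variable [z] of the Gauss functions. *)
Definition kint (a1 a2 x : R) : R :=
  exp ((a2 - 1) * (x + ln (a2 / a1))) * kern (a1 + a2 - 3) (x + ln (a2 / a1)).

Lemma kint_pos a1 a2 x : 0 < kint a1 a2 x.
Proof. apply Rmult_lt_0_compat; [apply exp_pos|apply kern_pos]. Qed.

Lemma exp_shift a1 a2 x : 0 < a1 -> 0 < a2 -> exp (x + ln (a2 / a1)) = a2 / a1 * exp x.
Proof.
  intros H1 H2. rewrite exp_plus, exp_ln; [ring|]. now apply Rdiv_lt_0_compat.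
Qed.

Lemma is_derive_kint a1 a2 x : is_derive (kint a1 a2) x
  (kint a1 a2 x * ((a2 - 1) - (a1 + a2 - 3) * (exp (x + ln (a2 / a1)) / (1 + exp (x + ln (a2 / a1)))))).
Proof.
  unfold kint. set (l := ln (a2 / a1)).
  eapply is_derive_eq.
  - apply Derive.is_derive_mult.
    + instantiate (1 := (a2 - 1) * exp ((a2 - 1) * (x + l))). auto_derive; auto; ring.
    + apply (is_derive_Rcomp (kern (a1 + a2 - 3)) (fun x => x + l)); [apply is_derive_kern|].
      instantiate (1 := 1). auto_derive; auto; ring.
  - cbv beta; match goal with |- @eq _ ?a ?b => change (@eq R a b) end; ring.
Qed.

(** The factor before [Lop] is positive, so a sign of [Lop] makes [V * kint] monotone; the
    comparison principle rests on this alone. *)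
Lemma is_derive_kint_mult a1 a2 x V dV : 0 < a1 -> 0 < a2 -> is_derive V x dV ->
  is_derive (fun t => V t * kint a1 a2 t) x
    (a2 * kint a1 a2 x / (1 + a2 / a1 * exp x) * Lop a1 a2 x (V x) dV).
Proof.
  intros H1 H2 HV. eapply is_derive_eq.
  - apply Derive.is_derive_mult; [exact HV|apply is_derive_kint].
  - rewrite exp_shift by auto. unfold Lop. pose proof (exp_pos x).
    assert (0 < a2 / a1) by now apply Rdiv_lt_0_compat.
    assert (0 < a2 / a1 * exp x) by now apply Rmult_lt_0_compat.
    field. repeat split; try lra.
    replace (a1 + a2 * exp x) with (a1 * (1 + a2 / a1 * exp x)) by (field; lra).
    apply Rgt_not_eq, Rmult_lt_0_compat; lra.
Qed.

(** With [P = e^(-N x)], [E = e^x], [Q = e^(2 x)] and [G = e^(N + 2)], the operator gives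
    [P (1 - (N+1) v - E (1 + (N-2) u))] plus [(N+2) G Q ((1 - E) + v + 4 E u)]. Away from 0 the
    first part is bounded below by a multiple of [P]; near 0 it can be negative, but only of order
    [u + v], and the second part outweighs it. *)
Lemma supersolution a1 a2 N x : 0 <= N -> 4 * (N + 3) <= a1 -> 4 * (N + 3) <= a2 -> x <= 0 ->
  (1 / a1 + 1 / a2) / 2 * exp (- N * x) <=
  Lop a1 a2 x (exp (- N * x) + (N + 2) * exp (N + 2) * exp (2 * x))
    (- N * exp (- N * x) + (N + 2) * exp (N + 2) * (2 * exp (2 * x))).
Proof.
  intros HN H1 H2 Hx.
  set (u := / a1); set (v := / a2).
  assert (Hu : 0 < u <= 1 / (4 * (N + 3))).
  { unfold u; split; [apply Rinv_0_lt_compat; lra|]. unfold Rdiv; rewrite Rmult_1_l.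
    apply Rinv_le_contravar; lra. }
  assert (Hv : 0 < v <= 1 / (4 * (N + 3))).
  { unfold v; split; [apply Rinv_0_lt_compat; lra|]. unfold Rdiv; rewrite Rmult_1_l.
    apply Rinv_le_contravar; lra. }
  assert (HuN : u * (N + 3) <= 1 / 4).
  { apply Rle_trans with (1 / (4 * (N + 3)) * (N + 3)); [apply Rmult_le_compat_r; lra|].
    right; field; lra. }
  assert (HvN : v * (N + 3) <= 1 / 4).
  { apply Rle_trans with (1 / (4 * (N + 3)) * (N + 3)); [apply Rmult_le_compat_r; lra|].
    right; field; lra. }
  set (E := exp x). assert (HE : 0 < E <= 1).
  { unfold E; split; [apply exp_pos|rewrite <- exp_0; now apply exp_le]. }
  set (P := exp (- N * x)). assert (HP : 0 < P) by apply exp_pos.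
  set (Q := exp (2 * x)). assert (HQ : 0 < Q) by apply exp_pos.
  set (G := exp (N + 2)). assert (HG : 0 < G) by apply exp_pos.
  unfold Lop. fold E. unfold Rdiv. fold u v.
  replace (P + (N + 2) * G * Q + (- N * P + (N + 2) * G * (2 * Q) - (P + (N + 2) * G * Q)) * v -
    E * (P + (N + 2) * G * Q - (- N * P + (N + 2) * G * (2 * Q) + 2 * (P + (N + 2) * G * Q)) * u))
   with (P * (1 - (N + 1) * v - E * (1 + (N - 2) * u)) + (N + 2) * G * Q * ((1 - E) + v + 4 * E * u)) by ring.
  rewrite !Rmult_1_l.
  assert (T : 0 <= (1 - E) + v + 4 * E * u) by nra.
  assert (TT : 0 <= (N + 2) * G * Q * ((1 - E) + v + 4 * E * u)).
  { repeat apply Rmult_le_pos; lra. }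
  (* For [x <= -1] the first part is at least [P / 8], which exceeds the required [(u + v) / 2 * P]
     because [u] and [v] are at most [1 / 12]. *)
  destruct (Rle_lt_dec x (-1)) as [Hx1|Hx1].
  - assert (HE2 : E <= 1 / 2).
    { apply Rle_trans with (exp (-1)); [now apply exp_le|].
      replace (-1) with (- (1)) by ring.
      rewrite exp_Ropp. replace (1 / 2) with (/ 2) by field. apply Rinv_le_contravar; [lra|].
      pose proof (exp_ineq_le 1); lra. }
    enough (P * (1 / 8) <= P * (1 - (N + 1) * v - E * (1 + (N - 2) * u))).
    { assert (u <= 1 / 12 /\ v <= 1 / 12) by nra. nra. }
    apply Rmult_le_compat_l; [lra|]. nra.
  - assert (HPb : P <= exp N).
    { unfold P; apply exp_le; nra. }
    assert (HQb : exp (-2) <= Q) by (unfold Q; apply exp_le; lra).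
    assert (HEb : 1 / 4 <= E).
    { apply Rle_trans with (exp (-1)); [|unfold E; apply exp_le; lra].
      replace (-1) with (- (1)) by ring.
      rewrite exp_Ropp. replace (1 / 4) with (/ 4) by field.
      apply Rinv_le_contravar; [apply exp_pos|]. pose proof exp_le_3; lra. }
    (* The constant [e^(N + 2)] is chosen for this: on [[-1, 0]] it makes [G * Q] at least [e^N],
       hence at least [P]. The prefactor [N + 2] then beats [N + 1] with the margin needed in
       [S3]. *)
    assert (GN : G * exp (-2) = exp N) by (unfold G; rewrite <- exp_plus; f_equal; ring).
    assert (S1 : (N + 2) * exp N * (u + v) <= (N + 2) * G * Q * ((1 - E) + v + 4 * E * u)).
    { rewrite <- GN, <- Rmult_assoc. pose proof (exp_pos (-2)).
      assert (0 <= (N + 2) * G) by (apply Rmult_le_pos; lra).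
      apply Rmult_le_compat; [apply Rmult_le_pos; lra|lra|now apply Rmult_le_compat_l|].
      assert (u <= 4 * E * u) by nra. lra. }
    assert (S2 : - (P * ((N + 1) * (u + v))) <= P * (1 - (N + 1) * v - E * (1 + (N - 2) * u))).
    { rewrite <- Ropp_mult_distr_r_reverse. apply Rmult_le_compat_l; [lra|].
      assert (0 <= (1 - E) * (u * (N + 1))) by (repeat apply Rmult_le_pos; lra).
      assert (0 <= E * u) by (apply Rmult_le_pos; lra).
      lra. }
    assert (S3 : P * ((N + 1) * (u + v)) + (u + v) * / 2 * P <= (N + 2) * exp N * (u + v)).
    { replace (P * ((N + 1) * (u + v)) + (u + v) * / 2 * P) with (P * ((u + v) * (N + 3 / 2))) by field.
      replace ((N + 2) * exp N * (u + v)) with (exp N * ((u + v) * (N + 2))) by ring.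
      assert (0 <= (u + v) * N) by (apply Rmult_le_pos; lra).
      apply Rmult_le_compat; [lra| |lra|]; lra. }
    lra.
Qed.

(* Near [x = 0] the operator is positive only on increasing functions, whence the [e^(2 x)] term. *)
Definition barrier (N x : R) : R := exp (- N * x) + (N + 2) * exp (N + 2) * exp (2 * x).

Lemma barrier_pos N x : 0 <= N -> 0 < barrier N x.
Proof.
  intros HN; unfold barrier.
  pose proof (exp_pos (- N * x)); pose proof (exp_pos (2 * x)); pose proof (exp_pos (N + 2)).
  assert (0 < (N + 2) * exp (N + 2) * exp (2 * x)) by (repeat apply Rmult_lt_0_compat; lra). lra.
Qed.

(** If [m * barrier + E] or [m * barrier - E] were negative at [x], its product with [kint], being
    nondecreasing, would stay below a fixed negative number at all points to the left, against the
    smallness of [E * kint] there. *)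
Lemma comparison_real a1 a2 N kap (E dE : R -> R) :
  0 <= N -> 4 * (N + 3) <= a1 -> 4 * (N + 3) <= a2 -> 0 <= kap ->
  (forall x, x <= 0 -> is_derive E x (dE x)) ->
  (forall x, x <= 0 -> Rabs (Lop a1 a2 x (E x) (dE x)) <= kap * exp (- N * x)) ->
  (forall e x, 0 < e -> exists y, y <= x /\ Rabs (E y) * kint a1 a2 y <= e) ->
  forall x, x <= 0 -> Rabs (E x) <= 2 * kap / (1 / a1 + 1 / a2) * barrier N x.
Proof.
  intros HN H1 H2 Hk HD HL HV x Hx.
  set (eps := 1 / a1 + 1 / a2).
  assert (He : 0 < eps).
  { unfold eps. apply Rplus_lt_0_compat; apply Rdiv_lt_0_compat; lra. }
  (* [supersolution] yields only [eps / 2] times the exponential, so dominating [kap] requires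
     division by [eps]. *)
  set (m := 2 * kap / eps). assert (Hm : 0 <= m) by (apply Rdiv_le_0_compat; lra).
  assert (HB := fun t => barrier_pos N t HN).
  assert (key : forall sg, Rabs sg = 1 -> 0 <= m * barrier N x + sg * E x).
  { intros sg Hsg. pose proof (kint_pos a1 a2 x) as K.
    apply Rnot_lt_le; intros L.
    set (g := - (m * barrier N x + sg * E x) * kint a1 a2 x).
    assert (Hg : 0 < g) by (unfold g; nra).
    destruct (HV (g / 2) x ltac:(lra)) as (y & Hy & Hy2).
    assert (I : (m * barrier N y + sg * E y) * kint a1 a2 y <= (m * barrier N x + sg * E x) * kint a1 a2 x).
    { apply (derive_nonneg_incr (fun t => (m * barrier N t + sg * E t) * kint a1 a2 t)
       (fun t => a2 * kint a1 a2 t / (1 + a2 / a1 * exp t) * Lop a1 a2 t (m * barrier N t + sg * E t)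
         (m * (- N * exp (- N * t) + (N + 2) * exp (N + 2) * (2 * exp (2 * t))) + sg * dE t)) y x Hy).
      - intros t Ht. apply (is_derive_kint_mult a1 a2 t (fun t => m * barrier N t + sg * E t)); try lra.
        apply is_derive_Rplus; apply is_derive_scal.
        + unfold barrier. auto_derive; auto; ring.
        + apply HD; lra.
      - intros t Ht. pose proof (kint_pos a1 a2 t). pose proof (exp_pos t).
        assert (0 < a2 / a1) by (apply Rdiv_lt_0_compat; lra).
        assert (0 < a2 / a1 * exp t) by now apply Rmult_lt_0_compat.
        apply Rmult_le_pos; [apply Rdiv_le_0_compat; [apply Rmult_le_pos|]; lra|].
        set (dB := - N * exp (- N * t) + (N + 2) * exp (N + 2) * (2 * exp (2 * t))).
        replace (Lop a1 a2 t (m * barrier N t + sg * E t) (m * dB + sg * dE t))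
          with (m * Lop a1 a2 t (barrier N t) dB + sg * Lop a1 a2 t (E t) (dE t)) by (unfold Lop; field; lra).
        pose proof (supersolution a1 a2 N t HN H1 H2 ltac:(lra)) as S.
        fold (barrier N t) in S. fold dB in S. fold eps in S.
        specialize (HL t ltac:(lra)).
        assert (S' : kap * exp (- N * t) <= m * Lop a1 a2 t (barrier N t) dB).
        { apply Rle_trans with (m * (eps / 2 * exp (- N * t))); [|apply Rmult_le_compat_l; auto].
          right; unfold m; field; lra. }
        assert (Rabs (sg * Lop a1 a2 t (E t) (dE t)) <= kap * exp (- N * t)).
        { rewrite Rabs_mult, Hsg; lra. }
        pose proof (Rle_abs (- (sg * Lop a1 a2 t (E t) (dE t)))) as Q. rewrite Rabs_Ropp in Q. lra. }
    assert (J : - (g / 2) <= (m * barrier N y + sg * E y) * kint a1 a2 y).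
    { pose proof (kint_pos a1 a2 y). specialize (HB y).
      assert (0 <= m * barrier N y * kint a1 a2 y) by (apply Rmult_le_pos; [apply Rmult_le_pos|]; lra).
      assert (Rabs (sg * E y * kint a1 a2 y) <= g / 2).
      { rewrite !Rabs_mult, Hsg, Rmult_1_l, (Rabs_pos_eq (kint a1 a2 y)); lra. }
      pose proof (Rle_abs (- (sg * E y * kint a1 a2 y))) as Q. rewrite Rabs_Ropp in Q. lra. }
    unfold g in *. lra. }
  apply Rabs_le. pose proof (key 1 Rabs_R1) as K1.
  pose proof (key (-1) ltac:(rewrite Rabs_left; lra)) as K2. lra.
Qed.

Lemma comparison_left a1 a2 N kap (E dE : R -> C) :
  0 <= N -> 4 * (N + 3) <= a1 -> 4 * (N + 3) <= a2 -> 0 <= kap ->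
  (forall x, x <= 0 -> is_Cderive E x (dE x)) ->
  (forall x, x <= 0 -> Cmod (CLop a1 a2 x (E x) (dE x)) <= kap * exp (- N * x)) ->
  (forall e x, 0 < e -> exists y, y <= x /\ Cmod (E y) * kint a1 a2 y <= e) ->
  forall x, x <= 0 -> Cmod (E x) <= 4 * kap / (1 / a1 + 1 / a2) * barrier N x.
Proof.
  intros HN H1 H2 Hk HD HL HV x Hx.
  assert (P : forall p : C -> R, (forall z, Rabs (p z) <= Cmod z) ->
    (forall x, x <= 0 -> is_derive (fun t => p (E t)) x (p (dE x))) ->
    (forall x v dv, p (CLop a1 a2 x v dv) = Lop a1 a2 x (p v) (p dv)) ->
    Rabs (p (E x)) <= 2 * kap / (1 / a1 + 1 / a2) * barrier N x).
  { intros p Hp HpD HpL. apply (comparison_real a1 a2 N kap (fun t => p (E t)) (fun t => p (dE t))); auto.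
    - intros t Ht. rewrite <- HpL. eapply Rle_trans; [apply Hp|auto].
    - intros e t He. destruct (HV e t He) as (y & Hy & Hy2). exists y; split; auto.
      eapply Rle_trans; [|exact Hy2]. apply Rmult_le_compat_r; auto. apply Rlt_le, kint_pos. }
  eapply Rle_trans; [apply Cmod_le_Re_Im|].
  pose proof (P Re re_le_Cmod (fun t Ht => proj1 (HD t Ht))) as P1.
  pose proof (P Im im_le_Cmod (fun t Ht => proj2 (HD t Ht))) as P2.
  replace (4 * kap / (1 / a1 + 1 / a2) * barrier N x)
    with (2 * kap / (1 / a1 + 1 / a2) * barrier N x + 2 * kap / (1 / a1 + 1 / a2) * barrier N x)
    by (unfold Rdiv; ring).
  apply Rplus_le_compat; [apply P1|apply P2]; intros; unfold CLop, Lop, Re, Im; simpl; unfold Rdiv; ring.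
Qed.

Lemma kint_mirror a1 a2 x : 0 < a1 -> 0 < a2 ->
  kint a2 a1 (- x) = a1 / a2 * exp (- x) * kint a1 a2 x.
Proof.
  intros H1 H2. unfold kint.
  replace (ln (a1 / a2)) with (- ln (a2 / a1)).
  2:{ rewrite <- ln_Rinv by now apply Rdiv_lt_0_compat. f_equal; field; lra. }
  set (l := ln (a2 / a1)).
  replace (- x + - l) with (- (x + l)) by ring.
  rewrite kern_opp.
  replace (a2 + a1 - 3) with (a1 + a2 - 3) by ring.
  replace (a1 / a2) with (exp (- l)).
  2:{ unfold l; rewrite exp_Ropp, exp_ln by now apply Rdiv_lt_0_compat. field; lra. }
  rewrite <- !Rmult_assoc, <- !exp_plus. f_equal. f_equal. ring.
Qed.

(** [t -> e^(-t) E(-t)] turns [CLop a1 a2] at [- t] into [- CLop a2 a1] at [t]. The weight also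
    matches the factor [e^(-x)] in [kint_mirror]; it is at least 1 for [t <= 0] and is dropped at
    the end. *)
Lemma comparison_right a1 a2 N kap (E dE : R -> C) :
  0 <= N -> 4 * (N + 3) <= a1 -> 4 * (N + 3) <= a2 -> 0 <= kap ->
  (forall x, 0 <= x -> is_Cderive E x (dE x)) ->
  (forall x, 0 <= x -> Cmod (CLop a1 a2 x (E x) (dE x)) <= kap * exp (N * x)) ->
  (forall e x, 0 < e -> exists y, x <= y /\ Cmod (E y) * kint a1 a2 y <= e) ->
  forall x, 0 <= x -> Cmod (E x) <= 4 * kap / (1 / a1 + 1 / a2) * barrier N (- x).
Proof.
  intros HN H1 H2 Hk HD HL HV x Hx.
  assert (I := comparison_left a2 a1 N kap (fun t => exp (- t) * E (- t)%R)%C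
    (fun t => - (exp (- t) * (E (- t)%R + dE (- t)%R)))%C HN H2 H1 Hk).
  cbv beta in I.
  assert (Q : Cmod (exp (- - x) * E (- - x)%R) <= 4 * kap / (1 / a2 + 1 / a1) * barrier N (- x)).
  { apply I; [| | |lra].
    - intros t Ht. eapply is_Cderive_eq.
      + apply is_Cderive_mult.
        * apply (is_Cderive_RtoC (fun t => exp (- t)) t (- exp (- t))).
          auto_derive; auto; ring.
        * apply (is_Cderive_comp E Ropp); [apply HD; lra|].
          apply is_derive_Ropp, (is_derive_id (K := R_AbsRing)).
      + change (one (K := R_AbsRing)) with 1. rewrite !RtoC_opp. ring.
    - intros t Ht.
      replace (CLop a2 a1 t (exp (- t) * E (- t)%R) (- (exp (- t) * (E (- t)%R + dE (- t)%R))))%C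
        with (- CLop a1 a2 (- t) (E (- t)%R) (dE (- t)%R))%C.
      + rewrite Cmod_opp. eapply Rle_trans; [apply HL; lra|]. right; f_equal; f_equal; ring.
      + unfold CLop.
        assert (Z : (exp t * exp (- t) = RtoC 1)%C).
        { rewrite <- RtoC_mult, <- exp_plus, Rplus_opp_r, exp_0; auto. }
        set (e := E (- t)%R). set (d := dE (- t)%R). set (u := RtoC (/ a1)). set (v := RtoC (/ a2)).
        replace (exp t * (exp (- t) * e - (- (exp (- t) * (e + d)) + 2 * (exp (- t) * e)) * v))%C
          with ((exp t * exp (- t)) * (e - (- (e + d) + 2 * e) * v))%C by ring.
        rewrite Z. ring.
    - intros e t He.
      destruct (HV (e * (a2 / a1)) (- t)) as (y & Hy & Hy2).
      { apply Rmult_lt_0_compat; auto. apply Rdiv_lt_0_compat; lra. }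
      exists (- y); split; [lra|].
      rewrite Cmod_mult, Cmod_R, Rabs_pos_eq by apply Rlt_le, exp_pos.
      rewrite Ropp_involutive, kint_mirror by lra.
      replace (exp y * Cmod (E y) * (a1 / a2 * exp (- y) * kint a1 a2 y))
        with ((exp y * exp (- y)) * (Cmod (E y) * kint a1 a2 y) * (a1 / a2)) by ring.
      rewrite <- exp_plus, Rplus_opp_r, exp_0, Rmult_1_l.
      apply Rle_trans with (e * (a2 / a1) * (a1 / a2)); [|right; field; lra].
      apply Rmult_le_compat_r; auto. apply Rdiv_le_0_compat; lra. }
  rewrite Ropp_involutive, Cmod_mult, Cmod_R, Rabs_pos_eq in Q by apply Rlt_le, exp_pos.
  rewrite (Rplus_comm (1 / a1)).
  pose proof (exp_ge_1 x Hx). pose proof (Cmod_ge_0 (E x)). nra.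
Qed.

(** * Uniqueness of analytic continuation *)

Lemma is_Cpseries_unique a (w l m : C) : is_Cpseries a w l -> is_Cpseries a w m -> l = m.
Proof.
  intros H1 H2.
  replace w with (1 * w)%C in H1, H2 by ring.
  apply is_Cpseries_line in H1, H2. destruct H1 as [A B], H2 as [A' B'].
  apply C_ext.
  - apply is_pseries_unique in A, A'. congruence.
  - apply is_pseries_unique in B, B'. congruence.
Qed.

Lemma is_Cpseries_zero a (w l : C) : is_Cpseries a w l -> (forall n, a n = 0) -> l = 0.
Proof.
  intros H Z. replace w with (1 * w)%C in H by ring.
  apply is_Cpseries_line in H. destruct H as [A B].
  apply is_pseries_unique in A, B. apply C_ext.
  - rewrite <- A, (PSeries_ext _ (fun _ => 0)), PSeries_const_0; auto.
    intros n; rewrite Z; unfold Re; simpl; ring.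
  - rewrite <- B, (PSeries_ext _ (fun _ => 0)), PSeries_const_0; auto.
    intros n; rewrite Z; unfold Im; simpl; ring.
Qed.

Lemma is_Cpseries_minus a b (w l m : C) : is_Cpseries a w l -> is_Cpseries b w m ->
  is_Cpseries (fun n => a n - b n)%C w (l - m)%C.
Proof. apply (is_pseries_minus (K := C_AbsRing) (V := C_NormedModule)). Qed.

Definition agree_near (f g : C -> C) (w0 : C) : Prop :=
  exists r, 0 < r /\ forall w : C, Cmod (w - w0) < r -> f w = g w.

(** At each point of the segment the difference of the two local series vanishes on the side already
    covered, so all its coefficients are 0 and agreement holds in a full disc. Working with discs
    rather than points of the segment allows the path to turn afterwards. *)
Lemma agree_near_segment (f g : C -> C) (w0 w1 : C) : w0 <> w1 ->
  (forall s : R, 0 <= s <= 1 -> analytic_at f (w0 + s * (w1 - w0))%C /\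
     analytic_at g (w0 + s * (w1 - w0))%C) ->
  agree_near f g w0 -> agree_near f g w1.
Proof.
  intros Hne Han (r0 & Hr0 & H0).
  set (e := (w1 - w0)%C).
  assert (He0 : e <> 0).
  { intros Z; apply Hne. replace w1 with (e + w0)%C by (unfold e; ring). rewrite Z; ring. }
  assert (He : 0 < Cmod e) by now apply Cmod_gt_0.
  set (gam := fun s : R => (w0 + s * e)%C).
  assert (Hgam : forall s t : R, Cmod (gam s - gam t) = Rabs (s - t) * Cmod e).
  { intros s t. unfold gam.
    replace (w0 + s * e - (w0 + t * e))%C with (RtoC (s - t) * e)%C by (rewrite RtoC_minus; ring).
    now rewrite Cmod_mult, Cmod_R. }
  assert (Hball : forall s r, 0 < r -> (forall w, Cmod (w - gam s) < r -> f w = g w) ->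
     forall t, Rabs (t - s) < r / Cmod e -> agree_near f g (gam t)).
  { intros s r Hr H t Ht. exists (r - Cmod (gam t - gam s)). rewrite Hgam.
    assert (Rabs (t - s) * Cmod e < r).
    { apply Rmult_lt_reg_r with (/ Cmod e); [now apply Rinv_0_lt_compat|].
      rewrite Rmult_assoc, Rinv_r, Rmult_1_r by lra. exact Ht. }
    split; [lra|]. intros w Hw; apply H.
    replace (w - gam s)%C with ((w - gam t) + (gam t - gam s))%C by ring.
    eapply Rle_lt_trans; [apply Cmod_triangle|]. rewrite Hgam; lra. }
  replace w1 with (gam 1) by (unfold gam, e; ring).
  apply (continuous_induction (fun s => agree_near f g (gam s)) 1); [| |lra].
  - exists (r0 / Cmod e); split; [now apply Rdiv_lt_0_compat|].
    intros t Ht. apply (Hball 0 r0); auto.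
    + intros w Hw; apply H0. replace (gam 0) with w0 in Hw by (unfold gam; ring). exact Hw.
    + rewrite Rminus_0_r, Rabs_pos_eq; lra.
  - intros s Hs Hprev.
    destruct (Han s ltac:(lra)) as [(a & r1 & H1) (b & r2 & H2)].
    fold e in H1, H2. fold (gam s) in H1, H2.
    set (r := Rmin r1 r2).
    assert (Hr : 0 < r) by (apply Rmin_glb_lt; [apply r1|apply r2]).
    assert (Hd : forall w, Cmod (w - gam s) < r -> is_Cpseries (fun n => a n - b n)%C (w - gam s)%C (f w - g w)%C).
    { intros w Hw. apply is_Cpseries_minus; [apply H1|apply H2];
        (eapply Rlt_le_trans; [exact Hw|]); [apply Rmin_l|apply Rmin_r]. }
    assert (L : forall h, Rabs h < r / Cmod e ->
      is_Cpseries (fun n => a n - b n)%C (h * e)%C (f (gam (s + h)%R) - g (gam (s + h)%R))%C).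
    { intros h Hh. replace (h * e)%C with (gam (s + h)%R - gam s)%C
        by (unfold gam; rewrite RtoC_plus; ring).
      apply Hd. rewrite Hgam. replace (s + h - s) with h by ring.
      apply Rmult_lt_reg_r with (/ Cmod e); [now apply Rinv_0_lt_compat|].
      rewrite Rmult_assoc, Rinv_r, Rmult_1_r by lra. exact Hh. }
    assert (Hre : 0 < r / Cmod e) by now apply Rdiv_lt_0_compat.
    assert (Z : forall h, - s < h < 0 -> (f (gam (s + h)%R) - g (gam (s + h)%R))%C = 0).
    { intros h Hh. destruct (Hprev (s + h) ltac:(lra)) as (r' & Hr' & H').
      rewrite H'; [ring|]. replace (gam (s + h)%R - gam (s + h)%R)%C with (RtoC 0) by ring.
      now rewrite Cmod_0. }
    assert (Zc : forall n, (a n - b n)%C = 0).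
    { intros n.
      assert (E : ((a n - b n) * e ^ n)%C = 0).
      { apply C_ext.
        - apply (rps_zero_coefs (fun n => Re ((a n - b n) * e ^ n)%C)
            (fun t => Re (f (gam t) - g (gam t))%C) s (r / Cmod e) s); auto; [lra| |].
          + intros h Hh; exact (proj1 (is_Cpseries_line _ h e _ (L h Hh))).
          + intros h Hh; now rewrite Z.
        - apply (rps_zero_coefs (fun n => Im ((a n - b n) * e ^ n)%C)
            (fun t => Im (f (gam t) - g (gam t))%C) s (r / Cmod e) s); auto; [lra| |].
          + intros h Hh; exact (proj2 (is_Cpseries_line _ h e _ (L h Hh))).
          + intros h Hh; now rewrite Z. }
      pose proof (Cpow_nz e n He0).
      replace (a n - b n)%C with ((a n - b n) * e ^ n * / e ^ n)%C by (field; auto).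
      rewrite E; ring. }
    exists (r / Cmod e); split; auto.
    intros t Ht. apply (Hball s r); auto.
    + intros w Hw. pose proof (is_Cpseries_zero _ _ _ (Hd w Hw) Zc) as Q.
      replace (f w) with (f w - g w + g w)%C by ring. rewrite Q; ring.
    + apply Rabs_def1; lra.
Qed.

(** The broken line from 0 to [Ci] and on to [t] avoids the puncture for every real [t <> 1],
    including those beyond 1. *)
Lemma continuation_unique (a : nat -> C) (f g : C -> C) (t : R) :
  continues punctured_plane a f -> continues punctured_plane a g -> t <> 1 ->
  f t = g t.
Proof.
  intros [F1 F2] [G1 G2] Ht.
  assert (A0 : agree_near f g 0).
  { exists 1; split; [lra|]. intros w Hw. replace (w - 0)%C with w in Hw by ring.
    eapply is_Cpseries_unique; [now apply F1|now apply G1]. }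
  assert (A1 : agree_near f g Ci).
  { apply agree_near_segment with (RtoC 0); auto.
    - intros E. apply (f_equal Im) in E; simpl in E; lra.
    - intros s Hs.
      assert (P : punctured_plane (0 + s * (Ci - 0))%C).
      { intros E. apply (f_equal Re) in E; simpl in E; lra. }
      split; auto. }
  assert (A2 : agree_near f g t).
  { apply agree_near_segment with Ci; auto.
    - intros E. apply (f_equal Im) in E; simpl in E; lra.
    - intros s Hs.
      assert (P : punctured_plane (Ci + s * (t - Ci))%C).
      { intros E. assert (E1 := f_equal Re E). assert (E2 := f_equal Im E). simpl in E1, E2.
        assert (s = 1) by lra. subst s. lra. }
      split; auto. }
  destruct A2 as (r & Hr & H). apply H.
  replace (t - t)%C with (RtoC 0) by ring. now rewrite Cmod_0.
Qed.

(** * The incomplete Lerch transcendent at non-positive integers *)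

(* Continuation of [sum_k (k + om)^l (k+j choose j) w^k]. *)
Fixpoint lerch_sum (l j : nat) (om w : C) : C :=
  match l with
  | O => (/ (1 - w) ^ S j)%C
  | S i => ((INR j + 1) * lerch_sum i (S j) om w + (om - INR j - 1) * lerch_sum i j om w)%C
  end.

(** Uses [(k + om) C(k+j, j) = (j + 1) C(k+j+1, j+1) + (om - j - 1) C(k+j, j)]: a power of [k + om]
    is traded for a higher pole at 1. The explicit form is needed because [Lerch_neg] is only
    characterised by its continuation property. *)
Lemma continues_lerch_sum l j om :
  continues punctured_plane (fun k => ((INR k + om) ^ l * mbin j k)%C) (lerch_sum l j om).
Proof.
  revert j; induction l as [|l IH]; intros j.
  - eapply continues_ext; [|apply (continues_mbin j)]. intros k; simpl; ring.
  - eapply continues_ext;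
      [|apply (continues_lin _ _ _ _ _ (INR j + 1)%C (om - INR j - 1)%C (IH (S j)) (IH j))].
    intros k; cbn [mbin Cpow]. pose proof (pos_INR j).
    assert (N : RtoC (INR j + 1) <> 0) by (apply RtoC_nz; lra).
    rewrite RtoC_div, RtoC_mult, !RtoC_plus by lra.
    rewrite RtoC_plus in N. field; easy.
Qed.

Lemma Lerch_neg_eq l om (t : R) : t <> 1 -> Lerch_neg l om t = lerch_sum l 0 om t.
Proof.
  intros Ht. eapply continuation_unique; [apply Lerch_neg_spec| |exact Ht].
  eapply continues_ext; [|apply continues_lerch_sum]. intros k; simpl; ring.
Qed.

(** Formally the function is a sum of [(k + om)^l e^((k + om) x)], and differentiation brings down
    [k + om]. The closed form proves this on both sides of 0, beyond the convergence of the
    series. *)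
Lemma is_Cderive_lerch_sum l j (om : C) x : x <> 0 ->
  is_Cderive (fun x => Cexp (om * x) * lerch_sum l j om (exp x))%C x
    (Cexp (om * x) * lerch_sum (S l) j om (exp x))%C.
Proof.
  intros Hx.
  assert (Hx1 : 1 - exp x <> 0).
  { intros E. apply Hx. apply exp_inv. rewrite exp_0; lra. }
  assert (N : (1 - exp x)%C <> 0) by (rewrite <- RtoC_minus; now apply RtoC_nz).
  revert j; induction l as [|l IH]; intros j.
  - eapply is_Cderive_eq.
    + apply is_Cderive_mult; [apply is_Cderive_Cexp|].
      apply is_Cderive_ext_loc with (f := fun t => RtoC (/ (1 - exp t) ^ S j)) (d := mkposreal _ (Rabs_pos_lt _ Hx)).
      { intros t Ht; simpl in Ht; cbn [lerch_sum].
        assert (1 - exp t <> 0).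
        { intros E. assert (t = 0) by (apply exp_inv; rewrite exp_0; lra). subst t.
          rewrite Rminus_0_l, Rabs_Ropp in Ht; lra. }
        rewrite RtoC_inv by now apply pow_nonzero.
        rewrite RtoC_pow, RtoC_minus; auto. }
      apply (is_Cderive_RtoC (fun t => / (1 - exp t) ^ S j)).
      apply (is_derive_inv (fun t => (1 - exp t) ^ S j)); [|now apply pow_nonzero].
      apply (is_derive_pow (fun t => 1 - exp t) (S j)).
      apply is_derive_Rminus; [apply is_derive_Rconst|apply is_derive_exp].
    + cbn [lerch_sum]. simpl pred.
      assert (Hp : (1 - exp x) ^ j <> 0) by now apply pow_nonzero.
      replace (- (INR (S j) * (0 - exp x) * (1 - exp x) ^ j) / ((1 - exp x) ^ S j) ^ 2)
        with ((INR j + 1) * exp x * / ((1 - exp x) * ((1 - exp x) * (1 - exp x) ^ j)))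
        by (rewrite S_INR; simpl; field; auto).
      rewrite !RtoC_mult, !RtoC_inv, !RtoC_mult, RtoC_pow, RtoC_plus, RtoC_minus
        by (repeat apply Rmult_integral_contrapositive_currified; auto).
      rewrite !Cpow_S.
      pose proof (Cpow_nz _ j N). cfield; auto.
  - apply is_Cderive_ext with (fun x : R => (INR j + 1) * (Cexp (om * x) * lerch_sum l (S j) om (exp x)) +
      (om - INR j - 1) * (Cexp (om * x) * lerch_sum l j om (exp x)))%C.
    { intros t; cbn [lerch_sum]; ring. }
    eapply is_Cderive_eq; [apply is_Cderive_plus; apply is_Cderive_scal; apply IH|].
    cbn [lerch_sum]; ring.
Qed.

(* [lerch_fun nu x = (1 - e^(nu x)) / (1 - e^x)], made smooth at [x = 0]. *)
Definition lerch_fun (nu : C) (x : R) : C := (psi nu x * todd x)%C.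

Definition lerch_der (nu : C) (l : nat) (x : R) : C :=
  (Derive_n (fun x => Re (lerch_fun nu x)) l x, Derive_n (fun x => Im (lerch_fun nu x)) l x).

Lemma esmooth_lerch_fun nu :
  esmooth (fun x => Re (lerch_fun nu x)) /\ esmooth (fun x => Im (lerch_fun nu x)).
Proof.
  destruct (esmooth_psi nu) as [H1 H2]; pose proof esmooth_todd as H3.
  split.
  - apply esmooth_ext with (fun x => Re (psi nu x) * todd x).
    + intros x; unfold lerch_fun, Re, Im; simpl; ring.
    + now apply esmooth_mult.
  - apply esmooth_ext with (fun x => Im (psi nu x) * todd x).
    + intros x; unfold lerch_fun, Re, Im; simpl; ring.
    + now apply esmooth_mult.
Qed.

Lemma is_Cderive_lerch_der nu l x : is_Cderive (lerch_der nu l) x (lerch_der nu (S l) x).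
Proof.
  destruct (esmooth_lerch_fun nu) as [H1 H2].
  split; [apply (esmooth_is_derive _ x (esmooth_Derive_n _ l H1))|
          apply (esmooth_is_derive _ x (esmooth_Derive_n _ l H2))].
Qed.

Lemma lerch_fun_spec nu x : (lerch_der nu 0 x * (1 - exp x))%C = (1 - Cexp (nu * x))%C.
Proof.
  change (lerch_der nu 0 x) with (lerch_fun nu x). unfold lerch_fun.
  assert (E : (todd x * (1 - exp x))%C = (- RtoC x)%C).
  { rewrite <- RtoC_minus, <- RtoC_mult, <- RtoC_opp. apply f_equal.
    rewrite todd_inv_phi. pose proof (phi_spec x); pose proof (phi_pos x).
    replace (1 - exp x) with (- (x * phi x)) by lra. field; lra. }
  rewrite <- Cmult_assoc, E.
  replace (psi nu x * - x)%C with (- (x * psi nu x))%C by ring. rewrite psi_spec; ring.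
Qed.

Lemma lerch_der_eq nu l x : x <> 0 ->
  lerch_der nu l x = (lerch_sum l 0 0 (exp x) - Cexp (nu * x) * lerch_sum l 0 nu (exp x))%C.
Proof.
  revert x; induction l as [|l IH]; intros x Hx.
  - assert (Hx1 : 1 - exp x <> 0).
    { intros E. apply Hx. apply exp_inv. rewrite exp_0; lra. }
    assert (N : (1 - exp x)%C <> 0) by (rewrite <- RtoC_minus; now apply RtoC_nz).
    replace (lerch_der nu 0 x) with (lerch_der nu 0 x * (1 - exp x) / (1 - exp x))%C by (field; auto).
    rewrite lerch_fun_spec. cbn [lerch_sum Cpow]. field; auto.
  - apply is_Cderive_unique with (lerch_der nu l) x; [apply is_Cderive_lerch_der|].
    apply is_Cderive_ext_loc with (d := mkposreal _ (Rabs_pos_lt _ Hx))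
      (f := fun x : R => (Cexp (0 * x) * lerch_sum l 0 0 (exp x) - Cexp (nu * x) * lerch_sum l 0 nu (exp x))%C).
    { intros t Ht; simpl in Ht. rewrite IH.
      - rewrite Cmult_0_l, Cexp_0; ring.
      - intros E; subst t. rewrite Rminus_0_l, Rabs_Ropp in Ht; lra. }
    eapply is_Cderive_eq; [apply is_Cderive_minus; now apply is_Cderive_lerch_sum|].
    rewrite Cmult_0_l, Cexp_0; ring.
Qed.

(** Away from [Y = 1] this is [lerch_der_eq] at [ln Y]. At [Y = 1] the filled value is a limit, and
    [lerch_der], being continuous across 0, supplies it. *)
Lemma incLerch_neg_eq nu l (Y : R) : 0 < Y -> incLerch_neg l 0 nu Y = lerch_der nu l (ln Y).
Proof.
  intros HY.
  assert (K : forall t : R, 0 < t -> t <> 1 ->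
    (Lerch_neg l 0 t - Rcpow t nu * Lerch_neg l (0 + nu) t)%C = lerch_der nu l (ln t)).
  { intros t Ht Ht1. rewrite !Lerch_neg_eq, lerch_der_eq, exp_ln by
      (auto; intros E; apply Ht1; rewrite <- (exp_ln t Ht), E; apply exp_0).
    rewrite Cplus_0_l; reflexivity. }
  unfold incLerch_neg. destruct (Req_EM_T Y 1) as [->|H1]; [|now apply K].
  unfold CLim.
  assert (L : forall p : C -> R, (forall t, ex_derive (fun x => p (lerch_der nu l x)) t) ->
    Lim (fun t => p (Lerch_neg l 0 t - Rcpow t nu * Lerch_neg l (0 + nu) t)%C) 1 = p (lerch_der nu l (ln 1))).
  { intros p Hp. apply is_lim_unique.
    apply is_lim_ext_loc with (fun t => p (lerch_der nu l (ln t))).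
    - exists (mkposreal 1 Rlt_0_1); intros t Ht Ht1.
      rewrite K; auto. change (Rabs (t - 1) < 1) in Ht. apply Rabs_def2 in Ht; lra.
    - apply (is_lim_continuity (fun t => p (lerch_der nu l (ln t))) 1).
      apply continuity_pt_filterlim, (ex_derive_continuous (fun t => p (lerch_der nu l (ln t)))).
      destruct (Hp (ln 1)) as [d Hd].
      eexists; apply (is_derive_Rcomp (fun x => p (lerch_der nu l x)) ln); [exact Hd|].
      apply is_derive_ln; lra. }
  rewrite (L Re), (L Im); [reflexivity| |].
  - intros t; exists (Im (lerch_der nu (S l) t)); exact (proj2 (is_Cderive_lerch_der nu l t)).
  - intros t; exists (Re (lerch_der nu (S l) t)); exact (proj1 (is_Cderive_lerch_der nu l t)).
Qed.

Lemma lerch_der_bound nu l : exists M N, 0 <= M /\ 0 <= N /\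
  forall x, Cmod (lerch_der nu l x) <= M * exp (N * Rabs x).
Proof.
  destruct (esmooth_lerch_fun nu) as [H1 H2].
  destruct (esmooth_bounded _ (esmooth_Derive_n _ l H1)) as (M & N & HM & HN & H).
  destruct (esmooth_bounded _ (esmooth_Derive_n _ l H2)) as (M' & N' & HM' & HN' & H').
  exists (M + M'), (N + N'); repeat split; try lra.
  intros x. eapply Rle_trans; [apply Cmod_le_Re_Im|].
  specialize (H x); specialize (H' x). pose proof (Rabs_pos x).
  assert (exp (N * Rabs x) <= exp ((N + N') * Rabs x)) by (apply exp_le; nra).
  assert (exp (N' * Rabs x) <= exp ((N + N') * Rabs x)) by (apply exp_le; nra).
  assert (M * exp (N * Rabs x) <= M * exp ((N + N') * Rabs x)) by now apply Rmult_le_compat_l.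
  assert (M' * exp (N' * Rabs x) <= M' * exp ((N + N') * Rabs x)) by now apply Rmult_le_compat_l.
  change (Re (lerch_der nu l x)) with (Derive_n (fun x => Re (lerch_fun nu x)) l x).
  change (Im (lerch_der nu l x)) with (Derive_n (fun x => Im (lerch_fun nu x)) l x).
  lra.
Qed.

Lemma diffop_lerch_bound nu P : exists M N, 0 <= M /\ 0 <= N /\
  forall x, Cmod (diffop P (fun l => lerch_der nu l x)) <= M * exp (N * Rabs x).
Proof.
  assert (H : forall k, exists M N, 0 <= M /\ 0 <= N /\
    forall x, Cmod (diffop P (fun l => lerch_der nu (k + l) x)) <= M * exp (N * Rabs x)).
  2: apply (H O).
  induction P as [|c P IH]; intros k; simpl diffop.
  - exists 0, 0; repeat split; try lra. intros x; rewrite Cmod_0; lra.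
  - destruct (IH (S k)) as (M & N & HM & HN & H).
    destruct (lerch_der_bound nu k) as (M' & N' & HM' & HN' & H').
    exists (M + Rabs c * M'), (N + N'). pose proof (Rabs_pos c). repeat split; [nra|lra|].
    intros x. eapply Rle_trans; [apply Cmod_triangle|].
    rewrite Cmod_mult, Cmod_R, Nat.add_0_r.
    specialize (H x); specialize (H' x). pose proof (Rabs_pos x).
    assert (E1 : exp (N * Rabs x) <= exp ((N + N') * Rabs x)) by (apply exp_le; nra).
    assert (E2 : exp (N' * Rabs x) <= exp ((N + N') * Rabs x)) by (apply exp_le; nra).
    replace (diffop P (fun n => lerch_der nu (k + S n) x)) with (diffop P (fun l => lerch_der nu (S k + l) x)).
    2:{ clear. f_equal. apply FunctionalExtensionality.functional_extensionality.
        intros n; now rewrite Nat.add_succ_r. }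
    assert (Rabs c * Cmod (lerch_der nu k x) <= Rabs c * (M' * exp ((N + N') * Rabs x))).
    { apply Rmult_le_compat_l; auto. eapply Rle_trans; [exact H'|]. now apply Rmult_le_compat_l. }
    assert (M * exp (N * Rabs x) <= M * exp ((N + N') * Rabs x)) by now apply Rmult_le_compat_l.
    lra.
Qed.

Lemma is_Cderive_diffop (U : nat -> R -> C) P x :
  (forall l, is_Cderive (U l) x (U (S l) x)) ->
  is_Cderive (fun x => diffop P (fun l => U l x)) x (diffop P (fun l => U (S l) x)).
Proof.
  revert U; induction P as [|c P IH]; intros U H; simpl.
  - apply is_Cderive_const.
  - apply is_Cderive_plus; [apply is_Cderive_scal, H|].
    apply (IH (fun l => U (S l))). intros l; apply H.
Qed.

(** Coefficients of [P(x + 1)]: moving the factor [e^x] past [D] turns [D] into [D + 1]. *)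
Fixpoint pshift (P : list R) : list R :=
  match P with
  | [] => []
  | c :: t => padd [c] (padd (pshift t) (0 :: pshift t))
  end.

Lemma peval_pshift P x : peval (pshift P) x = peval P (x + 1).
Proof.
  induction P as [|c t IH]; cbn [pshift]; auto.
  rewrite !peval_padd. simpl. rewrite IH. ring.
Qed.

(* Differentiating [(1 - e^x) u = 1 - e^(nu x)] repeatedly. *)
Lemma diffop_lerch_rec nu P x :
  (diffop P (fun l => lerch_der nu l x) - exp x * diffop (pshift P) (fun l => lerch_der nu l x))%C =
  (peval P 0 - peval P nu * Cexp (nu * x))%C.
Proof.
  revert x; induction P as [|c t IH]; intros x; cbn [pshift].
  - simpl; ring.
  - assert (D := is_Cderive_unique
      (fun x => diffop t (fun l => lerch_der nu l x) - exp x * diffop (pshift t) (fun l => lerch_der nu l x))%C x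
      (diffop t (fun l => lerch_der nu (S l) x) -
        (exp x * diffop (pshift t) (fun l => lerch_der nu l x) + exp x * diffop (pshift t) (fun l => lerch_der nu (S l) x)))%C
      (- (peval t nu * (nu * Cexp (nu * x))))%C).
    rewrite !diffop_padd. cbn [diffop].
    rewrite Cplus_comm in D.
    assert (D' : (diffop t (fun l => lerch_der nu (S l) x) -
        (exp x * diffop (pshift t) (fun l => lerch_der nu l x) + exp x * diffop (pshift t) (fun l => lerch_der nu (S l) x)))%C
        = (- (peval t nu * (nu * Cexp (nu * x))))%C).
    { rewrite <- D; [ring| |].
      - eapply is_Cderive_eq.
        + apply is_Cderive_minus; [apply (is_Cderive_diffop (lerch_der nu)); intros; apply is_Cderive_lerch_der|].
          apply is_Cderive_mult; [apply is_Cderive_RtoC, is_derive_exp|].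
          apply (is_Cderive_diffop (lerch_der nu)); intros; apply is_Cderive_lerch_der.
        + cbv beta; ring.
      - apply is_Cderive_ext with (fun x : R => peval t 0 - peval t nu * Cexp (nu * x))%C.
        + intros y; now rewrite IH.
        + eapply is_Cderive_eq.
          * apply is_Cderive_minus; [apply is_Cderive_const|apply is_Cderive_scal, is_Cderive_Cexp].
          * ring. }
    pose proof (lerch_fun_spec nu x) as E.
    transitivity (c * (lerch_der nu 0 x * (1 - exp x)) + (diffop t (fun l => lerch_der nu (S l) x) -
        (exp x * diffop (pshift t) (fun l => lerch_der nu l x) + exp x * diffop (pshift t) (fun l => lerch_der nu (S l) x))))%C;
      [ring|].
    rewrite D', E. simpl peval. ring.
Qed.

(** * The formal expansion *)

Definition conv (f g : nat -> C) (k : nat) : C := csum (fun m => f m * g (k - m)%nat)%C (S k).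

Lemma csum_rev f n : csum f n = csum (fun i => f (n - 1 - i)%nat) n.
Proof.
  revert f; induction n as [|n IH]; intros f; auto.
  rewrite csum_shift. cbn [csum].
  rewrite (IH (fun i => f (S i))). replace (S n - 1 - n)%nat with O by lia.
  rewrite Cplus_comm. apply (f_equal (fun z => (z + f O)%C)).
  apply csum_ext; intros i Hi. f_equal; lia.
Qed.

Lemma conv_comm f g k : conv f g k = conv g f k.
Proof.
  unfold conv; rewrite csum_rev; apply csum_ext; intros i Hi.
  replace (S k - 1 - i)%nat with (k - i)%nat by lia.
  replace (k - (k - i))%nat with i by lia. ring.
Qed.

(** In generating functions: [f' = (1 + a z) f] implies [f' g = (1 + a z) f g]. *)
Lemma conv_shift_l f f' g a k : f' O = f O -> (forall m, f' (S m) = f (S m) + a * f m)%C ->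
  conv f' g (S k) = (conv f g (S k) + a * conv f g k)%C.
Proof.
  intros H0 HS. unfold conv.
  rewrite (csum_shift _ (S k)), (csum_shift (fun m => f m * g (S k - m)%nat)%C (S k)).
  rewrite H0.
  rewrite (csum_ext (fun i => f' (S i) * g (S k - S i)%nat)%C
    (fun i => f (S i) * g (S k - S i)%nat + a * (f i * g (k - i)%nat))%C).
  - rewrite csum_plus, csum_scal; ring.
  - intros i _. rewrite HS. simpl; ring.
Qed.

Lemma conv_shift_r f g g' a k : g' O = g O -> (forall m, g' (S m) = g (S m) + a * g m)%C ->
  conv f g' (S k) = (conv f g (S k) + a * conv f g k)%C.
Proof.
  intros H0 HS. rewrite !(conv_comm f). now apply conv_shift_l.
Qed.

Lemma conv_0 f g : conv f g 0 = (f O * g O)%C.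
Proof. unfold conv; simpl; ring. Qed.

Lemma csum_conv f g K :
  csum (conv f g) (S K) = csum (fun m => f m * csum g (S (K - m)))%C (S K).
Proof.
  induction K as [|K IH].
  - unfold conv; simpl; ring.
  - change (csum (conv f g) (S (S K))) with (csum (conv f g) (S K) + conv f g (S K))%C.
    rewrite IH. unfold conv.
    change (csum (fun m => f m * csum g (S (S K - m)))%C (S (S K)))
      with (csum (fun m => f m * csum g (S (S K - m)))%C (S K) + f (S K) * csum g (S (S K - S K)))%C.
    rewrite (csum_ext (fun m => f m * csum g (S (S K - m)))%C
      (fun m => f m * csum g (S (K - m)) + f m * g (S K - m)%nat)%C).
    + rewrite csum_plus.
      change (csum (fun m => f m * g (S K - m)%nat)%C (S (S K)))
        with (csum (fun m => f m * g (S K - m)%nat)%C (S K) + f (S K) * g (S K - S K)%nat)%C.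
      rewrite Nat.sub_diag. simpl (csum g 1). ring.
    + intros i Hi. replace (S K - i)%nat with (S (K - i)) by lia.
      change (csum g (S (S (K - i)))) with (csum g (S (K - i)) + g (S (K - i)))%C. ring.
Qed.

Lemma csum_Cmod_le f n b : (forall i, (i < n)%nat -> Cmod (f i) <= b) -> Cmod (csum f n) <= INR n * b.
Proof.
  induction n as [|n IH]; intros H.
  - simpl csum; rewrite Cmod_0; simpl; lra.
  - simpl csum. eapply Rle_trans; [apply Cmod_triangle|].
    rewrite S_INR. specialize (IH (fun i Hi => H i (Nat.lt_trans _ _ _ Hi (Nat.lt_succ_diag_r n)))).
    specialize (H n (Nat.lt_succ_diag_r n)). lra.
Qed.

Lemma pow_le_pow (e : R) m n : 0 <= e <= 1 -> (n <= m)%nat -> e ^ m <= e ^ n.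
Proof.
  intros He H. replace m with (n + (m - n))%nat by lia. rewrite pow_add.
  assert (0 <= e ^ n) by (apply pow_le; lra).
  assert (e ^ (m - n) <= 1) by (rewrite <- (pow1 (m - n)); apply pow_incr; lra). nra.
Qed.

Lemma csum_tail g K n B e : 0 <= B -> 0 <= e <= 1 -> (n <= K)%nat ->
  (forall j, (j <= K)%nat -> Cmod (g j) <= B * e ^ j) ->
  Cmod (csum g (S K) - csum g (S n)) <= INR K * (B * e ^ S n).
Proof.
  intros HB He Hn H.
  assert (P : forall d, (n + d <= K)%nat -> Cmod (csum g (S (n + d)) - csum g (S n)) <= INR d * (B * e ^ S n)).
  { induction d as [|d IH]; intros Hd.
    - rewrite Nat.add_0_r. replace (csum g (S n) - csum g (S n))%C with (RtoC 0) by ring.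
      rewrite Cmod_0; simpl; lra.
    - replace (n + S d)%nat with (S (n + d)) by lia.
      change (csum g (S (S (n + d)))) with (csum g (S (n + d)) + g (S (n + d)))%C.
      replace (csum g (S (n + d)) + g (S (n + d)) - csum g (S n))%C
        with ((csum g (S (n + d)) - csum g (S n)) + g (S (n + d)))%C by ring.
      eapply Rle_trans; [apply Cmod_triangle|]. rewrite S_INR.
      specialize (IH ltac:(lia)). specialize (H (S (n + d)) ltac:(lia)).
      assert (B * e ^ S (n + d) <= B * e ^ S n).
      { apply Rmult_le_compat_l; auto. apply pow_le_pow; auto; lia. }
      lra. }
  specialize (P (K - n)%nat ltac:(lia)). replace (n + (K - n))%nat with K in P by lia.
  eapply Rle_trans; [exact P|]. apply Rmult_le_compat_r.
  - apply Rmult_le_pos; auto. apply pow_le; lra.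
  - apply le_INR; lia.
Qed.

(** The product of the truncated sums exceeds the truncated Cauchy product by the terms of total
    order above [K]: the factor [f m], of size [e^m], meets only the part of [g] beyond [K - m]. *)
Lemma csum_mult_conv f g K B e : 0 <= B -> 0 <= e <= 1 ->
  (forall j, (j <= K)%nat -> Cmod (f j) <= B * e ^ j) ->
  (forall j, (j <= K)%nat -> Cmod (g j) <= B * e ^ j) ->
  Cmod (csum f (S K) * csum g (S K) - csum (conv f g) (S K)) <= INR (S K) * (B * (INR K * B)) * e ^ (K + 1).
Proof.
  intros HB He Hf Hg. rewrite csum_conv.
  replace (csum f (S K) * csum g (S K) - csum (fun m => f m * csum g (S (K - m))) (S K))%C
    with (csum (fun m => f m * (csum g (S K) - csum g (S (K - m))))%C (S K)).
  - eapply Rle_trans; [apply csum_Cmod_le with (b := B * (INR K * B) * e ^ (K + 1))|lra].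
    intros m Hm. rewrite Cmod_mult.
    apply Rle_trans with (B * e ^ m * (INR K * (B * e ^ S (K - m)))).
    + apply Rmult_le_compat; auto using Cmod_ge_0; [apply Hf; lia|].
      apply csum_tail; auto; lia.
    + right. replace (K + 1)%nat with (m + S (K - m))%nat by lia. rewrite pow_add. ring.
  - rewrite (csum_ext _ (fun m => csum g (S K) * f m + (-1) * (f m * csum g (S (K - m))))%C)
      by (intros; ring).
    rewrite csum_plus, !csum_scal. ring.
Qed.

(** * The polynomials [P_{2k}] and their telescoping sums *)

(* The two factors of [P_{2k}], with [u = 1 / alpha_1] and [v = 1 / alpha_2];
   [Pval u v k] is [P_{2k}]. *)
Definition aseq1 (u : R) (x : C) (m : nat) : C := (RtoC u ^ m * qpoly m (x + 1))%C.
Definition aseq2 (v : R) (x : C) (j : nat) : C := (RtoC v ^ j * qpoly j (- x))%C.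
Definition Pval (u v : R) (k : nat) (x : C) : C := conv (aseq1 u x) (aseq2 v x) k.

(** The shifts of [aseq1] and [aseq2] by 1 multiply their generating functions by [1 - (x + 2) u z]
    and [1 / (1 + x v z)], so [(1 + x v z) P(x + 1) = (1 - (x + 2) u z) P(x)]. The statement
    compares coefficients of [z^(k+1)]. *)
Lemma Pval_rec (u v : R) k (x : C) :
  Pval u v (S k) (x + 1) =
  (Pval u v (S k) x - (x * v * Pval u v k (x + 1) + (x + 2) * u * Pval u v k x))%C.
Proof.
  unfold Pval.
  assert (F0 : aseq1 u (x + 1) 0 = aseq1 u x 0) by (unfold aseq1; rewrite !qpoly_0; auto).
  assert (FS : forall m, aseq1 u (x + 1) (S m) = (aseq1 u x (S m) + (- (u * (x + 2))) * aseq1 u x m)%C).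
  { intros m; unfold aseq1. rewrite qpoly_rec, !Cpow_S. ring. }
  assert (G0 : aseq2 v x 0 = aseq2 v (x + 1) 0) by (unfold aseq2; rewrite !qpoly_0; auto).
  assert (GS : forall m, aseq2 v x (S m) = (aseq2 v (x + 1) (S m) + (v * x) * aseq2 v (x + 1) m)%C).
  { intros m; unfold aseq2.
    replace (- x)%C with (- (x + 1) + 1)%C by ring. rewrite qpoly_rec, !Cpow_S.
    ring. }
  rewrite (conv_shift_l (aseq1 u x) (aseq1 u (x + 1)) _ _ _ F0 FS).
  rewrite (conv_shift_r _ (aseq2 v (x + 1)) (aseq2 v x) _ k G0 GS).
  destruct k as [|k].
  - rewrite !conv_0, F0, G0. ring.
  - rewrite (conv_shift_l (aseq1 u x) (aseq1 u (x + 1)) _ _ _ F0 FS).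
    rewrite (conv_shift_r _ (aseq2 v (x + 1)) (aseq2 v x) _ k G0 GS). ring.
Qed.

(** Setting [z = 1] in that relation and cutting at order [K] leaves only the top terms, homogeneous
    of degree [K + 1] in [u] and [v]. *)
Lemma Pval_telescope (u v : R) K (x : C) :
  ((1 + x * v) * csum (fun k => Pval u v k (x + 1)) (S K) - (1 - (x + 2) * u) * csum (fun k => Pval u v k x) (S K))%C
  = (x * v * Pval u v K (x + 1) + (x + 2) * u * Pval u v K x)%C.
Proof.
  induction K as [|K IH].
  - assert (E : forall y, Pval u v 0 y = 1).
    { intros y; unfold Pval; rewrite conv_0; unfold aseq1, aseq2; rewrite !qpoly_0; simpl; ring. }
    simpl csum. rewrite !E. ring.
  - change (csum (fun k => Pval u v k (x + 1)) (S (S K)))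
      with (csum (fun k => Pval u v k (x + 1)) (S K) + Pval u v (S K) (x + 1))%C.
    change (csum (fun k => Pval u v k x) (S (S K)))
      with (csum (fun k => Pval u v k x) (S K) + Pval u v (S K) x)%C.
    set (X := csum (fun k => Pval u v k (x + 1)) (S K)) in *. set (Y := csum (fun k => Pval u v k x) (S K)) in *.
    replace ((1 + x * v) * (X + Pval u v (S K) (x + 1)) - (1 - (x + 2) * u) * (Y + Pval u v (S K) x))%C
      with (((1 + x * v) * X - (1 - (x + 2) * u) * Y) + Pval u v (S K) (x + 1) + x * v * Pval u v (S K) (x + 1)
        - Pval u v (S K) x + (x + 2) * u * Pval u v (S K) x)%C by ring.
    rewrite IH. rewrite (Pval_rec u v K x) at 1. ring.
Qed.

(** These lists are free of [u] and [v], so constants derived from them are uniform in the two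
    parameters; powers of [u] and [v] enter only as scalar factors. *)
Definition rlist (m j : nat) : list R :=
  epsilon (inhabits []) (fun l => (length l <= S (2 * (m + j)))%nat /\
     forall x, (qpoly m (x + 1) * qpoly j (- x))%C = peval l x).

Lemma rlist_spec m j : (length (rlist m j) <= S (2 * (m + j)))%nat /\
  forall x, (qpoly m (x + 1) * qpoly j (- x))%C = peval (rlist m j) x.
Proof.
  unfold rlist; apply epsilon_spec.
  change (is_poly (2 * (m + j)) (fun x => qpoly m (x + 1) * qpoly j (- x))%C).
  apply is_poly_le with (2 * m + 2 * j)%nat; [lia|]. apply is_poly_mult.
  - apply is_poly_ext with (fun x => qpoly m (1%R * x + 1%R)%C).
    + intros x; apply (f_equal (qpoly m)); ring.
    + apply is_poly_comp, is_poly_qpoly.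
  - apply is_poly_ext with (fun x => qpoly j ((-1)%R * x + 0%R)%C).
    + intros x; apply (f_equal (qpoly j)); cring.
    + apply is_poly_comp, is_poly_qpoly.
Qed.

Fixpoint plsum (f : nat -> list R) (n : nat) : list R :=
  match n with O => [] | S k => padd (plsum f k) (f k) end.

Lemma peval_plsum f n x : peval (plsum f n) x = csum (fun i => peval (f i) x) n.
Proof. induction n as [|n IH]; simpl; auto. now rewrite peval_padd, IH. Qed.

Lemma diffop_plsum f n U : diffop (plsum f n) U = csum (fun i => diffop (f i) U) n.
Proof. induction n as [|n IH]; simpl; auto. now rewrite diffop_padd, IH. Qed.

Lemma length_plsum f n d : (forall i, (i < n)%nat -> (length (f i) <= d)%nat) -> (length (plsum f n) <= d)%nat.
Proof.
  induction n as [|n IH]; intros H; simpl; [lia|]. apply length_padd; auto.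
Qed.

Definition Plist (u v : R) (k : nat) : list R :=
  plsum (fun m => pscal (u ^ m * v ^ (k - m)) (rlist m (k - m))) (S k).

Lemma peval_Plist u v k x : peval (Plist u v k) x = Pval u v k x.
Proof.
  unfold Plist; rewrite peval_plsum. unfold Pval, conv; apply csum_ext; intros m Hm.
  rewrite peval_pscal, <- (proj2 (rlist_spec m (k - m))), RtoC_mult, !RtoC_pow.
  unfold aseq1, aseq2; ring.
Qed.

Lemma RtoC_sum_n (f : nat -> R) n : RtoC (sum_n f n) = csum (fun i => RtoC (f i)) (S n).
Proof.
  induction n as [|n IH].
  - rewrite sum_O; simpl; ring.
  - rewrite sum_Sn. change (plus (sum_n f n) (f (S n))) with (sum_n f n + f (S n)).
    rewrite RtoC_plus, IH; reflexivity.
Qed.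

Lemma rpeval_Plist a1 a2 k x : 0 < a1 -> 0 < a2 ->
  Ppoly a1 a2 k x = rpeval (Plist (/ a1) (/ a2) k) x.
Proof.
  intros H1 H2. apply RtoC_inj. rewrite <- peval_RtoC, peval_Plist.
  unfold Ppoly; rewrite RtoC_sum_n. unfold Pval, conv; apply csum_ext; intros m Hm.
  unfold aseq1, aseq2. rewrite <- RtoC_plus, <- RtoC_opp, !qpoly_RtoC.
  rewrite <- !RtoC_pow, <- !RtoC_mult. apply f_equal.
  replace (1 + (x + 1)) with (2 + x) by ring. replace (1 + - x) with (1 - x) by ring.
  rewrite !pow_inv. field. split; apply pow_nonzero; lra.
Qed.

Lemma length_Plist u v k : (length (Plist u v k) <= S (2 * k))%nat.
Proof.
  apply length_plsum; intros m Hm. unfold pscal; rewrite length_map.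
  destruct (rlist_spec m (k - m)) as [L _]. lia.
Qed.

Definition Aapp (nu : C) (u v : R) (K : nat) (x : R) : C :=
  diffop (plsum (Plist u v) (S K)) (fun l => lerch_der nu l x).

Lemma Tpartial_eq nu Y1 Y2 a1 a2 K : 0 < Y1 -> 0 < Y2 -> 0 < a1 -> 0 < a2 ->
  Tpartial nu Y1 Y2 a1 a2 K = (/ Y1 * Aapp nu (/ a1) (/ a2) K (ln (Y2 / Y1)))%C.
Proof.
  intros HY1 HY2 H1 H2. unfold Tpartial, Aapp. apply f_equal.
  rewrite diffop_plsum, csum_sum_n. apply sum_n_ext; intros k.
  rewrite (diffop_sum_n _ _ (2 * k)) by apply length_Plist.
  apply sum_n_ext; intros l.
  rewrite incLerch_neg_eq by now apply Rdiv_lt_0_compat.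
  unfold pcoef. rewrite (Derive_n_poly_0 _ (Plist (/ a1) (/ a2) k) l); auto.
  intros x; now apply rpeval_Plist.
Qed.

Lemma Cmod_uv_pow u v e m j : 0 <= u <= e -> 0 <= v <= e -> u ^ m * v ^ j <= e ^ (m + j).
Proof.
  intros Hu Hv. rewrite pow_add. apply Rmult_le_compat; try (apply pow_le; lra); apply pow_incr; lra.
Qed.

Lemma diffop_family_bound nu (L : nat -> list R) n : exists M N, 0 <= M /\ 0 <= N /\
  forall i, (i < n)%nat -> forall x, Cmod (diffop (L i) (fun l => lerch_der nu l x)) <= M * exp (N * Rabs x).
Proof.
  induction n as [|n (M & N & HM & HN & H)].
  - exists 0, 0; repeat split; try lra. intros i Hi; lia.
  - destruct (diffop_lerch_bound nu (L n)) as (M' & N' & HM' & HN' & H').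
    exists (M + M'), (N + N'); repeat split; try lra.
    intros i Hi x. pose proof (Rabs_pos x).
    assert (E1 : exp (N * Rabs x) <= exp ((N + N') * Rabs x)) by (apply exp_le; nra).
    assert (E2 : exp (N' * Rabs x) <= exp ((N + N') * Rabs x)) by (apply exp_le; nra).
    pose proof (exp_pos (N * Rabs x)). pose proof (exp_pos (N' * Rabs x)).
    destruct (Nat.eq_dec i n) as [->|Hne].
    + specialize (H' x).
      assert (M' * exp (N' * Rabs x) <= M' * exp ((N + N') * Rabs x)) by now apply Rmult_le_compat_l.
      assert (0 <= M * exp ((N + N') * Rabs x)) by (apply Rmult_le_pos; lra). lra.
    + specialize (H i ltac:(lia) x).
      assert (M * exp (N * Rabs x) <= M * exp ((N + N') * Rabs x)) by now apply Rmult_le_compat_l.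
      assert (0 <= M' * exp ((N + N') * Rabs x)) by (apply Rmult_le_pos; lra). lra.
Qed.

Lemma diffop_Plist_bound nu k : exists M N, 0 <= M /\ 0 <= N /\ forall u v e x,
  0 <= u <= e -> 0 <= v <= e ->
  Cmod (diffop (Plist u v k) (fun l => lerch_der nu l x)) <= M * e ^ k * exp (N * Rabs x).
Proof.
  destruct (diffop_family_bound nu (fun m => rlist m (k - m)) (S k)) as (M & N & HM & HN & H).
  exists (INR (S k) * M), N; repeat split; auto.
  { apply Rmult_le_pos; auto; apply pos_INR. }
  intros u v e x Hu Hv. unfold Plist; rewrite diffop_plsum.
  eapply Rle_trans; [apply csum_Cmod_le with (b := e ^ k * (M * exp (N * Rabs x)))|right; ring].
  intros m Hm. rewrite diffop_pscal, Cmod_mult, Cmod_R.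
  assert (0 <= u ^ m * v ^ (k - m)) by (apply Rmult_le_pos; apply pow_le; lra).
  rewrite Rabs_pos_eq by auto.
  apply Rmult_le_compat; auto using Cmod_ge_0.
  replace k with (m + (k - m))%nat at 2 by lia. now apply Cmod_uv_pow.
Qed.

Lemma Aapp_bound nu K : exists M N, 0 <= M /\ 0 <= N /\ forall u v x,
  0 <= u <= 1 -> 0 <= v <= 1 -> Cmod (Aapp nu u v K x) <= M * exp (N * Rabs x).
Proof.
  unfold Aapp.
  enough (Q : forall n, exists M N, 0 <= M /\ 0 <= N /\ forall u v x,
    0 <= u <= 1 -> 0 <= v <= 1 ->
    Cmod (diffop (plsum (Plist u v) n) (fun l => lerch_der nu l x)) <= M * exp (N * Rabs x)) by apply Q.
  induction n as [|n (M & N & HM & HN & H)].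
  - exists 0, 0; repeat split; try lra. intros; simpl; rewrite Cmod_0; lra.
  - destruct (diffop_Plist_bound nu n) as (M' & N' & HM' & HN' & H').
    exists (M + M'), (N + N'); repeat split; try lra.
    intros u v x Hu Hv. cbn [plsum]. rewrite diffop_padd.
    eapply Rle_trans; [apply Cmod_triangle|].
    specialize (H u v x Hu Hv). specialize (H' u v 1 x Hu Hv). rewrite pow1, Rmult_1_r in H'.
    pose proof (Rabs_pos x).
    assert (E1 : exp (N * Rabs x) <= exp ((N + N') * Rabs x)) by (apply exp_le; nra).
    assert (E2 : exp (N' * Rabs x) <= exp ((N + N') * Rabs x)) by (apply exp_le; nra).
    assert (M * exp (N * Rabs x) <= M * exp ((N + N') * Rabs x)) by now apply Rmult_le_compat_l.
    assert (M' * exp (N' * Rabs x) <= M' * exp ((N + N') * Rabs x)) by now apply Rmult_le_compat_l.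
    lra.
Qed.

Definition Aapp_der (nu : C) (u v : R) (K : nat) (x : R) : C :=
  diffop (plsum (Plist u v) (S K)) (fun l => lerch_der nu (S l) x).

Lemma is_Cderive_Aapp nu u v K x : is_Cderive (Aapp nu u v K) x (Aapp_der nu u v K x).
Proof. apply (is_Cderive_diffop (lerch_der nu)); intros; apply is_Cderive_lerch_der. Qed.

Definition PK (u v : R) (K : nat) (x : C) : C := csum (fun k => Pval u v k x) (S K).

(** The operator whose symbol is the right side of [Pval_telescope]. Powers of [u] and [v] stay in
    front of fixed lists, so the factor [e^(K+1)] of [tail_bound] can be read off. *)
Definition tail_list (u v : R) (K : nat) : list R :=
  plsum (fun m => padd (pscal (u ^ m * v ^ (K - m) * v) (0 :: pshift (rlist m (K - m))))
    (pscal (u ^ m * v ^ (K - m) * u) (padd (0 :: rlist m (K - m)) (pscal 2 (rlist m (K - m)))))) (S K).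

Lemma peval_tail_list (u v : R) K (x : C) : peval (tail_list u v K) x =
  (x * v * Pval u v K (x + 1) + (x + 2) * u * Pval u v K x)%C.
Proof.
  unfold tail_list; rewrite peval_plsum. unfold Pval, conv.
  rewrite <- !csum_scal, <- csum_plus; apply csum_ext; intros m Hm.
  rewrite peval_padd, !peval_pscal, peval_padd, peval_pscal. cbn [peval].
  rewrite peval_pshift, <- !(proj2 (rlist_spec m (K - m))), !RtoC_mult, !RtoC_pow.
  unfold aseq1, aseq2. ring.
Qed.

(** [CLop] acts as [Q(D) - e^x Q2(D)] with [Q(y) = (1 + (y - 1) v) PK(y)] and
    [Q2(y) = (1 - (y + 2) u) PK(y)]. Replacing [Q2(D)] by [Q(D + 1)] leaves the boundary terms
    [Q(0)] and [Q(nu) e^(nu x)], and the price of the replacement is the tail operator. *)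
Lemma Aapp_CLop nu a1 a2 K x : 0 < a1 -> 0 < a2 ->
  CLop a1 a2 x (Aapp nu (/ a1) (/ a2) K x) (Aapp_der nu (/ a1) (/ a2) K x) =
  ((1 - (/ a2)%R) * PK (/ a1) (/ a2) K 0 - (1 + (nu - 1) * (/ a2)%R) * PK (/ a1) (/ a2) K nu * Cexp (nu * x)
   + exp x * diffop (tail_list (/ a1) (/ a2) K) (fun l => lerch_der nu l x))%C.
Proof.
  intros H1 H2. set (u := / a1). set (v := / a2).
  set (P := plsum (Plist u v) (S K)).
  set (U := fun l => lerch_der nu l x).
  assert (HA : Aapp nu u v K x = diffop P U) by reflexivity.
  assert (HD : Aapp_der nu u v K x = diffop (0 :: P) U).
  { unfold Aapp_der; fold P. cbn [diffop]. unfold U; ring. }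
  set (Q := padd P (pscal v (padd (0 :: P) (pscal (-1) P)))).
  set (Q2 := padd P (pscal (- u) (padd (0 :: P) (pscal 2 P)))).
  assert (PP : forall y, peval P y = PK u v K y).
  { intros y; unfold P, PK; rewrite peval_plsum; apply csum_ext; intros; apply peval_Plist. }
  assert (HQ : forall y, peval Q y = ((1 + (y - 1) * v) * PK u v K y)%C).
  { intros y; unfold Q. rewrite peval_padd, peval_pscal, peval_padd, peval_pscal. cbn [peval].
    rewrite PP. ring. }
  assert (HT : diffop (tail_list u v K) U = (diffop (pshift Q) U - diffop Q2 U)%C).
  { replace (diffop (pshift Q) U - diffop Q2 U)%C with (diffop (padd (pshift Q) (pscal (-1) Q2)) U)
      by (rewrite diffop_padd, diffop_pscal; ring).
    apply diffop_eq; intros n. rewrite peval_tail_list, peval_padd, peval_pscal, peval_pshift, HQ.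
    unfold Q2. rewrite peval_padd, peval_pscal, peval_padd, peval_pscal. cbn [peval].
    rewrite PP, <- Pval_telescope. unfold PK. rewrite RtoC_opp. ring. }
  pose proof (diffop_lerch_rec nu Q x) as R. fold U in R. rewrite !HQ in R.
  rewrite HT, HA, HD. unfold CLop. fold u v.
  replace (exp x * (diffop (pshift Q) U - diffop Q2 U))%C
    with (diffop Q U - exp x * diffop Q2 U - (diffop Q U - exp x * diffop (pshift Q) U))%C by ring.
  rewrite R. unfold Q at 1, Q2. rewrite !diffop_padd, !diffop_pscal, !diffop_padd, !diffop_pscal, RtoC_opp. ring.
Qed.

Lemma tail_bound nu K : exists M N, 0 <= M /\ 0 <= N /\ forall u v e x,
  0 <= u <= e -> 0 <= v <= e ->
  Cmod (diffop (tail_list u v K) (fun l => lerch_der nu l x)) <= M * e ^ (K + 1) * exp (N * Rabs x).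
Proof.
  destruct (diffop_family_bound nu (fun m => 0 :: pshift (rlist m (K - m))) (S K)) as (M & N & HM & HN & H).
  destruct (diffop_family_bound nu (fun m => padd (0 :: rlist m (K - m)) (pscal 2 (rlist m (K - m)))) (S K))
    as (M' & N' & HM' & HN' & H').
  exists (INR (S K) * (M + M')), (N + N'); repeat split; try lra.
  { apply Rmult_le_pos; [apply pos_INR|lra]. }
  intros u v e x Hu Hv. unfold tail_list; rewrite diffop_plsum.
  eapply Rle_trans; [apply csum_Cmod_le with (b := (M + M') * e ^ (K + 1) * exp ((N + N') * Rabs x))|right; ring].
  intros m Hm. rewrite diffop_padd, !(diffop_pscal (u ^ m * v ^ (K - m) * _)).
  eapply Rle_trans; [apply Cmod_triangle|]. rewrite !Cmod_mult, !Cmod_R.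
  assert (P0 : 0 <= u ^ m * v ^ (K - m)) by (apply Rmult_le_pos; apply pow_le; lra).
  assert (P1 : u ^ m * v ^ (K - m) <= e ^ K).
  { replace K with (m + (K - m))%nat at 2 by lia. now apply Cmod_uv_pow. }
  rewrite !Rabs_pos_eq by (apply Rmult_le_pos; lra).
  specialize (H m Hm x). specialize (H' m Hm x). pose proof (Rabs_pos x).
  assert (E1 : exp (N * Rabs x) <= exp ((N + N') * Rabs x)) by (apply exp_le; nra).
  assert (E2 : exp (N' * Rabs x) <= exp ((N + N') * Rabs x)) by (apply exp_le; nra).
  assert (M * exp (N * Rabs x) <= M * exp ((N + N') * Rabs x)) by now apply Rmult_le_compat_l.
  assert (M' * exp (N' * Rabs x) <= M' * exp ((N + N') * Rabs x)) by now apply Rmult_le_compat_l.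
  rewrite pow_add, pow_1.
  replace ((M + M') * (e ^ K * e) * exp ((N + N') * Rabs x))
    with ((e ^ K * e) * (M * exp ((N + N') * Rabs x)) + (e ^ K * e) * (M' * exp ((N + N') * Rabs x))) by ring.
  apply Rplus_le_compat; (apply Rmult_le_compat; auto using Cmod_ge_0; [apply Rmult_le_pos; lra| |lra]);
    apply Rmult_le_compat; lra.
Qed.

(** * Gamma quotients in the inhomogeneous term *)

(* [gfun mu] is [(alpha_1 - 1) / alpha_1 * (alpha_2 / alpha_1)^mu / ((alpha_1 - 1)_{-mu} (alpha_2)_mu)]. *)
Definition gfun (mu : C) (a1 a2 : R) : C :=
  ((CGamma a1 / CGamma (a1 - (1 + mu)) * Rcpow a1 (- (1 + mu))) *
   (CGamma a2 / CGamma (a2 - - mu) * Rcpow a2 (- - mu)))%C.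

Lemma qpoly_family_bound s K : exists B, 0 <= B /\ forall j, (j <= K)%nat -> Cmod (qpoly j s) <= B.
Proof.
  induction K as [|K (B & HB & H)].
  - exists (Cmod (qpoly 0 s)); split; [apply Cmod_ge_0|]. intros j Hj. replace j with O by lia. lra.
  - exists (B + Cmod (qpoly (S K) s)). pose proof (Cmod_ge_0 (qpoly (S K) s)). split; [lra|].
    intros j Hj. destruct (Nat.eq_dec j (S K)) as [->|]; [lra|].
    specialize (H j ltac:(lia)); lra.
Qed.

(** The two Gamma quotients have shifts [1 + mu] and [- mu], so their truncated series are the sums
    of [aseq1] and [aseq2]; cutting the product at total order [K] gives [PK]. *)
Lemma gfun_expansion mu K : exists M A, 1 <= A /\ 0 <= M /\ forall a1 a2, A <= a1 -> A <= a2 ->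
  1 / a1 + 1 / a2 <= 1 ->
  Cmod (gfun mu a1 a2 - PK (/ a1) (/ a2) K mu) <= M * (1 / a1 + 1 / a2) ^ (K + 1).
Proof.
  destruct (gamma_ratio_expansion K (1 + mu)%C) as (M1 & A1 & HA1 & HM1 & H1).
  destruct (gamma_ratio_expansion K (- mu)%C) as (M2 & A2 & HA2 & HM2 & H2).
  destruct (qsum_bound K (1 + mu)%C) as (B1 & HB1 & HQ1).
  destruct (qsum_bound K (- mu)%C) as (B2 & HB2 & HQ2).
  destruct (qpoly_family_bound (mu + 1)%C K) as (B3 & HB3 & HQ3).
  destruct (qpoly_family_bound (- mu)%C K) as (B4 & HB4 & HQ4).
  set (B := B3 + B4).
  exists (M1 * (M2 + B2) + B1 * M2 + INR (S K) * (B * (INR K * B))), (Rmax A1 A2).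
  assert (Z : 0 <= INR (S K) * (B * (INR K * B))).
  { unfold B. pose proof (pos_INR (S K)); pose proof (pos_INR K).
    repeat apply Rmult_le_pos; lra. }
  split; [eapply Rle_trans; [exact HA1|apply Rmax_l]|]. split.
  { assert (0 <= M1 * (M2 + B2)) by (apply Rmult_le_pos; lra).
    assert (0 <= B1 * M2) by (apply Rmult_le_pos; lra). lra. }
  intros a1 a2 Ha1 Ha2 He1.
  assert (Ha1' : A1 <= a1) by (eapply Rle_trans; [apply Rmax_l|exact Ha1]).
  assert (Ha2' : A2 <= a2) by (eapply Rle_trans; [apply Rmax_r|exact Ha2]).
  set (e := 1 / a1 + 1 / a2) in *. unfold gfun.
  set (X := (CGamma a1 / CGamma (a1 - (1 + mu)) * Rcpow a1 (- (1 + mu)))%C).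
  set (Y := (CGamma a2 / CGamma (a2 - - mu) * Rcpow a2 (- - mu))%C).
  set (u := / a1). set (v := / a2).
  assert (Hu : 0 < u) by (apply Rinv_0_lt_compat; lra).
  assert (Hv : 0 < v) by (apply Rinv_0_lt_compat; lra).
  assert (Ee : e = u + v) by (unfold e, u, v; field; lra).
  set (S1 := qsum K (1 + mu) u). set (S2 := qsum K (- mu) v).
  assert (EX : Cmod (X - S1) <= M1 * e ^ (K + 1)).
  { eapply Rle_trans; [apply (H1 a1 Ha1')|]. apply Rmult_le_compat_l; auto. apply pow_incr. fold u; lra. }
  assert (EY : Cmod (Y - S2) <= M2 * e ^ (K + 1)).
  { eapply Rle_trans; [apply (H2 a2 Ha2')|]. apply Rmult_le_compat_l; auto. apply pow_incr. fold v; lra. }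
  assert (BS1 : Cmod S1 <= B1) by (apply HQ1; lra).
  assert (BS2 : Cmod S2 <= B2) by (apply HQ2; lra).
  assert (Pe : 0 <= e ^ (K + 1) <= 1).
  { split; [apply pow_le; lra|]. rewrite <- (pow1 (K + 1)); apply pow_incr; lra. }
  assert (BY : Cmod Y <= M2 + B2).
  { pose proof (Cmod_triangle_sub Y S2). nra. }
  assert (EC : Cmod (S1 * S2 - PK u v K mu) <= INR (S K) * (B * (INR K * B)) * e ^ (K + 1)).
  { replace S1 with (csum (aseq1 u mu) (S K)).
    2:{ unfold S1, qsum, aseq1; apply csum_ext; intros m _. rewrite (Cplus_comm mu 1). ring. }
    replace S2 with (csum (aseq2 v mu) (S K)).
    2:{ unfold S2, qsum, aseq2; apply csum_ext; intros m _. ring. }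
    apply csum_mult_conv; try (unfold B; lra).
    - intros j Hj. unfold aseq1. rewrite Cmod_mult, Cmod_pow, Cmod_R, Rabs_pos_eq by lra.
      rewrite Rmult_comm. apply Rmult_le_compat; [apply Cmod_ge_0|apply pow_le; lra| |apply pow_incr; lra].
      specialize (HQ3 j Hj); unfold B; lra.
    - intros j Hj. unfold aseq2. rewrite Cmod_mult, Cmod_pow, Cmod_R, Rabs_pos_eq by lra.
      rewrite Rmult_comm. apply Rmult_le_compat; [apply Cmod_ge_0|apply pow_le; lra| |apply pow_incr; lra].
      specialize (HQ4 j Hj); unfold B; lra. }
  replace (X * Y - PK u v K mu)%C with ((X - S1) * Y + S1 * (Y - S2) + (S1 * S2 - PK u v K mu))%C by ring.
  eapply Rle_trans; [apply Cmod_triangle|].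
  eapply Rle_trans; [apply Rplus_le_compat_r, Cmod_triangle|]. rewrite !Cmod_mult.
  assert (Cmod (X - S1) * Cmod Y <= M1 * e ^ (K + 1) * (M2 + B2)).
  { apply Rmult_le_compat; auto using Cmod_ge_0. }
  assert (Cmod S1 * Cmod (Y - S2) <= B1 * (M2 * e ^ (K + 1))).
  { apply Rmult_le_compat; auto using Cmod_ge_0. }
  lra.
Qed.

(** The terms with [gfun] are the exact value of [L T], as [Vfun_derive] shows, so this bounds
    [L (T - A_K)]. The boundary terms of [Aapp_CLop] at 0 and [nu] are matched by the two
    expansions, and the tail has the right order by itself. *)
Lemma residual_bound nu K : exists M N A, 0 <= M /\ 0 <= N /\ 2 <= A /\ forall a1 a2 x : R, A <= a1 -> A <= a2 ->
  Cmod ((1 - (/ a2)%R) * gfun 0 a1 a2 - (1 + (nu - 1) * (/ a2)%R) * gfun nu a1 a2 * Cexp (nu * x)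
     - CLop a1 a2 x (Aapp nu (/ a1) (/ a2) K x) (Aapp_der nu (/ a1) (/ a2) K x))
  <= M * (1 / a1 + 1 / a2) ^ (K + 1) * exp (N * Rabs x).
Proof.
  destruct (gfun_expansion 0 K) as (M1 & A1 & HA1 & HM1 & H1).
  destruct (gfun_expansion nu K) as (M2 & A2 & HA2 & HM2 & H2).
  destruct (tail_bound nu K) as (M3 & N3 & HM3 & HN3 & H3).
  set (c := Cmod (nu - 1)). assert (Hc : 0 <= c) by apply Cmod_ge_0.
  (* The three summands absorb [e^(nu x)], the growth of the tail and its prefactor [e^x]. *)
  set (N := Rabs (Re nu) + N3 + 1).
  exists (M1 + (1 + c) * M2 + M3), N, (Rmax (Rmax A1 A2) 2).
  pose proof (Rabs_pos (Re nu)).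
  split; [|split; [unfold N; lra|split; [apply Rmax_r|]]].
  { assert (0 <= (1 + c) * M2) by (apply Rmult_le_pos; lra). lra. }
  intros a1 a2 x Ha1 Ha2.
  pose proof (Rmax_l (Rmax A1 A2) 2); pose proof (Rmax_r (Rmax A1 A2) 2).
  pose proof (Rmax_l A1 A2); pose proof (Rmax_r A1 A2).
  set (u := / a1). set (v := / a2). set (e := 1 / a1 + 1 / a2).
  assert (Hu : 0 < u <= 1 / 2).
  { split; [apply Rinv_0_lt_compat; lra|]. replace (1 / 2) with (/ 2) by field. apply Rinv_le_contravar; lra. }
  assert (Hv : 0 < v <= 1 / 2).
  { split; [apply Rinv_0_lt_compat; lra|]. replace (1 / 2) with (/ 2) by field. apply Rinv_le_contravar; lra. }
  assert (Ee : e = u + v) by (unfold e, u, v; field; lra).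
  specialize (H1 a1 a2 ltac:(lra) ltac:(lra) ltac:(fold e; lra)).
  specialize (H2 a1 a2 ltac:(lra) ltac:(lra) ltac:(fold e; lra)).
  specialize (H3 u v e x ltac:(lra) ltac:(lra)).
  rewrite Aapp_CLop by lra. fold u v e in H1, H2 |- *.
  set (T := diffop (tail_list u v K) (fun l => lerch_der nu l x)) in *.
  set (g0 := gfun 0 a1 a2) in *. set (g1 := gfun nu a1 a2) in *.
  set (p0 := PK u v K 0) in *. set (p1 := PK u v K nu) in *.
  replace ((1 - v) * g0 - (1 + (nu - 1) * v) * g1 * Cexp (nu * x) -
    ((1 - v) * p0 - (1 + (nu - 1) * v) * p1 * Cexp (nu * x) + exp x * T))%C
    with ((1 - v) * (g0 - p0) - ((1 + (nu - 1) * v) * (g1 - p1) * Cexp (nu * x) + exp x * T))%C by ring.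
  eapply Rle_trans; [apply Cmod_sub_le|].
  eapply Rle_trans; [apply Rplus_le_compat_l, Cmod_triangle|].
  rewrite !Cmod_mult, Cmod_Cexp, Cmod_R, (Rabs_pos_eq (exp x)) by apply Rlt_le, exp_pos.
  replace (Re (nu * x)%C) with (Re nu * x) by (unfold Re, Im; simpl; ring).
  set (Z := e ^ (K + 1)) in *. assert (HZ : 0 <= Z) by (apply pow_le; lra).
  pose proof (Rabs_pos x). pose proof (Rle_abs x). pose proof (exp_pos (N * Rabs x)) as PE.
  assert (X1 : 1 <= exp (N * Rabs x)) by (apply exp_ge_1; unfold N; nra).
  assert (X2 : exp (Re nu * x) <= exp (N * Rabs x)).
  { apply exp_le. apply Rle_trans with (Rabs (Re nu) * Rabs x).
    - rewrite <- Rabs_mult. apply Rle_abs.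
    - apply Rmult_le_compat_r; unfold N; lra. }
  assert (X3 : exp x * exp (N3 * Rabs x) <= exp (N * Rabs x)).
  { rewrite <- exp_plus. apply exp_le. unfold N. nra. }
  assert (B1 : Cmod (1 - v) <= 1).
  { rewrite <- RtoC_minus, Cmod_R, Rabs_pos_eq; lra. }
  assert (B2 : Cmod (1 + (nu - 1) * v) <= 1 + c).
  { eapply Rle_trans; [apply Cmod_triangle|]. rewrite Cmod_1, Cmod_mult, Cmod_R, Rabs_pos_eq by lra.
    fold c. nra. }
  assert (T1 : Cmod (1 - v) * Cmod (g0 - p0) <= M1 * Z * exp (N * Rabs x)).
  { apply Rle_trans with (1 * (M1 * Z)).
    - apply Rmult_le_compat; auto using Cmod_ge_0.
    - assert (0 <= M1 * Z) by (apply Rmult_le_pos; lra). nra. }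
  assert (T2 : Cmod (1 + (nu - 1) * v) * Cmod (g1 - p1) * exp (Re nu * x) <= (1 + c) * (M2 * Z) * exp (N * Rabs x)).
  { apply Rmult_le_compat; auto; [apply Rmult_le_pos; apply Cmod_ge_0|apply Rlt_le, exp_pos|].
    apply Rmult_le_compat; auto using Cmod_ge_0. }
  assert (T3 : exp x * Cmod T <= M3 * Z * exp (N * Rabs x)).
  { apply Rle_trans with (exp x * (M3 * Z * exp (N3 * Rabs x))).
    - apply Rmult_le_compat_l; auto. apply Rlt_le, exp_pos.
    - replace (exp x * (M3 * Z * exp (N3 * Rabs x))) with (M3 * Z * (exp x * exp (N3 * Rabs x))) by ring.
      apply Rmult_le_compat_l; auto. apply Rmult_le_pos; lra. }
  lra.
Qed.

(** * The function T_nu *)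

Definition fcoef (nu : C) (a1 a2 : R) : C := (/ (poch (a1 - 1) (- nu) * poch a2 nu))%C.

(** Numerator in the variation of constants formula, up to a constant factor. With [s = a1 + a2 - 2]
    and [p] equal to [a2 - 1] or [a2 - 1 + nu], the parameters [1 - s + p] and [p + 1] in [Abeta]
    are those of the two Gauss functions in T_nu. *)
Definition Dfun (F : C -> C -> C -> C -> C) (nu : C) (a1 a2 y : R) : C :=
  ((a2 - 1)%R * Abeta F (a2 - 1)%R (a1 + a2 - 2) y
   - fcoef nu a1 a2 * ((a2 - 1)%R + nu) * Abeta F ((a2 - 1)%R + nu) (a1 + a2 - 2) y)%C.

(* The value of [Dfun] at +oo. *)
Definition Dlim (F : C -> C -> C -> C -> C) (nu : C) (a1 a2 : R) : C :=
  ((a2 - 1)%R * beta F (a2 - 1)%R (a1 + a2 - 2)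
   - fcoef nu a1 a2 * ((a2 - 1)%R + nu) * beta F ((a2 - 1)%R + nu) (a1 + a2 - 2))%C.

(* For [d = 0], [Y1 * T_nu] as a function of [x = ln (Y2 / Y1)]. *)
Definition Vfun (F : C -> C -> C -> C -> C) (nu d : C) (a1 a2 x : R) : C :=
  (((a1 - 1) / a1)%R * ((Dfun F nu a1 a2 (x + ln (a2 / a1)) - d) * (/ kint a1 a2 x)%R))%C.

Lemma large_Re nu a1 a2 : Rabs (Re nu) + 3 <= a1 -> Rabs (Re nu) + 3 <= a2 ->
  0 < Re ((a2 - 1)%R + nu)%C < a1 + a2 - 2 /\ 0 < Re (RtoC (a2 - 1)) < a1 + a2 - 2 /\
  0 < Re (a1 - 1 - nu)%C /\ 0 < Re (a2 + nu)%C.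
Proof.
  intros H1 H2. pose proof (Rle_abs (Re nu)). pose proof (Rle_abs (- Re nu)) as Q.
  rewrite Rabs_Ropp in Q.
  change (Re ((a2 - 1)%R + nu)%C) with (a2 - 1 + Re nu).
  change (Re (a1 - 1 - nu)%C) with (a1 - 1 - Re nu).
  change (Re (a2 + nu)%C) with (a2 + Re nu).
  change (Re (RtoC (a2 - 1))) with (a2 - 1).
  pose proof (Rabs_pos (Re nu)). lra.
Qed.

Lemma poch_0 s : nonpole s -> poch s 0 = 1.
Proof.
  intros H; unfold poch. rewrite Cplus_0_r. field. now apply CGamma_nz.
Qed.

Lemma gfun_eq (mu : C) (a1 a2 : R) : Rabs (Re mu) + 3 <= a1 -> Rabs (Re mu) + 3 <= a2 ->
  gfun mu a1 a2 = (((a1 - 1) / a1)%R * fcoef mu a1 a2 * Cexp (mu * ln (a2 / a1)))%C.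
Proof.
  intros H1 H2. pose proof (Rabs_pos (Re mu)).
  destruct (large_Re mu a1 a2 H1 H2) as (_ & _ & L3 & L4).
  unfold gfun, fcoef, poch.
  replace (RtoC a1 - (1 + mu))%C with (a1 - 1 - mu)%C by ring.
  replace (RtoC a1 - 1 + - mu)%C with (a1 - 1 - mu)%C by ring.
  replace (RtoC a2 - - mu)%C with (a2 + mu)%C by ring.
  assert (G1 : CGamma a1 = ((a1 - 1) * CGamma (a1 - 1))%C).
  { rewrite <- CGamma_S; [apply (f_equal CGamma); ring|].
    apply nonpole_Re. change (0 < a1 - 1). lra. }
  rewrite G1.
  assert (N1 : CGamma (a1 - 1) <> 0).
  { apply CGamma_nz, nonpole_Re. change (0 < a1 - 1). lra. }
  pose proof (CGamma_nz _ (nonpole_Re _ L3)) as N2. pose proof (CGamma_nz _ (nonpole_Re _ L4)) as N3.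
  assert (N4 : CGamma a2 <> 0).
  { apply CGamma_nz, nonpole_Re. change (0 < a2). lra. }
  assert (E : Cexp (mu * ln (a2 / a1)) = (Rcpow a2 mu / Rcpow a1 mu)%C).
  { unfold Rcpow, Cdiv. rewrite <- Cexp_opp, <- Cexp_plus. apply (f_equal Cexp).
    rewrite ln_div, RtoC_minus by lra. ring. }
  rewrite E, RtoC_div, RtoC_minus by lra.
  replace (- - mu)%C with mu by ring.
  rewrite Rcpow_opp, Rcpow_plus, Rcpow_1 by lra.
  pose proof (Rcpow_nz a1 mu). assert (RtoC a1 <> 0) by (apply RtoC_nz; lra).
  cfield. auto 10.
Qed.

Lemma gfun_0 (a1 a2 : R) : 3 <= a1 -> 3 <= a2 -> gfun 0 a1 a2 = RtoC ((a1 - 1) / a1).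
Proof.
  intros H1 H2. rewrite gfun_eq by (simpl; rewrite Rabs_R0; lra).
  unfold fcoef. replace (- (0))%C with (RtoC 0) by ring.
  rewrite !poch_0 by (apply nonpole_Re; [change (0 < a1 - 1) || change (0 < a2); lra]).
  rewrite Cmult_0_l, Cexp_0. field.
Qed.

(** The right side is free of [d], because [d] contributes a multiple of [1 / kint]. It arises from
    the two beta densities divided by [kint], whose exponents differ by [nu]. *)
Lemma Vfun_derive F nu d a1 a2 x : is_Gauss_2F1 F ->
  Rabs (Re nu) + 3 <= a1 -> Rabs (Re nu) + 3 <= a2 ->
  exists dV, is_Cderive (Vfun F nu d a1 a2) x dV /\
   CLop a1 a2 x (Vfun F nu d a1 a2 x) dV =
   ((1 - (/ a2)%R) * gfun 0 a1 a2 - (1 + (nu - 1) * (/ a2)%R) * gfun nu a1 a2 * Cexp (nu * x))%C.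
Proof.
  intros HF H1 H2. pose proof (Rabs_pos (Re nu)).
  destruct (large_Re nu a1 a2 H1 H2) as ([L1 _] & [L2 _] & _).
  set (l := ln (a2 / a1)). set (y := x + l).
  set (p0 := RtoC (a2 - 1)) in *. set (p1 := (p0 + nu)%C) in *. set (s := a1 + a2 - 2) in *.
  set (f0 := fcoef nu a1 a2).
  set (D' := (p0 * (Cexp (p0 * y) * kern s y) - f0 * p1 * (Cexp (p1 * y) * kern s y))%C).
  assert (HD : is_Cderive (fun x => Dfun F nu a1 a2 (x + l)) x D').
  { eapply is_Cderive_eq.
    - apply (is_Cderive_comp (Dfun F nu a1 a2) (fun x => x + l)).
      + unfold Dfun. fold p0 p1 f0 s.
        apply is_Cderive_minus; apply is_Cderive_scal, is_Cderive_Abeta; auto.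
      + instantiate (1 := 1). auto_derive; auto; ring.
    - unfold D'; fold y. ring. }
  set (E := a2 / a1 * exp x).
  assert (HE : 0 < E).
  { unfold E. apply Rmult_lt_0_compat; [apply Rdiv_lt_0_compat; lra|apply exp_pos]. }
  assert (Ey : exp y = E) by (apply exp_shift; lra).
  set (w := (a2 - 1) - (a1 + a2 - 3) * (E / (1 + E))).
  pose proof (kint_pos a1 a2 x) as HK.
  assert (HI : is_derive (fun x => / kint a1 a2 x) x (- w / kint a1 a2 x)).
  { eapply is_derive_eq.
    - apply is_derive_inv; [apply is_derive_kint|lra].
    - fold l y. rewrite Ey. fold w. field. lra. }
  set (Dx := (Dfun F nu a1 a2 y - d)%C).
  set (c := (a1 - 1) / a1).
  exists (c * ((D' - 0) * (/ kint a1 a2 x)%R + Dx * (- w / kint a1 a2 x)%R))%C. split.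
  { apply is_Cderive_scal.
    apply (is_Cderive_mult (fun x => Dfun F nu a1 a2 (x + l) - d)%C (fun x => RtoC (/ kint a1 a2 x)));
      [|now apply is_Cderive_RtoC].
    apply is_Cderive_minus; [exact HD|apply is_Cderive_const]. }
  rewrite gfun_0, gfun_eq by lra. fold c l f0.
  unfold Vfun, CLop. fold l y Dx c.
  assert (Kk : kint a1 a2 x = exp ((a2 - 1) * y) * (kern s y * (1 + E))).
  { unfold kint; fold l y. replace (a1 + a2 - 3) with (s + -1) by (unfold s; ring).
    now rewrite kern_plus, kern_m1, Ey. }
  assert (ED : D' = (RtoC (exp ((a2 - 1) * y) * kern s y) * (p0 - f0 * p1 * (Cexp (nu * l) * Cexp (nu * x))))%C).
  { unfold D'.
    replace (Cexp (p0 * y)) with (RtoC (exp ((a2 - 1) * y))).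
    2:{ unfold p0; rewrite <- RtoC_mult, Cexp_RtoC; auto. }
    replace (Cexp (p1 * y)) with (RtoC (exp ((a2 - 1) * y)) * (Cexp (nu * l) * Cexp (nu * x)))%C.
    2:{ rewrite <- Cexp_RtoC, <- !Cexp_plus. apply (f_equal Cexp). unfold p1, p0, y.
        rewrite RtoC_mult, RtoC_plus; ring. }
    rewrite RtoC_mult; ring. }
  rewrite ED, Kk.
  assert (Ex : RtoC (exp x) = (E * a1 / a2)%C).
  { rewrite <- RtoC_mult, <- RtoC_div by lra. apply f_equal. unfold E; field; lra. }
  rewrite Ex.
  set (G := exp ((a2 - 1) * y)). assert (HG : 0 < G) by apply exp_pos.
  pose proof (kern_pos s y) as Hks. set (k := kern s y) in *.
  set (X := (Cexp (nu * l) * Cexp (nu * x))%C).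
  replace ((1 + (nu - 1) * (/ a2)%R) * (c * f0 * Cexp (nu * l)) * Cexp (nu * x))%C
    with ((1 + (nu - 1) * (/ a2)%R) * (c * f0) * X)%C by (unfold X; ring).
  replace (- w / (G * (k * (1 + E)))) with
    ((- ((a2 - 1) * (1 + E) - (a1 + a2 - 3) * E)) / (G * (k * ((1 + E) * (1 + E))))) by (unfold w; field; lra).
  assert (NG : RtoC G <> 0) by (apply RtoC_nz; lra).
  assert (Nk : RtoC k <> 0) by (apply RtoC_nz; lra).
  assert (NE : RtoC (1 + E) <> 0) by (apply RtoC_nz; lra).
  assert (N1 : RtoC a1 <> 0) by (apply RtoC_nz; lra).
  assert (N2 : RtoC a2 <> 0) by (apply RtoC_nz; lra).
  unfold p1, p0, Rdiv.
  rewrite !RtoC_mult, !RtoC_inv, ?RtoC_mult, RtoC_opp, !RtoC_minus, !RtoC_mult, !RtoC_minus, !RtoC_plus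
    by (try apply Rgt_not_eq; repeat apply Rmult_lt_0_compat; lra).
  rewrite RtoC_plus in NE.
  generalize dependent Dx. generalize dependent X. clear - NG Nk NE N1 N2. intros X Dx.
  cfield. auto 10.
Qed.

Lemma kint_le a1 a2 x : 3 <= a1 + a2 -> kint a1 a2 x <= exp ((a2 - 1) * (x + ln (a2 / a1))).
Proof.
  intros H. unfold kint. pose proof (kern_le_1 (a1 + a2 - 3) (x + ln (a2 / a1)) ltac:(lra)).
  pose proof (exp_pos ((a2 - 1) * (x + ln (a2 / a1)))). nra.
Qed.

(** On the left [kint] is at most a constant times [e^((a2 - 1) y)], which beats [e^(- N y)] as soon
    as [a2 - 1 > N]. *)
Lemma kint_decay_left a1 a2 M N e x : 3 <= a1 -> 3 <= a2 -> N + 1 < a2 -> 0 < e ->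
  exists y0, forall y, y <= y0 -> y <= x -> y <= 0 -> Cmod M * exp (N * Rabs y) * kint a1 a2 y <= e.
Proof.
  intros H1 H2 HN He.
  set (l := ln (a2 / a1)).
  destruct (exp_small (a2 - 1 - N) (Cmod M * exp ((a2 - 1) * l)) e ltac:(lra) He) as [y0 H].
  exists y0. intros y Hy _ Hy0.
  eapply Rle_trans; [|apply (H y Hy)].
  rewrite Rabs_left1 by lra.
  apply Rle_trans with (Cmod M * exp (N * - y) * exp ((a2 - 1) * (y + l))).
  - apply Rmult_le_compat_l; [|apply kint_le; lra].
    apply Rmult_le_pos; [apply Cmod_ge_0|apply Rlt_le, exp_pos].
  - right. rewrite !Rmult_assoc, <- !exp_plus. f_equal. f_equal. ring.
Qed.

Lemma Vfun_Cmod F nu d a1 a2 x : 3 <= a1 ->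
  Cmod (Vfun F nu d a1 a2 x) * kint a1 a2 x = (a1 - 1) / a1 * Cmod (Dfun F nu a1 a2 (x + ln (a2 / a1)) - d).
Proof.
  intros H1. unfold Vfun. pose proof (kint_pos a1 a2 x) as K.
  rewrite !Cmod_mult, !Cmod_R, !Rabs_pos_eq.
  - field. lra.
  - apply Rlt_le, Rinv_0_lt_compat, K.
  - apply Rdiv_le_0_compat; lra.
Qed.

Lemma Dfun_vanishes F nu a1 a2 : is_Gauss_2F1 F ->
  Rabs (Re nu) + 3 <= a1 -> Rabs (Re nu) + 3 <= a2 -> vanishes (Dfun F nu a1 a2).
Proof.
  intros HF H1 H2. destruct (large_Re nu a1 a2 H1 H2) as ([L1 _] & [L2 _] & _).
  apply vanishes_ext with (fun y => (a2 - 1)%R * Abeta F (a2 - 1)%R (a1 + a2 - 2) y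
   + (- (fcoef nu a1 a2 * ((a2 - 1)%R + nu))) * Abeta F ((a2 - 1)%R + nu) (a1 + a2 - 2) y)%C.
  - intros y; unfold Dfun; ring.
  - apply vanishes_plus; apply vanishes_scal, vanishes_Abeta; auto.
Qed.

Lemma Dfun_mirror_vanishes F nu a1 a2 : is_Gauss_2F1 F ->
  Rabs (Re nu) + 3 <= a1 -> Rabs (Re nu) + 3 <= a2 ->
  vanishes (fun y => Dfun F nu a1 a2 (- y) - Dlim F nu a1 a2)%C.
Proof.
  intros HF H1 H2. destruct (large_Re nu a1 a2 H1 H2) as (L1 & L2 & _).
  set (s := a1 + a2 - 2) in *.
  apply vanishes_ext with (fun y => (- (a2 - 1)%R) * Abeta F (s - (a2 - 1)%R) s y
   + (fcoef nu a1 a2 * ((a2 - 1)%R + nu)) * Abeta F (s - ((a2 - 1)%R + nu)) s y)%C.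
  - intros y; unfold Dfun, Dlim. fold s.
    rewrite <- (Abeta_reflection F (a2 - 1)%R s (- y) HF L2), <- (Abeta_reflection F ((a2 - 1)%R + nu)%C s (- y) HF L1).
    rewrite Ropp_involutive. ring.
  - apply vanishes_plus; apply vanishes_scal, vanishes_Abeta; auto.
    + change (0 < s - Re (RtoC (a2 - 1))). lra.
    + change (0 < s - Re ((a2 - 1)%R + nu)%C). lra.
Qed.

(** At the end of the line from which each comparison starts, [V * kint] tends to 0 because
    [Dfun - d] does, with [d = 0] on the left and [d = Dlim] on the right; [A_K * kint] tends to 0
    because [kint] decays faster than [A_K] can grow. *)
Lemma Vfun_estimates F nu K : is_Gauss_2F1 F ->
  exists M N A, 0 <= M /\ 0 <= N /\ Rabs (Re nu) + 3 <= A /\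
  forall a1 a2, A <= a1 -> A <= a2 ->
  (forall x, x <= 0 -> Cmod (Vfun F nu 0 a1 a2 x - Aapp nu (/ a1) (/ a2) K x)
      <= M * (1 / a1 + 1 / a2) ^ K * barrier N x) /\
  (forall x, 0 <= x -> Cmod (Vfun F nu (Dlim F nu a1 a2) a1 a2 x - Aapp nu (/ a1) (/ a2) K x)
      <= M * (1 / a1 + 1 / a2) ^ K * barrier N (- x)).
Proof.
  intros HF.
  destruct (residual_bound nu K) as (M & N & A & HM & HN & HA & HR).
  destruct (Aapp_bound nu K) as (M' & N' & HM' & HN' & HB).
  pose proof (Rabs_pos (Re nu)).
  (* Besides the threshold [A] of the residual, the summands keep clear of the Gamma poles, meet the
     hypothesis of the comparison lemmas, and let [kint] outweigh the growth [N'] of the partial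
     sum. *)
  exists (4 * M), N, (Rmax A (Rabs (Re nu) + 3 + 4 * (N + 3) + N')).
  split; [lra|split; [auto|split]].
  { eapply Rle_trans; [|apply Rmax_r]. lra. }
  intros a1 a2 Ha1 Ha2.
  pose proof (Rmax_l A (Rabs (Re nu) + 3 + 4 * (N + 3) + N')).
  pose proof (Rmax_r A (Rabs (Re nu) + 3 + 4 * (N + 3) + N')).
  set (e := 1 / a1 + 1 / a2).
  assert (Hu : 0 < / a1 <= 1).
  { split; [apply Rinv_0_lt_compat; lra|]. rewrite <- Rinv_1. apply Rinv_le_contravar; lra. }
  assert (Hv : 0 < / a2 <= 1).
  { split; [apply Rinv_0_lt_compat; lra|]. rewrite <- Rinv_1. apply Rinv_le_contravar; lra. }
  assert (He : 0 < e) by (unfold e, Rdiv; lra).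
  set (kap := M * e ^ (K + 1)).
  assert (Hkap : 0 <= kap) by (apply Rmult_le_pos; auto; apply pow_le; lra).
  assert (Ekap : forall z, 4 * kap / e * z = 4 * M * e ^ K * z).
  { intros z. unfold kap. rewrite pow_add, pow_1. field. lra. }
  assert (HV : forall d x, exists dV, is_Cderive (Vfun F nu d a1 a2) x dV /\
     CLop a1 a2 x (Vfun F nu d a1 a2 x) dV =
     ((1 - (/ a2)%R) * gfun 0 a1 a2 - (1 + (nu - 1) * (/ a2)%R) * gfun nu a1 a2 * Cexp (nu * x))%C).
  { intros d x. apply Vfun_derive; auto; lra. }
  assert (HE : forall d, exists dE, forall x,
    is_Cderive (fun x => Vfun F nu d a1 a2 x - Aapp nu (/ a1) (/ a2) K x)%C x (dE x) /\
    Cmod (CLop a1 a2 x (Vfun F nu d a1 a2 x - Aapp nu (/ a1) (/ a2) K x)%C (dE x)) <= kap * exp (N * Rabs x)).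
  { intros d.
    exists (fun x => proj1_sig (constructive_indefinite_description _ (HV d x)) - Aapp_der nu (/ a1) (/ a2) K x)%C.
    intros x. destruct (constructive_indefinite_description _ (HV d x)) as (dV & D1 & D2). cbn [proj1_sig].
    split; [apply is_Cderive_minus; auto; apply is_Cderive_Aapp|].
    specialize (HR a1 a2 x ltac:(lra) ltac:(lra)). rewrite <- D2 in HR.
    replace (CLop a1 a2 x (Vfun F nu d a1 a2 x - Aapp nu (/ a1) (/ a2) K x)%C
       (dV - Aapp_der nu (/ a1) (/ a2) K x)%C) with
      (CLop a1 a2 x (Vfun F nu d a1 a2 x) dV - CLop a1 a2 x (Aapp nu (/ a1) (/ a2) K x) (Aapp_der nu (/ a1) (/ a2) K x))%C
      by (unfold CLop; ring).
    exact HR. }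
  assert (HAM : forall x, Cmod (Aapp nu (/ a1) (/ a2) K x) <= Cmod M' * exp (N' * Rabs x)).
  { intros x. rewrite Cmod_R, Rabs_pos_eq by auto. apply HB; lra. }
  assert (Hc : 0 <= (a1 - 1) / a1 <= 1).
  { split; [apply Rdiv_le_0_compat; lra|]. apply Rmult_le_reg_r with a1; [lra|]. field_simplify; lra. }
  split; intros x Hx.
  - destruct (HE 0) as (dE & HdE). rewrite <- Ekap.
    apply (comparison_left a1 a2 N kap (fun x => Vfun F nu 0 a1 a2 x - Aapp nu (/ a1) (/ a2) K x)%C dE); auto; try lra.
    + intros t _; apply HdE.
    + intros t Ht. eapply Rle_trans; [apply HdE|]. rewrite Rabs_left1 by lra.
      right; f_equal; f_equal; ring.
    + intros eta t Heta.
      destruct (vanishes_small _ (eta / 2) (Dfun_vanishes F nu a1 a2 HF ltac:(lra) ltac:(lra)) ltac:(lra)) as [y1 Hy1].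
      destruct (kint_decay_left a1 a2 M' N' (eta / 2) t ltac:(lra) ltac:(lra) ltac:(lra) ltac:(lra)) as [y2 Hy2].
      set (l := ln (a2 / a1)).
      set (y := Rmin (Rmin (y1 - l) y2) (Rmin t 0)).
      assert (Hy : y <= y1 - l /\ y <= y2 /\ y <= t /\ y <= 0).
      { unfold y. pose proof (Rmin_l (Rmin (y1 - l) y2) (Rmin t 0)); pose proof (Rmin_r (Rmin (y1 - l) y2) (Rmin t 0)).
        pose proof (Rmin_l (y1 - l) y2); pose proof (Rmin_r (y1 - l) y2).
        pose proof (Rmin_l t 0); pose proof (Rmin_r t 0). lra. }
      exists y; split; [lra|].
      pose proof (kint_pos a1 a2 y).
      apply Rle_trans with ((Cmod (Vfun F nu 0 a1 a2 y) + Cmod (Aapp nu (/ a1) (/ a2) K y)) * kint a1 a2 y).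
      * apply Rmult_le_compat_r; [lra|apply Cmod_sub_le].
      * rewrite Rmult_plus_distr_r, Vfun_Cmod by lra. fold l.
        specialize (Hy1 (y + l) ltac:(lra)). specialize (Hy2 y ltac:(lra) ltac:(lra) ltac:(lra)).
        replace (Dfun F nu a1 a2 (y + l) - 0)%C with (Dfun F nu a1 a2 (y + l)) by ring.
        pose proof (Cmod_ge_0 (Dfun F nu a1 a2 (y + l))).
        assert (Cmod (Aapp nu (/ a1) (/ a2) K y) * kint a1 a2 y <= Cmod M' * exp (N' * Rabs y) * kint a1 a2 y).
        { apply Rmult_le_compat_r; [lra|auto]. }
        nra.
  - set (D0 := Dlim F nu a1 a2). destruct (HE D0) as (dE & HdE). rewrite <- Ekap.
    apply (comparison_right a1 a2 N kap (fun x => Vfun F nu D0 a1 a2 x - Aapp nu (/ a1) (/ a2) K x)%C dE); auto; try lra.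
    + intros t _; apply HdE.
    + intros t Ht. eapply Rle_trans; [apply HdE|]. rewrite Rabs_pos_eq by lra. lra.
    + intros eta t Heta.
      destruct (vanishes_small _ (eta / 2) (Dfun_mirror_vanishes F nu a1 a2 HF ltac:(lra) ltac:(lra)) ltac:(lra)) as [y1 Hy1].
      (* [kint_mirror] carries the factor [a1 / a2] and one exponential, which explains the weight
         of [eta] and the increase of [N'] by 1. *)
      destruct (kint_decay_left a2 a1 M' (N' + 1) (eta / 2 * (a1 / a2)) (- t)) as [y2 Hy2]; try lra.
      { apply Rmult_lt_0_compat; [lra|apply Rdiv_lt_0_compat; lra]. }
      set (l := ln (a2 / a1)).
      set (y := Rmin (Rmin (y1 + l) y2) (Rmin (- t) 0)).
      assert (Hy : y <= y1 + l /\ y <= y2 /\ y <= - t /\ y <= 0).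
      { unfold y. pose proof (Rmin_l (Rmin (y1 + l) y2) (Rmin (- t) 0)); pose proof (Rmin_r (Rmin (y1 + l) y2) (Rmin (- t) 0)).
        pose proof (Rmin_l (y1 + l) y2); pose proof (Rmin_r (y1 + l) y2).
        pose proof (Rmin_l (- t) 0); pose proof (Rmin_r (- t) 0). lra. }
      exists (- y); split; [lra|].
      pose proof (kint_pos a1 a2 (- y)).
      apply Rle_trans with ((Cmod (Vfun F nu D0 a1 a2 (- y)) + Cmod (Aapp nu (/ a1) (/ a2) K (- y))) * kint a1 a2 (- y)).
      * apply Rmult_le_compat_r; [lra|apply Cmod_sub_le].
      * rewrite Rmult_plus_distr_r, Vfun_Cmod by lra. fold l.
        specialize (Hy1 (y - l) ltac:(lra)). specialize (Hy2 y ltac:(lra) ltac:(lra) ltac:(lra)).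
        replace (- y + l) with (- (y - l)) by ring. fold D0 in Hy1.
        pose proof (Cmod_ge_0 (Dfun F nu a1 a2 (- (y - l)) - D0)).
        assert (Cmod (Aapp nu (/ a1) (/ a2) K (- y)) * kint a1 a2 (- y) <= eta / 2).
        { pose proof (kint_mirror a1 a2 (- y) ltac:(lra) ltac:(lra)) as KM.
          rewrite Ropp_involutive in KM.
          rewrite KM in Hy2.
          apply Rle_trans with (Cmod M' * exp (N' * Rabs (- y)) * kint a1 a2 (- y)).
          - apply Rmult_le_compat_r; [lra|auto].
          - apply Rmult_le_reg_r with (a1 / a2); [apply Rdiv_lt_0_compat; lra|].
            eapply Rle_trans; [|exact Hy2]. right.
            rewrite Rabs_Ropp, Rabs_left1 by lra.
            replace ((N' + 1) * - y) with (N' * - y + - y) by ring. rewrite exp_plus.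
            assert (exp y * exp (- y) = 1) by (rewrite <- exp_plus, Rplus_opp_r; apply exp_0).
            replace (Cmod M' * (exp (N' * - y) * exp (- y)) * (a1 / a2 * exp y * kint a1 a2 (- y)))
              with (Cmod M' * exp (N' * - y) * kint a1 a2 (- y) * (a1 / a2) * (exp y * exp (- y))) by ring.
            rewrite H4. ring. }
        nra.
Qed.

(** * Vanishing of the constant *)

(** Division by the first term of [Dlim] removes the common Gamma factor and leaves a quantity that
    does not change when both parameters are raised by 1. *)
Definition Dratio F (nu : C) (a1 a2 : R) : C :=
  (Dlim F nu a1 a2 / ((a2 - 1)%R * beta F (a2 - 1)%R (a1 + a2 - 2)))%C.

Lemma beta_nz F (p s : R) : is_Gauss_2F1 F -> 0 < p < s -> beta F p s <> 0.
Proof.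
  intros HF Hp E. pose proof (beta_lower F p s 0 HF Hp) as L. rewrite E, Cmod_0 in L.
  pose proof (exp_pos (p * 0)); pose proof (kern_pos s 0). nra.
Qed.

Lemma poch_shift (a : R) (w : C) : 0 < a -> 0 < Re (a + w)%C ->
  poch (a + 1) w = (poch a w * ((a + w) / a))%C.
Proof.
  intros Ha Hw. unfold poch.
  replace (RtoC a + 1 + w)%C with (a + w + 1)%C by ring.
  assert (P1 : nonpole a) by (apply nonpole_Re; simpl; lra).
  rewrite !CGamma_S by (auto using nonpole_Re).
  pose proof (CGamma_nz _ P1). assert (RtoC a <> 0) by (apply RtoC_nz; lra).
  cfield; auto.
Qed.

(** By [beta_rec] and the functional equation of Gamma, both terms of [Dlim] acquire the same factor
    [(a1 - 1) a2 / (s (s + 1))], where [s = a1 + a2 - 2]. *)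
Lemma Dratio_shift F nu a1 a2 : is_Gauss_2F1 F ->
  Rabs (Re nu) + 3 <= a1 -> Rabs (Re nu) + 3 <= a2 ->
  Dratio F nu (a1 + 1) (a2 + 1) = Dratio F nu a1 a2.
Proof.
  intros HF H1 H2. pose proof (Rabs_pos (Re nu)).
  destruct (large_Re nu a1 a2 H1 H2) as (L1 & L2 & L3 & L4).
  unfold Dratio, Dlim.
  set (p0 := RtoC (a2 - 1)) in *. set (p1 := (p0 + nu)%C) in *. set (s := a1 + a2 - 2) in *.
  replace (a1 + 1 + (a2 + 1) - 2) with (s + 1 + 1) by (unfold s; ring).
  replace (RtoC (a2 + 1 - 1)) with (p0 + 1)%C by (unfold p0; rewrite <- RtoC_plus; apply f_equal; ring).
  replace (p0 + 1 + nu)%C with (p1 + 1)%C by (unfold p1; ring).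
  assert (Ns : RtoC s <> 0) by (apply RtoC_nz; unfold s; lra).
  assert (Ns1 : (s + 1)%C <> 0) by (rewrite <- RtoC_plus; apply RtoC_nz; unfold s; lra).
  assert (R0 : beta F (p0 + 1) (s + 1 + 1) = (p0 * (s - p0) * beta F p0 s / (s * (s + 1)))%C).
  { rewrite <- (beta_rec F p0 s HF L2). field; auto. }
  assert (R1 : beta F (p1 + 1) (s + 1 + 1) = (p1 * (s - p1) * beta F p1 s / (s * (s + 1)))%C).
  { rewrite <- (beta_rec F p1 s HF L1). field; auto. }
  rewrite R0, R1.
  assert (N0 : p0 <> 0) by (apply RtoC_nz; lra).
  assert (N0' : (p0 + 1)%C <> 0) by (unfold p0; rewrite <- RtoC_plus; apply RtoC_nz; lra).
  assert (E0 : (s - p0)%C = (a1 - 1)%C) by (unfold p0, s; rewrite !RtoC_minus, !RtoC_plus; ring).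
  assert (E1 : (s - p1)%C = (a1 - 1 - nu)%C) by (unfold p1; rewrite <- E0; ring).
  assert (Ea2 : RtoC a2 = (p0 + 1)%C) by (unfold p0; rewrite <- RtoC_plus; apply f_equal; ring).
  rewrite E0, E1.
  assert (Nb : beta F p0 s <> 0) by (apply beta_nz; auto; unfold s; lra).
  assert (Nq0 : (a1 - 1)%C <> 0) by (rewrite <- RtoC_minus; apply RtoC_nz; lra).
  assert (Nq1 : (a1 - 1 - nu)%C <> 0) by (intros E; rewrite E in L3; simpl in L3; lra).
  assert (Np1 : (p1 + 1)%C <> 0).
  { replace (p1 + 1)%C with (a2 + nu)%C by (rewrite Ea2; unfold p1; ring).
    intros E; rewrite E in L4; simpl in L4; lra. }
  assert (Ef : fcoef nu (a1 + 1) (a2 + 1) =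
     (fcoef nu a1 a2 * ((a1 - 1) * (p0 + 1) / ((a1 - 1 - nu) * (p1 + 1))))%C).
  { unfold fcoef.
    replace (RtoC (a1 + 1) - 1)%C with (RtoC (a1 - 1) + 1)%C by (rewrite RtoC_plus, RtoC_minus; ring).
    rewrite (RtoC_plus a2 1), <- (RtoC_minus a1 1), !poch_shift.
    - rewrite RtoC_minus, Ea2.
      assert (P1 : poch (a1 - 1) (- nu) <> 0).
      { unfold poch, Cdiv. apply Cmult_neq_0; [|apply Cinv_neq_0]; apply CGamma_nz, nonpole_Re.
        - exact L3.
        - change (0 < a1 - 1); lra. }
      assert (P2 : poch a2 nu <> 0).
      { unfold poch, Cdiv. apply Cmult_neq_0; [|apply Cinv_neq_0]; apply CGamma_nz, nonpole_Re.
        - exact L4.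
        - change (0 < a2); lra. }
      rewrite Ea2 in P2.
      replace (p0 + 1 + nu)%C with (p1 + 1)%C by (unfold p1; ring).
      change (a1 - 1 + - nu)%C with (a1 - 1 - nu)%C.
      revert P1 P2 Nq0 Nq1 Np1 N0'. clear.
      generalize (poch (a1 - 1) (- nu)) (poch (p0 + 1) nu) (a1 - 1 - nu)%C (p1 + 1)%C (p0 + 1)%C.
      generalize (a1 - 1)%C. intros. cfield. auto 10.
    - first [lra|exact L4|rewrite RtoC_minus; exact L3].
    - first [lra|exact L4|rewrite RtoC_minus; exact L3].
    - first [lra|exact L4|rewrite RtoC_minus; exact L3].
    - first [lra|exact L4|rewrite RtoC_minus; exact L3]. }
  rewrite Ef. cfield. repeat split; auto.
Qed.

(** At [x = 0] the solutions for [d = 0] and [d = Dlim] are both close to the same partial sum, so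
    their difference, a multiple of [Dlim / kint], is small. Order 1 suffices, as the bound only has
    to tend to 0 along the shifts; [Dratio], being invariant under them, is then 0. *)
Lemma Dratio_zero F nu : is_Gauss_2F1 F -> exists A, Rabs (Re nu) + 3 <= A /\
  forall a1 a2, A <= a1 -> A <= a2 -> Dlim F nu a1 a2 = 0.
Proof.
  intros HF. destruct (Vfun_estimates F nu 1 HF) as (M & N & A & HM & HN & HA & HE).
  pose proof (Rabs_pos (Re nu)).
  set (B := M * barrier N 0 * 2).
  assert (HB0 := barrier_pos N 0 HN).
  assert (HB : 0 <= B) by (unfold B; apply Rmult_le_pos; [apply Rmult_le_pos|]; lra).
  assert (key : forall a1 a2, A <= a1 -> A <= a2 ->
    Cmod (Dratio F nu a1 a2) <= 2 * B * (1 / a1 + 1 / a2) * (1 + a2 / a1)).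
  { intros a1 a2 H1 H2. destruct (HE a1 a2 H1 H2) as [EL ER].
    specialize (EL 0 (Rle_refl 0)). specialize (ER 0 (Rle_refl 0)). rewrite Ropp_0 in ER.
    rewrite pow_1 in EL, ER.
    set (e := 1 / a1 + 1 / a2) in *.
    set (V0 := Vfun F nu 0 a1 a2 0) in *. set (D0 := Dlim F nu a1 a2) in *.
    set (V1 := Vfun F nu D0 a1 a2 0) in *.
    assert (ED : (((a1 - 1) / a1)%R * D0 * (/ kint a1 a2 0)%R)%C = (V0 - V1)%C).
    { unfold V0, V1, Vfun. ring. }
    assert (EC : Cmod (V0 - V1) <= B * e).
    { set (A0 := Aapp nu (/ a1) (/ a2) 1 0) in *.
      replace (V0 - V1)%C with ((V0 - A0) - (V1 - A0))%C by ring.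
      eapply Rle_trans; [apply Cmod_sub_le|]. unfold B. lra. }
    rewrite <- ED, !Cmod_mult, !Cmod_R in EC.
    pose proof (kint_pos a1 a2 0) as Kp.
    assert (0 < / kint a1 a2 0) by now apply Rinv_0_lt_compat.
    assert (Hc : 1 / 2 <= (a1 - 1) / a1).
    { apply Rmult_le_reg_r with a1; [lra|]. field_simplify; lra. }
    rewrite !Rabs_pos_eq in EC by lra.
    assert (HD : Cmod D0 <= 2 * B * e * kint a1 a2 0).
    { apply Rmult_le_reg_r with (/ kint a1 a2 0); auto.
      rewrite (Rmult_assoc _ (kint a1 a2 0)), Rinv_r, Rmult_1_r by lra.
      assert (0 <= Cmod D0 * / kint a1 a2 0) by (apply Rmult_le_pos; [apply Cmod_ge_0|lra]). nra. }
    unfold Dratio. fold D0.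
    set (s := a1 + a2 - 2). set (l := ln (a2 / a1)).
    (* The lower bound is taken at [y = l], the point corresponding to [x = 0]: there the density is
       [kint] divided by [1 + a2 / a1], which bounds [kint] by the normalising term of [Dratio]. *)
    assert (LB := beta_lower F (a2 - 1) s l HF ltac:(unfold s; lra)).
    assert (Ek : kint a1 a2 0 = exp ((a2 - 1) * l) * kern s l * (1 + a2 / a1)).
    { unfold kint. fold l. rewrite Rplus_0_l. replace (a1 + a2 - 3) with (s + -1) by (unfold s; ring).
      rewrite kern_plus, kern_m1.
      replace (exp l) with (a2 / a1) by (unfold l; rewrite exp_ln; auto; apply Rdiv_lt_0_compat; lra). ring. }
    assert (Hr : 0 < a2 / a1) by (apply Rdiv_lt_0_compat; lra).
    assert (Nb : beta F (a2 - 1)%R s <> 0) by (apply beta_nz; auto; unfold s; lra).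
    assert (Pb : 0 < Cmod (beta F (a2 - 1)%R s)) by now apply Cmod_gt_0.
    rewrite Cmod_div by (apply Cmult_neq_0; auto; apply RtoC_nz; lra).
    rewrite Cmod_mult, Cmod_R, Rabs_pos_eq by lra.
    set (bb := (a2 - 1) * Cmod (beta F (a2 - 1)%R s)) in *.
    assert (Hbb : 0 < bb) by (unfold bb; apply Rmult_lt_0_compat; lra).
    apply Rmult_le_reg_r with bb; auto.
    unfold Rdiv at 1. rewrite Rmult_assoc, Rinv_l, Rmult_1_r by lra.
    eapply Rle_trans; [exact HD|]. rewrite Ek.
    assert (0 <= 2 * B * e * (1 + a2 / a1)).
    { assert (0 < / a1) by (apply Rinv_0_lt_compat; lra). assert (0 < / a2) by (apply Rinv_0_lt_compat; lra).
      assert (0 <= e) by (unfold e, Rdiv; lra). apply Rmult_le_pos; [apply Rmult_le_pos|]; lra. }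
    replace (2 * B * e * (exp ((a2 - 1) * l) * kern s l * (1 + a2 / a1)))
      with (2 * B * e * (1 + a2 / a1) * (exp ((a2 - 1) * l) * kern s l)) by ring.
    apply Rmult_le_compat_l; auto. }
  exists A; split; auto. intros a1 a2 H1 H2.
  assert (Sh : forall n, Dratio F nu (a1 + INR n) (a2 + INR n) = Dratio F nu a1 a2).
  { induction n as [|n IH].
    - simpl INR. now rewrite !Rplus_0_r.
    - rewrite S_INR, <- !Rplus_assoc, Dratio_shift; auto; pose proof (pos_INR n); lra. }
  assert (HZ : Dratio F nu a1 a2 = 0).
  { apply Cmod_eq_0. destruct (Req_dec (Cmod (Dratio F nu a1 a2)) 0) as [E|E]; auto. exfalso.
    set (eta := Cmod (Dratio F nu a1 a2)) in *. assert (Heta : 0 < eta) by (pose proof (Cmod_ge_0 (Dratio F nu a1 a2)); fold eta in H0; lra).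
    set (r := 1 + a2 / a1). assert (Hr : 1 < r) by (unfold r; assert (0 < a2 / a1) by (apply Rdiv_lt_0_compat; lra); lra).
    set (Q := 2 * B * 2 * (1 + r)).
    destruct (INR_unbounded (Q / eta + 1)) as [n Hn].
    assert (HQ : 0 <= Q) by (unfold Q; apply Rmult_le_pos; lra).
    assert (0 <= Q / eta) by (apply Rdiv_le_0_compat; lra).
    specialize (key (a1 + INR n) (a2 + INR n) ltac:(lra) ltac:(lra)). rewrite Sh in key. fold eta in key.
    assert (I1 : 0 < / INR n) by (apply Rinv_0_lt_compat; lra).
    assert (e1 : 1 / (a1 + INR n) <= / INR n) by (unfold Rdiv; rewrite Rmult_1_l; apply Rinv_le_contravar; lra).
    assert (e2 : 1 / (a2 + INR n) <= / INR n) by (unfold Rdiv; rewrite Rmult_1_l; apply Rinv_le_contravar; lra).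
    assert (p1 : 0 < 1 / (a1 + INR n)) by (apply Rdiv_lt_0_compat; lra).
    assert (p2 : 0 < 1 / (a2 + INR n)) by (apply Rdiv_lt_0_compat; lra).
    (* Adding [n] to both parameters keeps their quotient below [1 + a2 / a1], so the factor in
       [key] stays bounded while the sum of reciprocals tends to 0. *)
    assert (e3 : (a2 + INR n) / (a1 + INR n) <= r).
    { apply Rmult_le_reg_r with (a1 + INR n); [lra|].
      unfold Rdiv at 1. rewrite Rmult_assoc, Rinv_l, Rmult_1_r by lra.
      unfold r. assert (a2 / a1 * a1 = a2) by (field; lra).
      assert (0 < a2 / a1) by (apply Rdiv_lt_0_compat; lra). nra. }
    assert (p3 : 0 < (a2 + INR n) / (a1 + INR n)) by (apply Rdiv_lt_0_compat; lra).
    assert (eta <= Q * / INR n).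
    { eapply Rle_trans; [exact key|]. unfold Q.
      replace (2 * B * 2 * (1 + r) * / INR n) with (2 * B * (2 * / INR n) * (1 + r)) by ring.
      apply Rmult_le_compat; [apply Rmult_le_pos; lra|lra|apply Rmult_le_compat_l; lra|lra]. }
    assert (Q * / INR n < eta); [|lra].
    apply Rmult_lt_reg_r with (INR n); [lra|]. rewrite Rmult_assoc, Rinv_l, Rmult_1_r by lra.
    assert (eta * (Q / eta + 1) < eta * INR n) by (apply Rmult_lt_compat_l; lra).
    assert (eta * (Q / eta + 1) = Q + eta) by (field; lra). lra. }
  assert (Nb : beta F (a2 - 1)%R (a1 + a2 - 2) <> 0) by (apply beta_nz; auto; lra).
  assert (Np : RtoC (a2 - 1) <> 0) by (apply RtoC_nz; lra).
  unfold Dratio in HZ.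
  replace (Dlim F nu a1 a2) with (Dlim F nu a1 a2 / ((a2 - 1)%R * beta F (a2 - 1)%R (a1 + a2 - 2))
    * ((a2 - 1)%R * beta F (a2 - 1)%R (a1 + a2 - 2)))%C by (field; auto).
  rewrite HZ; ring.
Qed.

(** * Identification of T_nu and conclusion *)

(** The kernel in [Abeta] has index [s - 1 = a1 + a2 - 3], the same as in [kint]; the quotient
    therefore strips off the weights and leaves the two Gauss functions, with [e^(nu y) = z^nu] in
    front of the second. *)
Lemma Tfun_eq F nu Y1 Y2 a1 a2 : is_Gauss_2F1 F -> 0 < Y1 -> 0 < Y2 ->
  Rabs (Re nu) + 3 <= a1 -> Rabs (Re nu) + 3 <= a2 ->
  Tfun F nu Y1 Y2 a1 a2 = (/ Y1 * Vfun F nu 0 a1 a2 (ln (Y2 / Y1)))%C.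
Proof.
  intros HF HY1 HY2 H1 H2. pose proof (Rabs_pos (Re nu)).
  destruct (large_Re nu a1 a2 H1 H2) as ([L1 _] & [L2 _] & _ & _).
  unfold Tfun, Vfun, Dfun, Abeta.
  set (x := ln (Y2 / Y1)). set (l := ln (a2 / a1)). set (y := x + l).
  assert (Ez : a2 * Y2 / (a1 * Y1) = exp y).
  { unfold y, x, l. rewrite exp_plus, !exp_ln by (apply Rdiv_lt_0_compat; lra). field; lra. }
  rewrite Ez. unfold kint. fold l y.
  set (p0 := RtoC (a2 - 1)) in *. set (p1 := (p0 + nu)%C) in *. set (s := a1 + a2 - 2) in *.
  replace (1 - s + p0)%C with (2 - a1)%C by (unfold p0, s; rewrite !RtoC_minus, RtoC_plus; ring).
  replace (p0 + 1)%C with (RtoC a2) by (unfold p0; rewrite RtoC_minus; ring).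
  replace (1 - s + p1)%C with (2 - a1 + nu)%C by (unfold p1, p0, s; rewrite !RtoC_minus, RtoC_plus; ring).
  replace (p1 + 1)%C with (a2 + nu)%C by (unfold p1, p0; rewrite RtoC_minus; ring).
  replace (s - 1) with (a1 + a2 - 3) by (unfold s; ring).
  set (X0 := F 1 (2 - a1)%C a2 (- exp y)%C). set (X1 := F 1 (2 - a1 + nu)%C (a2 + nu)%C (- exp y)%C).
  replace (Cexp (p0 * y)) with (RtoC (exp ((a2 - 1) * y))).
  2:{ unfold p0; rewrite <- RtoC_mult, Cexp_RtoC; auto. }
  replace (Cexp (p1 * y)) with (RtoC (exp ((a2 - 1) * y)) * Rcpow (exp y) nu)%C.
  2:{ unfold Rcpow. rewrite ln_exp, <- Cexp_RtoC, <- Cexp_plus. apply (f_equal Cexp).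
      unfold p1, p0. rewrite RtoC_mult; ring. }
  unfold fcoef.
  pose proof (exp_pos ((a2 - 1) * y)). pose proof (kern_pos (a1 + a2 - 3) y).
  rewrite RtoC_inv, !RtoC_mult by nra.
  rewrite !RtoC_div, !RtoC_mult by nra.
  assert (RtoC (exp ((a2 - 1) * y)) <> 0) by (apply RtoC_nz; lra).
  assert (RtoC (kern (a1 + a2 - 3) y) <> 0) by (apply RtoC_nz; lra).
  assert (RtoC a1 <> 0) by (apply RtoC_nz; lra).
  assert (RtoC Y1 <> 0) by (apply RtoC_nz; lra).
  assert (p0 <> 0) by (intros E; rewrite E in L2; simpl in L2; lra).
  assert (p1 <> 0) by (intros E; rewrite E in L1; simpl in L1; lra).
  set (Z := (/ (poch (a1 - 1) (- nu) * poch a2 nu))%C).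
  replace (Rcpow (exp y) nu / (poch (a1 - 1) (- nu) * poch a2 nu))%C with (Rcpow (exp y) nu * Z)%C by reflexivity.
  cfield. auto 10.
Qed.

Theorem theorem6 :
  forall F : C -> C -> C -> C -> C, is_Gauss_2F1 F ->
  forall (Y1 Y2 : R) (nu : C), 0 < Y1 -> 0 < Y2 ->
  forall K : nat,
  exists M A : R, 0 < A /\
    forall a1 a2 : R, A <= a1 -> A <= a2 -> - a2 < Re nu < a1 ->
      Cmod (Tfun F nu Y1 Y2 a1 a2 - Tpartial nu Y1 Y2 a1 a2 K)
        <= M * (1 / a1 + 1 / a2) ^ (K + 1).
Proof.
  intros F HF Y1 Y2 nu HY1 HY2 K.
  destruct (Vfun_estimates F nu (K + 1) HF) as (M & N & A & HM & HN & HA & HE).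
  destruct (Dratio_zero F nu HF) as (A' & HA' & HD).
  destruct (diffop_Plist_bound nu (K + 1)) as (M' & N' & HM' & HN' & HP).
  set (x := ln (Y2 / Y1)).
  pose proof (Rabs_pos (Re nu)).
  exists (/ Y1 * (M * (barrier N x + barrier N (- x)) + M' * exp (N' * Rabs x))), (Rmax A A').
  split; [pose proof (Rmax_l A A'); lra|].
  intros a1 a2 H1 H2 _.
  pose proof (Rmax_l A A'); pose proof (Rmax_r A A').
  rewrite Tfun_eq, Tpartial_eq by (auto; lra). fold x.
  set (u := / a1). set (v := / a2). set (e := 1 / a1 + 1 / a2).
  assert (Hu : 0 < u) by (apply Rinv_0_lt_compat; lra).
  assert (Hv : 0 < v) by (apply Rinv_0_lt_compat; lra).
  assert (Ee : e = u + v) by (unfold e, u, v; field; lra).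
  (* The surplus term of index [K + 1] is homogeneous of that degree, hence itself [O(e^(K+1))], and
     joins the error. *)
  assert (EA : Aapp nu u v (K + 1) x = (Aapp nu u v K x + diffop (Plist u v (K + 1)) (fun l => lerch_der nu l x))%C).
  { unfold Aapp. rewrite Nat.add_1_r.
    change (plsum (Plist u v) (S (S K))) with (padd (plsum (Plist u v) (S K)) (Plist u v (S K))).
    apply diffop_padd. }
  assert (EV : Cmod (Vfun F nu 0 a1 a2 x - Aapp nu u v (K + 1) x) <= M * e ^ (K + 1) * (barrier N x + barrier N (- x))).
  { destruct (HE a1 a2 ltac:(lra) ltac:(lra)) as [EL ER].
    rewrite (HD a1 a2) in ER by lra.
    pose proof (barrier_pos N x HN); pose proof (barrier_pos N (- x) HN).
    assert (0 <= M * e ^ (K + 1)) by (apply Rmult_le_pos; auto; apply pow_le; lra).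
    destruct (Rle_lt_dec x 0).
    - eapply Rle_trans; [now apply EL|]. fold e. apply Rmult_le_compat_l; lra.
    - eapply Rle_trans; [apply ER; lra|]. fold e. apply Rmult_le_compat_l; lra. }
  specialize (HP u v e x ltac:(lra) ltac:(lra)).
  replace (/ Y1 * Vfun F nu 0 a1 a2 x - / Y1 * Aapp nu u v K x)%C
    with (/ Y1 * ((Vfun F nu 0 a1 a2 x - Aapp nu u v (K + 1) x) + diffop (Plist u v (K + 1)) (fun l => lerch_der nu l x)))%C
    by (rewrite EA; ring).
  assert (HY : 0 < / Y1) by now apply Rinv_0_lt_compat.
  rewrite <- RtoC_inv, Cmod_mult, Cmod_R, Rabs_pos_eq, !Rmult_assoc by lra.
  apply Rmult_le_compat_l; [lra|].
  eapply Rle_trans; [apply Cmod_triangle|]. lra.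
Qed.
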